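(* Let $G$ be a connected complex semisimple Lie group with Lie algebra $\mathfrak g$, let $M$ be a $G$-manifold with sheaf of functions $\mathcal A$, let $r$ be a classical r-matrix on $\mathfrak g$ and $U_h(\mathfrak g,r)$ the corresponding quantum group. Let $m_h=m_0+hm_1+o(h)$ be a $U_h(\mathfrak g,r)$-invariant associative quantization of $\mathcal A$. Then the corresponding Poisson bracket $p(a,b)=m_1(a,b)-m_1(b,a)$ has the form $$p(a,b)=f(a,b)-r_M(a,b),$$ where $f$ is a $\varphi$-bracket on $M$ with $\varphi=[\![r,r]\!]$.
   Context: **Quantum group.** A classical r-matrix is an element $r\in\wedge^2\mathfrak g$ whose Schouten bracket $\varphi=[\![r,r]\!]\in\wedge^3\mathfrak g$ is $\mathfrak g$-invariant. Let $\Delta$ and $\varepsilon$ be the usual comultiplication and counit of $U(\mathfrak g)$. The quantum group $U_h(\mathfrak g,r)$ is $U(\mathfrak g)[[h]]$ as a topological $\mathbb C[[h]]$-algebra, with counit the natural extension of $\varepsilon$ and comultiplication $\Delta_h(x)=F_h\Delta(x)F_h^{-1}$, where $F_h\in U(\mathfrak g)^{\otimes 2}[[h]]$ satisfies $F_h=1\otimes1+\frac h2 r+o(h)$, $(\varepsilon\otimes1)F_h=(1\otimes\varepsilon)F_h=1\otimes 1$ (i.e. is the unit), and $$(F_h\otimes1)\cdot(\Delta\otimes \mathrm{id})(F_h)=(1\otimes F_h)\cdot(\mathrm{id}\otimes\Delta)(F_h)\cdot\Phi_h$$ for an invariant element $\Phi_h\in U(\mathfrak g)^{\otimes3}[[h]]$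 with $\Phi_h=1\otimes1\otimes1+h^2\varphi+o(h^2)$ ($\varphi$ up to a normalizing scalar factor), chosen so that $\Phi_h\Phi_h^s=1$, where $\Phi_h^s=(s\otimes s\otimes s)(\Phi_h)$ and $s$ is the antipode of $U(\mathfrak g)$. **Quantizations.** $\mathcal A$ is the sheaf of analytic, smooth or algebraic functions on $M$ with usual multiplication $m_0$; $U(\mathfrak g)$ acts on $\mathcal A$, extended to an action of $U(\mathfrak g)[[h]]$ on $\mathcal A[[h]]$. A $U_h(\mathfrak g,r)$-invariant associative quantization of $\mathcal A$ is an associative $\mathbb C[[h]]$-linear multiplication $m_h=\sum_{k\ge0}h^km_k$ on $\mathcal A[[h]]$, with $m_0$ the usual multiplication and $m_k$, $k>0$, bidifferential operators vanishing on constants, such that $b\,m_h(x\otimes y)=m_h(\Delta_h(b)(x\otimes y))$ for $b\in U(\mathfrak g)$, $x,y\in\mathcal A$. **Brackets.** A bracket on $M$ is a skew-symmetric map $f:\mathcal A^{\otimes2}\to\mathcal A$ satisfying the Leibniz rule $f(ab,c)=af(b,c)+f(a,c)b$; brackets are identified with bivector fields on $M$. A bracket is Poisson if $[\![f,f]\!]=0$. For $\psi\in\wedge^k\mathfrak g$ (skew-symmetric tensors in $\mathfrak g^{\otimes k}$), $\psi_M$ is the $k$-vector field on $M$ induced by the action map $\mathfrak g\to\mathrm{Vect}(M)$ (given by the action of $\mathfrak g$ on $\mathcal A$ by derivations); in particular $r_M(a,b)=m_0(r(a\otimes b))$. For invariant $\varphi\in\wedge^3\mathfrak g$, a $\varphi$-bracket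 is a $G$-invariant bracket $f$ with $[\![f,f]\!]=-\varphi_M$, where $[\![\cdot,\cdot]\!]$ is the Schouten bracket, normalized on $\wedge^\bullet\mathfrak g$ and on polyvector fields in the same way (so that $\psi\mapsto\psi_M$ respects it).
   Formalization: For smooth functions, G is taken to be a connected real Lie group whose complexified Lie algebra is the semisimple g, since a complex G cannot act there with g acting complex-linearly and f G-invariant; in the analytic and algebraic cases G is complex as stated. *)

(* Defs.v *)
From HB Require Import structures.
From mathcomp Require Import all_boot all_order all_algebra.
From mathcomp Require Import all_classical all_reals all_analysis.
From mathcomp Require Import complex.
Set Implicit Arguments.
Unset Strict Implicit.
Unset Printing Implicit Defensive.
Import Order.TTheory GRing.Theory Num.Theory numFieldNormedType.Exports.
Local Open Scope classical_set_scope.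
Local Open Scope ring_scope.

(** * Spaces with a sheaf of complex-valued functions

   A section over [V] is a total function of which only the values on [V]
   matter: every notion below is invariant under [eq_on V].  Accordingly an
   operator (or a product) on the sheaf takes the open set as an argument. *)

Definition eq_on (T S : Type) (V : set T) (a b : T -> S) : Prop :=
  forall p, V p -> a p = b p.

Record space (R : realType) := Space {
  pt :> topologicalType;
  fn : set pt -> (pt -> R[i]) -> Prop;
  fn_open : forall V a, fn V a -> open V;
  fn_eq : forall V a b, fn V a -> eq_on V a b -> fn V b;
  fn_res : forall V W a, open W -> W `<=` V -> fn V a -> fn W a;
  fn_glue : forall V a, open V ->
    (forall p, V p -> exists W, [/\ W p, W `<=` V & fn W a]) -> fn V a;
  fn_cst : forall V c, open V -> fn V (fun=> c);
  fn_add : forall V a b, fn V a -> fn V b -> fn V (fun p => a p + b p);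
  fn_mul : forall V a b, fn V a -> fn V b -> fn V (fun p => a p * b p) }.

Arguments fn {R} s V a.

Definition op (R : realType) (X : space R) : Type :=
  set X -> (X -> R[i]) -> X -> R[i].

Definition biop (R : realType) (X : space R) : Type :=
  set X -> (X -> R[i]) -> (X -> R[i]) -> X -> R[i].

(* [xi] is a derivation of the restriction of the sheaf to [D]. *)
Definition derivation (R : realType) (X : space R) (D : set X) (xi : op X) :
    Prop :=
  [/\ forall V a, V `<=` D -> fn X V a -> fn X V (xi V a),
      forall V a b, V `<=` D -> fn X V a -> eq_on V a b ->
        eq_on V (xi V a) (xi V b),
      forall V W a, V `<=` D -> open W -> W `<=` V -> fn X V a ->
        eq_on W (xi W a) (xi V a),
      forall V (c : R[i]) a b, V `<=` D -> fn X V a -> fn X V b ->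
        eq_on V (xi V (fun p => c * a p + b p))
                (fun p => c * xi V a p + xi V b p) &
      forall V a b, V `<=` D -> fn X V a -> fn X V b ->
        eq_on V (xi V (fun p => a p * b p))
                (fun p => xi V a p * b p + a p * xi V b p)].

(** * Complex-analytic and smooth manifolds *)

Fixpoint diff_upto (K : numFieldType) (V W : normedModType K) (k : nat)
    (D : set V) (u : V -> W) : Prop :=
  if k is k'.+1 then
    (forall x, D x -> differentiable u x) /\
    (forall v : V, diff_upto k' D (fun x => 'D_v u x))
  else True.

Definition infinitely_diff (K : numFieldType) (V W : normedModType K)
    (D : set V) (u : V -> W) : Prop :=
  forall k, diff_upto k D u.

(* The local models: which C-valued functions on open subsets of a normed
   K-space are admitted, and their derivative along a vector. *)
Record diff_model (R : realType) := DiffModel {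
  dm_field : numFieldType;
  dm_fun : forall V : normedModType dm_field, set V -> (V -> R[i]) -> Prop;
  dm_deriv : forall V : normedModType dm_field,
    V -> (V -> R[i]) -> V -> R[i] }.

Arguments dm_fun {R} d {V}.
Arguments dm_deriv {R} d {V}.

(* Infinitely complex-differentiable functions, i.e. holomorphic ones. *)
Definition holomorphic_model (R : realType) : diff_model R :=
  @DiffModel R R[i]
    (fun V D u => @infinitely_diff R[i] V (R[i])^o D u)
    (fun V v u x => @derive R[i] V (R[i])^o u x v).

Definition smooth_model (R : realType) : diff_model R :=
  @DiffModel R R
    (fun V D u =>
       @infinitely_diff R V R^o D (fun x => complex.Re (u x)) /\
       @infinitely_diff R V R^o D (fun x => complex.Im (u x)))
    (fun V v u x =>
       (@derive R V R^o (fun y => complex.Re (u y)) x v +i*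
        @derive R V R^o (fun y => complex.Im (u y)) x v)%C).

Record chart (R : realType) (dm : diff_model R) (X : space R) (n : nat) :=
  Chart {
  ch_dom : set X;
  ch_map : X -> 'rV[dm_field dm]_n;
  ch_inv : 'rV[dm_field dm]_n -> X;
  ch_open : open ch_dom;
  ch_open_im : open (ch_map @` ch_dom);
  ch_mapK : forall p, ch_dom p -> ch_inv (ch_map p) = p;
  ch_cont : forall p, ch_dom p -> {for p, continuous ch_map};
  ch_inv_cont : forall p, ch_dom p -> {for ch_map p, continuous ch_inv};
  ch_fn : forall V a, open V -> V `<=` ch_dom ->
    (fn X V a <-> dm_fun dm (ch_map @` V) (fun z => a (ch_inv z))) }.

Definition manifold (R : realType) (dm : diff_model R) (X : space R) : Prop :=
  [/\ hausdorff_space X, @second_countable X &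
      forall p : X, exists n (c : chart dm X n), ch_dom c p].

(* The section [F] of the structure sheaf of the product X * Y over [D]. *)
Definition fn_prod (R : realType) (dm : diff_model R) (X Y : space R)
    (D : set (X * Y)) (F : X -> Y -> R[i]) : Prop :=
  open D /\
  forall x y, D (x, y) ->
    exists m n (c : chart dm X m) (d : chart dm Y n),
      [/\ ch_dom c x, ch_dom d y &
          dm_fun dm
            [set z : 'rV[dm_field dm]_m * 'rV[dm_field dm]_n |
              [/\ (ch_map c @` ch_dom c) z.1, (ch_map d @` ch_dom d) z.2 &
                  D (ch_inv c z.1, ch_inv d z.2)]]
            (fun z => F (ch_inv c z.1) (ch_inv d z.2))].

Definition coord_field (R : realType) (dm : diff_model R) (X : space R)
    (n : nat) (c : chart dm X n) (i : 'I_n) : op X :=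
  fun _ a p =>
    dm_deriv dm (delta_mx 0 i : 'rV_n) (fun z => a (ch_inv c z)) (ch_map c p).

(** * Smooth complex algebraic varieties *)

Inductive polyfun (R : realType) (n : nat) : ('rV[R[i]]_n -> R[i]) -> Prop :=
| polyfun_cst c : polyfun (fun=> c)
| polyfun_coord i : polyfun (fun z => z 0 i)
| polyfun_add P Q : polyfun P -> polyfun Q -> polyfun (fun z => P z + Q z)
| polyfun_mul P Q : polyfun P -> polyfun Q -> polyfun (fun z => P z * Q z).

(* An isomorphism of [ac_dom] with the standard smooth affine variety
   { P_1 = ... = P_k = 0, Q <> 0 }, with its Zariski topology and its regular
   functions; the Jacobian matrix of the P_i has rank k everywhere on it. *)
Record alg_chart (R : realType) (X : space R) (n : nat) := AlgChart {
  ac_dom : set X;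
  ac_map : X -> 'rV[R[i]]_n;
  ac_codim : nat;
  ac_eqs : 'I_ac_codim -> 'rV[R[i]]_n -> R[i];
  ac_ineq : 'rV[R[i]]_n -> R[i];
  ac_open : open ac_dom;
  ac_eqs_poly : forall i, polyfun (ac_eqs i);
  ac_ineq_poly : polyfun ac_ineq;
  ac_inj : forall p q, ac_dom p -> ac_dom q -> ac_map p = ac_map q -> p = q;
  ac_image : ac_map @` ac_dom =
    [set z | (forall i, ac_eqs i z = 0) /\ ac_ineq z != 0];
  ac_smooth : forall p, ac_dom p ->
    \rank (\matrix_(i < ac_codim, j < n)
      (@derive R[i] 'rV[R[i]]_n (R[i])^o (ac_eqs i) (ac_map p)
         (delta_mx 0 j) : R[i])) = ac_codim;
  ac_zariski : forall V, V `<=` ac_dom ->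
    (open V <-> forall p, V p -> exists H : 'rV[R[i]]_n -> R[i],
       [/\ polyfun H, H (ac_map p) != 0 &
           forall q, ac_dom q -> H (ac_map q) != 0 -> V q]);
  ac_fn : forall V a, open V -> V `<=` ac_dom ->
    (fn X V a <-> forall p, V p -> exists F H : 'rV[R[i]]_n -> R[i],
       [/\ polyfun F, polyfun H, H (ac_map p) != 0 &
           forall q, V q -> H (ac_map q) != 0 ->
             a q = F (ac_map q) / H (ac_map q)]) }.

(* The diagonal of X * X is closed for the Zariski topology of the product. *)
Definition separated (R : realType) (X : space R) : Prop :=
  forall p q : X, p <> q ->
    exists (V W : set X) (k : nat) (b c : 'I_k -> X -> R[i]),
      [/\ V p, W q, forall i, fn X V (b i) /\ fn X W (c i),
          \sum_i b i p * c i q != 0 &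
          forall x, V x -> W x -> \sum_i b i x * c i x = 0].

Definition smooth_variety (R : realType) (X : space R) : Prop :=
  [/\ compact [set: X], separated X &
      forall p : X, exists n (c : alg_chart X n), ac_dom c p].

(** * Lie groups and G-manifolds *)

Record group_law (T : Type) := GroupLaw {
  gmul : T -> T -> T;
  ginv : T -> T;
  gone : T;
  gmulA : forall x y z, gmul x (gmul y z) = gmul (gmul x y) z;
  gmul1 : forall x, gmul gone x = x;
  gmulV : forall x, gmul (ginv x) x = gone }.

Record lie_group (R : realType) (dm : diff_model R) := LieGroup {
  lg_space :> space R;
  lg_law : group_law lg_space;
  lg_manifold : manifold dm lg_space;
  lg_div : forall V u, fn lg_space V u ->
    fn_prod dm
      [set z : lg_space * lg_space | V (gmul lg_law z.1 (ginv lg_law z.2))]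
      (fun x y => u (gmul lg_law x (ginv lg_law y))) }.

(* Translation by [k] of open sets and of sections, (k.a)(p) = a(k^-1 p), for
   a group acting through [act]. *)
Definition tr_set (T S : Type) (gl : group_law T) (act : T -> S -> S) (k : T)
    (V : set S) : set S := [set p | V (act (ginv gl k) p)].

Definition tr_fun (T S Y : Type) (gl : group_law T) (act : T -> S -> S) (k : T)
    (a : S -> Y) : S -> Y := fun p => a (act (ginv gl k) p).

Definition left_invariant (R : realType) (dm : diff_model R)
    (G : lie_group dm) (xi : op G) : Prop :=
  let gl := lg_law G in
  forall k V u, fn G V u -> forall p, V p ->
    xi (tr_set gl (gmul gl) k V) (tr_fun gl (gmul gl) k u) (gmul gl k p)
    = xi V u p.

Record lie_algebra (F : fieldType) := LieAlgebra {
  la_sort :> vectType F;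
  br : la_sort -> la_sort -> la_sort;
  br_linear : forall x, linear (br x);
  br_alt : forall x, br x x = 0;
  br_jacobi : forall x y z, br x (br y z) + br y (br z x) + br z (br x y) = 0 }.

Arguments br {F l}.

Section Semisimple.
Context {F : fieldType} (g : lie_algebra F).

Definition lie_ideal (I : {vspace g}) : Prop :=
  forall x y : g, y \in I -> br x y \in I.

Definition derived_space (I : {vspace g}) : {vspace g} :=
  <<[seq br x y | x <- vbasis I, y <- vbasis I]>>%VS.

Definition solvable_space (I : {vspace g}) : Prop :=
  exists n, iter n derived_space I = 0%VS.

Definition semisimple : Prop :=
  forall I : {vspace g}, lie_ideal I -> solvable_space I -> I = 0%VS.

End Semisimple.

(* [la_field] identifies [la_alg] with the Lie algebra of all left-invariant
   derivations of the sheaf of C-valued functions of G.  For a complex Lie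
   group this is Lie(G); for a real one it is the complexification of Lie(G). *)
Record lie_algebra_of (R : realType) (dm : diff_model R) (G : lie_group dm) :=
  LieAlgebraOf {
  la_alg :> lie_algebra R[i];
  la_field : la_alg -> op G;
  la_field_der : forall x, derivation setT (la_field x);
  la_field_inv : forall x, left_invariant (la_field x);
  la_field_lin : forall (c : R[i]) x y V u, fn G V u ->
    eq_on V (la_field (c *: x + y) V u)
            (fun p => c * la_field x V u p + la_field y V u p);
  la_field_br : forall x y V u, fn G V u ->
    eq_on V (la_field (br x y) V u)
            (fun p => la_field x V (la_field y V u) p
                      - la_field y V (la_field x V u) p);
  la_field_inj : forall x,
    (forall V u, fn G V u -> eq_on V (la_field x V u) (fun=> 0)) -> x = 0;
  la_field_surj : forall xi, derivation setT xi -> left_invariant xi ->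
    exists x, forall V u, fn G V u -> eq_on V (xi V u) (la_field x V u) }.

(* The sheaf of functions of a G-manifold is one of these.  In the smooth
   category the connected group acting is a real Lie group whose complexified
   Lie algebra is g (a real form): the differential of an action by
   diffeomorphisms consists of real vector fields, so it can be C-linear on a
   complex Lie algebra only if it vanishes. *)
Inductive category := Analytic | Smooth | Algebraic.

Definition model_of (R : realType) (k : category) : diff_model R :=
  if k is Smooth then smooth_model R else holomorphic_model R.

(* Regular functions for the canonical algebraic structure of a complex
   semisimple group: its representative functions. *)
Definition regular_fun (R : realType) (dm : diff_model R) (G : lie_group dm)
    (u : G -> R[i]) : Prop :=
  fn G setT u /\
  exists (n : nat) (v w : 'I_n -> G -> R[i]),
    forall x y, u (gmul (lg_law G) x y) = \sum_i v i x * w i y.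

(* [act] is a morphism of algebraic varieties G * M -> M: near each point,
   the pullback of a regular function is a quotient of elements of
   C[G] (x) A(W), on a principal open subset of G * W. *)
Definition algebraic_action (R : realType) (dm : diff_model R)
    (G : lie_group dm) (M : space R) (act : G -> M -> M) : Prop :=
  forall V a, fn M V a -> forall x p, V (act x p) ->
    exists (W : set M) (n : nat) (u v : 'I_n -> G -> R[i])
           (b c : 'I_n -> M -> R[i]),
      [/\ W p,
          forall i, regular_fun (u i) /\ regular_fun (v i),
          forall i, fn M W (b i) /\ fn M W (c i),
          \sum_i v i x * c i p != 0 &
          forall y q, W q -> \sum_i v i y * c i q != 0 ->
            V (act y q) /\
            a (act y q) = (\sum_i u i y * b i q) / (\sum_i v i y * c i q)].

Record G_manifold (R : realType) (k : category)
    (G : lie_group (model_of R k)) := GManifold {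
  gm_space :> space R;
  gm_act : G -> gm_space -> gm_space;
  gm_act1 : forall p, gm_act (gone (lg_law G)) p = p;
  gm_actM : forall x y p,
    gm_act (gmul (lg_law G) x y) p = gm_act x (gm_act y p);
  gm_manifold :
    if k is Algebraic then smooth_variety gm_space
    else manifold (model_of R k) gm_space;
  gm_regular :
    if k is Algebraic then algebraic_action gm_act
    else forall V a, fn gm_space V a ->
      fn_prod (model_of R k) [set z : G * gm_space | V (gm_act z.1 z.2)]
        (fun x p => a (gm_act x p)) }.

(** * Universal enveloping algebra and tensor products *)

Definition alg_hom (F : fieldType) (A B : algType F) (f : A -> B) : Prop :=
  linear f /\ monoid_morphism f.

Definition bilinear_map (F : fieldType) (A B V : lmodType F)
    (f : A -> B -> V) : Prop :=
  (forall a, linear (f a)) /\ (forall b, linear (f^~ b)).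

Definition lie_hom (F : fieldType) (g : lie_algebra F) (A : algType F)
    (f : g -> A) : Prop :=
  linear f /\ forall x y, f (br x y) = f x * f y - f y * f x.

Record enveloping (F : fieldType) (g : lie_algebra F) := Enveloping {
  ug_alg :> algType F;
  ug_in : g -> ug_alg;
  ug_lift : forall A : algType F, (g -> A) -> ug_alg -> A;
  ug_in_hom : lie_hom ug_in;
  ug_lift_hom : forall (A : algType F) (f : g -> A),
    lie_hom f -> alg_hom (ug_lift f);
  ug_liftE : forall (A : algType F) (f : g -> A),
    lie_hom f -> forall x, ug_lift f (ug_in x) = f x;
  ug_lift_uniq : forall (A : algType F) (f : g -> A) (h : ug_alg -> A),
    lie_hom f -> alg_hom h -> (forall x, h (ug_in x) = f x) ->
    h =1 ug_lift f }.

Arguments ug_in {F g}.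

Record tensor_product (F : fieldType) (A B : algType F) := TensorProduct {
  tp_alg :> algType F;
  tens : A -> B -> tp_alg;
  tp_lift : forall V : lmodType F, (A -> B -> V) -> tp_alg -> V;
  tens_bilinear : bilinear_map tens;
  tens1 : tens 1 1 = 1;
  tensM : forall a a' b b', tens a b * tens a' b' = tens (a * a') (b * b');
  tp_lift_linear : forall (V : lmodType F) (f : A -> B -> V),
    bilinear_map f -> linear (tp_lift f);
  tp_liftE : forall (V : lmodType F) (f : A -> B -> V),
    bilinear_map f -> forall a b, tp_lift f (tens a b) = f a b;
  tp_lift_uniq : forall (V : lmodType F) (f : A -> B -> V) (h : tp_alg -> V),
    bilinear_map f -> linear h -> (forall a b, h (tens a b) = f a b) ->
    h =1 tp_lift f }.

Arguments tens {F A B}.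
Arguments tp_lift {F A B} t {V}.

(** * Skew-symmetric tensors over g and classical r-matrices *)

Section Tensors.
Context {F : fieldType} (g : lie_algebra F).

Definition dimg : nat := \dim {:g}.
Definition basg (i : 'I_dimg) : g := (vbasis {:g})`_i.

(* Coordinates in the basis of g of elements of g (x) g and g (x) g (x) g *)
Definition tensor2 : Type := 'I_dimg -> 'I_dimg -> F.
Definition tensor3 : Type := 'I_dimg -> 'I_dimg -> 'I_dimg -> F.

Definition struct_cst (i k p : 'I_dimg) : F :=
  coord (vbasis {:g}) p (br (basg i) (basg k)).

Definition skew2 (r : tensor2) : Prop := forall i j, r j i = - r i j.

(* [r12, s13] + [r12, s23] + [r13, s23] *)
Definition yang_baxter (r s : tensor2) : tensor3 := fun p q t =>
  \sum_i \sum_k r i q * s k t * struct_cst i k p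
  + \sum_j \sum_k r p j * s k t * struct_cst j k q
  + \sum_j \sum_l r p j * s q l * struct_cst j l t.

(* With X /\ Y = X (x) Y - Y (x) X this is the symmetric bilinear map with
   [[X1 /\ X2, Y1 /\ Y2]] = [X1,Y1] /\ X2 /\ Y2 - [X1,Y2] /\ X2 /\ Y1
                            - [X2,Y1] /\ X1 /\ Y2 + [X2,Y2] /\ X1 /\ Y1. *)
Definition schouten (r s : tensor2) : tensor3 := fun p q t =>
  yang_baxter r s p q t + yang_baxter s r p q t.

Definition invariant3 (phi : tensor3) : Prop :=
  forall (x : g) p q t,
    \sum_i phi i q t * coord (vbasis {:g}) p (br x (basg i))
    + \sum_i phi p i t * coord (vbasis {:g}) q (br x (basg i))
    + \sum_i phi p q i * coord (vbasis {:g}) t (br x (basg i)) = 0.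

Definition classical_rmatrix (r : tensor2) : Prop :=
  skew2 r /\ invariant3 (schouten r r).

End Tensors.

(** * The quantum group U_h(g, r) *)

(* A formal power series in h is the sequence of its coefficients. *)
Definition psmul (A : pzRingType) (x y : nat -> A) (n : nat) : A :=
  \sum_(i < n.+1) x i * y (n - i)%N.

Definition psone (A : pzRingType) (n : nat) : A := (n == 0)%:R.

Section QuantumGroup.
Context {F : fieldType} {g : lie_algebra F} (Ug : enveloping g).
Context (T2 : tensor_product Ug Ug) (T3 : tensor_product T2 Ug).

Definition comul : Ug -> T2 :=
  @ug_lift _ _ Ug T2
    (fun x => tens T2 (ug_in Ug x) 1 + tens T2 1 (ug_in Ug x)).

Definition counit : Ug -> F^o := @ug_lift _ _ Ug (F^o) (fun=> 0).

Definition antipode (s : Ug -> Ug) : Prop :=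
  [/\ linear s, s 1 = 1, forall u v, s (u * v) = s v * s u &
      forall x, s (ug_in Ug x) = - ug_in Ug x].

Definition tens3 (u v w : Ug) : T3 := tens T3 (tens T2 u v) w.

(* x (x) 1, 1 (x) x, (Delta (x) id)(x) and (id (x) Delta)(x) *)
Definition leg12 (x : T2) : T3 := tens T3 x 1.
Definition leg23 : T2 -> T3 := tp_lift T2 (tens3 1).
Definition comul_id : T2 -> T3 :=
  tp_lift T2 (fun u v => tens T3 (comul u) v).
Definition id_comul : T2 -> T3 :=
  tp_lift T2 (fun u v => tp_lift T2 (tens3 u) (comul v)).

Definition counit_id : T2 -> Ug :=
  tp_lift T2 (fun u v => (counit u : F) *: v).
Definition id_counit : T2 -> Ug :=
  tp_lift T2 (fun u v => (counit v : F) *: u).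

Definition map3 (s : Ug -> Ug) : T3 -> T3 :=
  tp_lift T3 (fun x w => tp_lift T2 (fun u v => tens3 (s u) (s v) (s w)) x).

Definition comul3 (x : g) : T3 :=
  tens3 (ug_in Ug x) 1 1 + tens3 1 (ug_in Ug x) 1 + tens3 1 1 (ug_in Ug x).

Definition to_T2 (r : tensor2 g) : T2 :=
  \sum_i \sum_j r i j *: tens T2 (ug_in Ug (basg i)) (ug_in Ug (basg j)).

Definition to_T3 (phi : tensor3 g) : T3 :=
  \sum_i \sum_j \sum_k phi i j k *:
    tens3 (ug_in Ug (basg i)) (ug_in Ug (basg j)) (ug_in Ug (basg k)).

Record quantum_group (r : tensor2 g) := QuantumGroup {
  qg_F : nat -> T2;
  qg_Finv : nat -> T2;
  qg_Phi : nat -> T3;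
  qg_s : Ug -> Ug;
  qg_antipode : antipode qg_s;
  qg_FFinv : psmul qg_F qg_Finv =1 @psone T2;
  qg_FinvF : psmul qg_Finv qg_F =1 @psone T2;
  qg_F0 : qg_F 0 = 1;
  qg_F1 : qg_F 1 = 2%:R^-1 *: to_T2 r;
  qg_counit_l : (fun n => counit_id (qg_F n)) =1 @psone Ug;
  qg_counit_r : (fun n => id_counit (qg_F n)) =1 @psone Ug;
  qg_Phi_inv : forall n x, comul3 x * qg_Phi n = qg_Phi n * comul3 x;
  qg_Phi0 : qg_Phi 0 = 1;
  qg_Phi1 : qg_Phi 1 = 0;
  qg_Phi2 : exists2 c : F, c != 0 &
    qg_Phi 2 = c *: to_T3 (schouten r r);
  qg_Phi_s : psmul qg_Phi (fun n => map3 qg_s (qg_Phi n)) =1 @psone T3;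
  qg_twist :
    psmul (fun n => leg12 (qg_F n)) (fun n => comul_id (qg_F n)) =1
    psmul (psmul (fun n => leg23 (qg_F n)) (fun n => id_comul (qg_F n)))
      qg_Phi }.

(* Delta_h(u) = F_h Delta(u) F_h^-1 *)
Definition comulh (r : tensor2 g) (Q : quantum_group r) (u : Ug) :
    nat -> T2 :=
  psmul (fun n => qg_F Q n * comul u) (qg_Finv Q).

End QuantumGroup.

(** * Actions, brackets and quantizations on a G-manifold *)

Section OnManifold.
Context {R : realType} {k : category} {G : lie_group (model_of R k)}.
Context (g : lie_algebra_of G) (M : G_manifold G).

(* (x a)(p) is the derivative at the unit along [x] of  y |-> a(y^-1 p). *)
Definition inf_act (x : g) : op M := fun V a p =>
  let gl := lg_law G in
  la_field x [set y | V (gm_act (ginv gl y) p)]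
    (fun y => a (gm_act (ginv gl y) p)) (gone gl).

(* The action of U(g) on the sheaf of functions which extends that of g; it is
   unique, as g generates U(g). *)
Record env_action (Ug : enveloping g) := EnvAction {
  ea :> Ug -> op M;
  ea_fn : forall u V a, fn M V a -> fn M V (ea u V a);
  ea_eq : forall u V a b, fn M V a -> eq_on V a b ->
    eq_on V (ea u V a) (ea u V b);
  ea_res : forall u V W a, open W -> W `<=` V -> fn M V a ->
    eq_on W (ea u W a) (ea u V a);
  ea_lin : forall u V (c : R[i]) a b, fn M V a -> fn M V b ->
    eq_on V (ea u V (fun p => c * a p + b p))
            (fun p => c * ea u V a p + ea u V b p);
  ea_lin_l : forall (c : R[i]) u v V a, fn M V a ->
    eq_on V (ea (c *: u + v) V a) (fun p => c * ea u V a p + ea v V a p);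
  ea_1 : forall V a, fn M V a -> eq_on V (ea 1 V a) a;
  ea_M : forall u v V a, fn M V a ->
    eq_on V (ea (u * v) V a) (ea u V (ea v V a));
  ea_in : forall x V a, fn M V a ->
    eq_on V (ea (ug_in Ug x) V a) (inf_act x V a) }.

Definition bracket (f : biop M) : Prop :=
  [/\ forall V a b, fn M V a -> fn M V b -> fn M V (f V a b),
      forall V a b a' b', fn M V a -> fn M V b -> eq_on V a a' ->
        eq_on V b b' -> eq_on V (f V a b) (f V a' b'),
      forall V W a b, open W -> W `<=` V -> fn M V a -> fn M V b ->
        eq_on W (f W a b) (f V a b),
      forall V (c : R[i]) a b d, fn M V a -> fn M V b -> fn M V d ->
        eq_on V (f V (fun p => c * a p + b p) d)
                (fun p => c * f V a d p + f V b d p) &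
      (forall V a b, fn M V a -> fn M V b ->
         eq_on V (f V a b) (fun p => - f V b a p)) /\
      (forall V a b c, fn M V a -> fn M V b -> fn M V c ->
         eq_on V (f V (fun p => a p * b p) c)
                 (fun p => a p * f V b c p + f V a c p * b p))].

(* The Schouten bracket of two bivector fields, in the normalization for which
   [[r_M, s_M]] = ([[r, s]])_M for [schouten r s] above; the sign comes from
   f(f(a,b),c) + cyclic = - (yang_baxter r r)_M (a,b,c)  for  f = r_M. *)
Definition schoutenM (f f' : biop M) (V : set M) (a b c : M -> R[i]) :
    M -> R[i] := fun p =>
  - (f V (f' V a b) c p + f V (f' V b c) a p + f V (f' V c a) b p
     + f' V (f V a b) c p + f' V (f V b c) a p + f' V (f V c a) b p).

Definition poisson (f : biop M) : Prop :=
  bracket f /\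
  forall V a b c, fn M V a -> fn M V b -> fn M V c ->
    eq_on V (schoutenM f f V a b c) (fun=> 0).

Definition tensor2M (r : tensor2 g) : biop M := fun V a b p =>
  \sum_i \sum_j r i j * inf_act (basg i) V a p * inf_act (basg j) V b p.

Definition tensor3M (phi : tensor3 g) (V : set M) (a b c : M -> R[i]) :
    M -> R[i] := fun p =>
  \sum_i \sum_j \sum_l phi i j l * inf_act (basg i) V a p
    * inf_act (basg j) V b p * inf_act (basg l) V c p.

Definition G_invariant (f : biop M) : Prop :=
  let gl := lg_law G in let act := @gm_act _ _ _ M in
  forall x V a b, fn M V a -> fn M V b -> forall p, V p ->
    f (tr_set gl act x V) (tr_fun gl act x a) (tr_fun gl act x b) (act x p)
    = f V a b p.

Definition phi_bracket (phi : tensor3 g) (f : biop M) : Prop :=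
  [/\ bracket f, G_invariant f &
      forall V a b c, fn M V a -> fn M V b -> fn M V c ->
        eq_on V (schoutenM f f V a b c) (fun p => - tensor3M phi V a b c p)].

(* Vector fields on [D] whose compositions, with function coefficients, are
   the differential operators on D: coordinate fields of a chart or, on an
   algebraic variety, arbitrary derivations of the sheaf. *)
Definition frame (D : set M) (n : nat) (d : 'I_n -> op M) : Prop :=
  if k is Algebraic then forall i, derivation D (d i)
  else exists2 c : chart (model_of R k) M n,
         ch_dom c = D & d = coord_field c.

Definition bidiff_op (B : biop M) : Prop :=
  (forall V a b, fn M V a -> fn M V b -> fn M V (B V a b)) /\
  forall p : M, exists (D : set M) (n : nat) (d : 'I_n -> op M)
      (N : nat) (c : 'I_N -> M -> R[i]) (al be : 'I_N -> seq 'I_n),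
    [/\ open D, D p, frame D d, forall t, fn M D (c t) &
        forall V W a b, fn M V a -> fn M V b ->
          open W -> W `<=` V -> W `<=` D ->
          eq_on W (B V a b)
            (fun q => \sum_t c t q * foldr (fun i => d i W) a (al t) q
                                   * foldr (fun i => d i W) b (be t) q)].

(* The product on A[[h]] given by  m_h = sum_k h^k m_k *)
Definition mh (m : nat -> biop M) (V : set M) (x y : nat -> M -> R[i]) :
    nat -> M -> R[i] := fun n p =>
  \sum_(i < n.+1) \sum_(j < (n - i).+1) m i V (x j) (y (n - i - j)%N) p.

(* The coefficients of  m_h(X (x . y))  for X in U(g)^(x)2[[h]]  and
   x, y in A(V). *)
Definition mh_act (Ug : enveloping g) (T2 : tensor_product Ug Ug)
    (ac : env_action Ug) (m : nat -> biop M) (V : set M) (X : nat -> T2)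
    (x y : M -> R[i]) : nat -> M -> R[i] := fun n p =>
  \sum_(i < n.+1)
    (tp_lift T2 (V := (R[i])^o)
       (fun u v => m i V (ac u V x) (ac v V y) p) (X (n - i)%N) : R[i]).

Record invariant_quantization (Ug : enveloping g) (T2 : tensor_product Ug Ug)
    (T3 : tensor_product T2 Ug) (ac : env_action Ug) (r : tensor2 g)
    (Q : quantum_group T3 r) (m : nat -> biop M) : Prop :=
  InvariantQuantization {
  iq_m0 : forall V a b, fn M V a -> fn M V b ->
    eq_on V (m 0 V a b) (fun p => a p * b p);
  iq_bidiff : forall i, (0 < i)%N -> bidiff_op (m i);
  iq_cst : forall i V a (c : R[i]), (0 < i)%N -> fn M V a ->
    eq_on V (m i V (fun=> c) a) (fun=> 0) /\
    eq_on V (m i V a (fun=> c)) (fun=> 0);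
  iq_assoc : forall V (x y z : nat -> M -> R[i]),
    (forall n, fn M V (x n)) -> (forall n, fn M V (y n)) ->
    (forall n, fn M V (z n)) ->
    forall n, eq_on V (mh m V (mh m V x y) z n) (mh m V x (mh m V y z) n);
  iq_invariant : forall u V (a b : M -> R[i]), fn M V a -> fn M V b ->
    forall n, eq_on V (ac u V (m n V a b))
                      (mh_act ac m V (comulh Q u) a b n) }.

(* The Poisson bracket of a quantization. *)
Definition poisson_of (m : nat -> biop M) : biop M := fun V a b p =>
  m 1 V a b p - m 1 V b a p.

End OnManifold.

(* Main.v *)
From HB Require Import structures.
From mathcomp Require Import all_boot all_order all_algebra.
From mathcomp Require Import all_classical all_reals all_analysis.
From mathcomp Require Import complex ring.
Require Import Defs.
Set Implicit Arguments.
Unset Strict Implicit.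
Unset Printing Implicit Defensive.
Import Order.TTheory GRing.Theory Num.Theory numFieldNormedType.Exports.
Local Open Scope classical_set_scope.
Local Open Scope ring_scope.

(** Let [p] be the antisymmetrization of [m 1] and let [x] act on functions through
    the infinitesimal action of the Lie algebra.

    The coefficients of h and h^2 in the associativity of the quantization say
    that [m 1] is a Hochschild cocycle whose associator is a coboundary; after
    antisymmetrization, [p] satisfies the Leibniz rule and the Jacobi identity
    ([poisson_of_bracket], [poisson_of_jacobi]).

    The coefficient of h^0 in its invariance says that the Lie algebra acts by
    derivations.  As F_h = 1 + (h / 2) r + o(h), the coefficient of h is
    [x (m_1 (a, b)) = m_1 (x a, b) + m_1 (a, x b)
       + (r_M (x a, b) + r_M (a, x b) - x (r_M (a, b))) / 2]
    ([first_order_invariance]).  Antisymmetrized, this says that [f = p + r_M] is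
    invariant under the Lie algebra.

    Write J(u) for the cyclic sum of [u (u (a, b), c)].  Then
    [0 = J(p) = J(f - r_M) = J(f) - (mixed terms) + J(r_M)], where the mixed terms
    vanish because [f] is invariant ([mixed_vanish]), and J(r_M) is minus the field
    of the Yang-Baxter expression of [r] ([tensor_jacobi]).  Since the Schouten
    bracket of [f] with itself is -2 J(f), it is minus the field of [[r, r]].

    The longest part of the proof is that invariance under the Lie algebra implies
    invariance under the connected group, for analytic, smooth and algebraic
    actions.  Fix [q]; the bracket of the translates of [a] and [b] by
    [y], evaluated at [y^-1 q], has to be constant in [y].  It suffices that its
    derivative vanishes along all curves [y s(t)] with [s(0) = 1]
    ([constant_on_group], by the mean value inequality in charts).  The velocity
    of such a curve is given by an element of the Lie algebra, because the curve
    induces a left-invariant derivation ([curve_field_element]).  To differentiate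
    a bracket whose arguments depend on [t], the translates of [a] are expanded,
    to first order, into fixed functions with coefficients depending on [t]
    ([expansion]): in a chart into coordinates, where the derivatives of the
    coefficients are found by the symmetry of second derivatives, and on a variety
    by the rule for quotients.  In charts this uses that a derivation of the sheaf
    is a combination of the coordinate fields ([derivation_formula]), which
    follows from Hadamard's lemma; that lemma is proved over R and over C at once,
    with the mean value inequality as the only analytic input. *)

(** * Iterated differentiability *)

Section DiffUpto.
Context {K : numFieldType}.
Implicit Types V W U : normedModType K.

(** Lets one check a guessed differential by an estimate, and identifies it at
    the same time. *)
Lemma differentiable_eps V W (f : V -> W) (df : {linear V -> W}) x :
  continuous df ->
  (forall e : K, 0 < e ->
     \forall h \near 0, `|f (h + x) - f x - df h| <= e * `|h|) ->
  differentiable f x /\ 'd f x = df :> (V -> W).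
Proof.
move=> cdf H.
have E : f \o shift x = cst (f x) + df +o_ 0 id.
  apply: eqaddoE; apply/eqaddoP => e e0.
  by near=> h; rewrite opprD addrA; near: h; exact: H.
have D := diff_unique cdf E.
by split => //; apply/diff_locallyP; rewrite D.
Unshelve. all: by end_near. Qed.

Lemma differentiable_epsP V W (f : V -> W) x : differentiable f x ->
  forall e : K, 0 < e ->
     \forall h \near 0, `|f (h + x) - f x - 'd f x h| <= e * `|h|.
Proof.
move=> /diff_locally /eqaddoP H e e0; near=> h.
by rewrite -addrA -opprD; near: h; exact: H.
Unshelve. all: by end_near. Qed.

Lemma near_eq_differentiable V W (f g : V -> W) x :
  (\near x, f x = g x) -> differentiable f x -> differentiable g x.
Proof.
move=> fg df; have fgx := nbhs_singleton fg.
have [] // := @differentiable_eps _ _ g ('d f x) x.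
  exact: diff_continuous.
move=> e e0; near=> h; rewrite -fgx.
have -> : g (h + x) = f (h + x).
  apply/esym; near: h.
  by have := fg; rewrite (near_shift 0)/=; apply: filterS => y; rewrite subr0.
by near: h; exact: differentiable_epsP.
Unshelve. all: by end_near. Qed.

Lemma open_eq_near V (T : Type) (D : set V) (f g : V -> T) x :
  open D -> eq_on D f g -> D x -> \near x, f x = g x.
Proof.
move=> oD fg Dx; have := open_nbhs_nbhs (conj oD Dx).
exact: filterS.
Qed.

Lemma derive_ext V W (D : set V) (f g : V -> W) v :
  open D -> eq_on D f g -> eq_on D (fun x => 'D_v f x) (fun x => 'D_v g x).
Proof. by move=> oD fg x Dx; apply: near_eq_derive; exact: open_eq_near fg Dx. Qed.

Lemma diff_upto_sub V W k (D D' : set V) (u : V -> W) :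
  D' `<=` D -> diff_upto k D u -> diff_upto k D' u.
Proof.
move=> DD; elim: k u => //= k IH u [d1 d2]; split; first by move=> x /DD/d1.
by move=> v; exact/IH.
Qed.

Lemma diff_upto_ext V W k (D : set V) (u w : V -> W) :
  open D -> eq_on D u w -> diff_upto k D u -> diff_upto k D w.
Proof.
move=> oD; elim: k u w => //= k IH u w uw [d1 d2]; split.
  by move=> x Dx; apply: near_eq_differentiable (d1 _ Dx); exact: open_eq_near Dx.
by move=> v; apply: IH (d2 v); exact: derive_ext.
Qed.

Lemma diff_upto_pred V W k (D : set V) (u : V -> W) :
  diff_upto k.+1 D u -> diff_upto k D u.
Proof.
elim: k u => //= k IH u [d1 d2]; split=> // v; exact: IH.
Qed.

Lemma diff_upto_cst V W k (D : set V) (c : W) : diff_upto k D (fun=> c).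
Proof.
elim: k c => //= k IH c; split=> [x _|v]; first exact: differentiable_cst.
have -> : (fun x : V => 'D_v (fun=> c) x) = fun=> (0 : W).
  by apply: boolp.funext => x; exact: derive_cst.
exact: IH.
Qed.

Lemma diff_upto_add V W k (D : set V) (u w : V -> W) : open D ->
  diff_upto k D u -> diff_upto k D w -> diff_upto k D (fun x => u x + w x).
Proof.
move=> oD; elim: k u w => //= k IH u w [u1 u2] [w1 w2]; split=> [x Dx|v].
  by apply: differentiableD; [exact: u1|exact: w1].
apply: diff_upto_ext oD _ (IH _ _ (u2 v) (w2 v)) => x Dx.
by rewrite deriveD //; apply: diff_derivable; [exact: u1|exact: w1].
Qed.

Lemma diff_upto_mul V k (D : set V) (u w : V -> K^o) : open D ->
  diff_upto k D u -> diff_upto k D w -> diff_upto k D (fun x => u x * w x : K^o).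
Proof.
move=> oD; elim: k u w => // k IH u w us ws.
have [[u1 u2] [w1 w2]] := (us, ws); split=> [x Dx|v].
  by apply: differentiableM; [exact: u1|exact: w1].
have us' := diff_upto_pred us; have ws' := diff_upto_pred ws.
apply: diff_upto_ext oD _ (diff_upto_add oD (IH _ _ us' (w2 v)) (IH _ _ ws' (u2 v))).
by move=> x Dx; rewrite deriveM //; apply: diff_derivable; [exact: u1|exact: w1].
Qed.

Lemma diff_upto_lin V W k (D : set V) (f : {linear V -> W}) :
  continuous f -> diff_upto k D f.
Proof.
move=> cf; case: k => //= k; split=> [x _|v]; first exact: linear_differentiable.
have -> : (fun x : V => 'D_v f x) = fun=> f v; last exact: diff_upto_cst.
by apply: boolp.funext => x; rewrite deriveE ?diff_lin //; exact: linear_differentiable.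
Qed.

(** The map [h] is affine with linear part [L]; saying so by increments
    covers projections, lines and slices of a product alike. *)
Lemma derive_affine V V' W (h : V' -> V) (L : {linear V' -> V}) (u : V -> W) v x :
  (forall x y, h (x + y) = L x + h y) ->
  'D_v (u \o h) x = 'D_(L v) u (h x).
Proof.
move=> hL; rewrite /derive.
have -> : (fun t : K => t^-1 *: (((u \o h) \o shift x) (t *: v) - (u \o h) x)) =
          (fun t : K => t^-1 *: ((u \o shift (h x)) (t *: L v) - u (h x))) => //.
by apply: boolp.funext => t /=; rewrite hL linearZ.
Qed.

Lemma differentiable_affine V V' (h : V' -> V) (L : {linear V' -> V}) x :
  (forall x y, h (x + y) = L x + h y) -> continuous L -> differentiable h x.
Proof.
move=> hL cL; have [] // := @differentiable_eps _ _ h L x cL.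
by move=> e e0; near=> y; rewrite hL addrK subrr normr0 mulr_ge0 // ltW.
Unshelve. all: by end_near. Qed.

Lemma diff_upto_affine V V' W k (D : set V) (h : V' -> V)
    (L : {linear V' -> V}) (u : V -> W) :
  (forall x y, h (x + y) = L x + h y) -> continuous L ->
  diff_upto k D u -> diff_upto k (h @^-1` D) (u \o h).
Proof.
move=> hL cL; elim: k u => //= k IH u [u1 u2]; split=> [x Dx|v].
  apply: differentiable_comp; first exact: differentiable_affine hL cL.
  exact: u1.
have -> : (fun x => 'D_v (u \o h) x) = (fun y => 'D_(L v) u y) \o h; last exact: IH.
by apply: boolp.funext => x; rewrite (derive_affine u v x hL).
Qed.

End DiffUpto.

(** * Velocities of curves *)

Section ScaleL.
Context {K : numFieldType} {V : normedModType K} (h : V).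
Definition scalel (t : K^o) : V := t *: h.
Lemma scalel_is_linear : linear scalel.
Proof. by move=> a x y; rewrite /scalel scalerDl scalerA. Qed.
HB.instance Definition _ := GRing.isLinear.Build K K^o V _ scalel scalel_is_linear.
Lemma scalel_cont : continuous scalel.
Proof. by move=> t; apply: scalel_continuous. Qed.
End ScaleL.

Section VelocityK.
Context {R : realType} {K : numFieldType} (inj : {rmorphism R -> K}).
Hypothesis inj_cont : continuous (inj : R -> K^o).
Implicit Types V W : normedModType K.

(** Curves are parametrized by real numbers even when [K] is the complex
    field, [inj] being the inclusion of R in [K]: the real mean value theorem
    then serves both fields. *)
Definition velocity V (h : R -> V) (h' : V) : Prop :=
  (fun t => (inj t)^-1 *: (h t - h 0)) @ 0^' --> h'.

Lemma velocity_to0 V (h : R -> V) h' : velocity h h' ->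
  (fun t => h t - h 0) @ 0^' --> (0 : V).
Proof.
move=> H.
have I0 : (inj : R -> K^o) @ 0^' --> (0 : K).
  have := @inj_cont 0; rewrite /continuous_at rmorph0 => c.
  exact: cvg_trans (cvg_app _ (@nbhs_dnbhs R 0)) c.
have : (fun t => inj t *: ((inj t)^-1 *: (h t - h 0))) @ 0^' --> (0 : V).
  by rewrite -[X in _ --> X](scale0r h'); exact: cvgZ.
apply: cvg_trans; apply: near_eq_cvg; near=> t; rewrite /= scalerA divff ?scale1r //.
rewrite fmorph_eq0; near: t; exact: nbhs_dnbhs_neq.
Unshelve. all: by end_near. Qed.

(** With [L] the differential, [u (h t) - u (h 0)] differs from
    [L (h t - h 0)] by a small multiple of [`|h t - h 0|], and [h t - h 0] is of
    the order of [t]. *)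
Lemma velocity_chain V W (u : V -> W) (h : R -> V) h' :
  differentiable u (h 0) -> velocity h h' ->
  velocity (u \o h) ('D_h' u (h 0)).
Proof.
move=> du vh; rewrite deriveE // /velocity.
set L := 'd u (h 0).
pose Q t := (inj t)^-1 *: (h t - h 0).
pose rho t := u (h t) - u (h 0) - L (h t - h 0).
have -> : (fun t => (inj t)^-1 *: ((u \o h) t - (u \o h) 0)) =
          (fun t => L (Q t) + (inj t)^-1 *: rho t).
  apply: boolp.funext => t; rewrite /Q linearZ -scalerDr /rho /=; congr (_ *: _).
  by rewrite [RHS]addrC subrK.
rewrite -[X in _ --> X]addr0; apply: cvgD.
  have cL : {for h', continuous L} by apply: diff_continuous.
  exact: (cvg_comp _ _ vh cL).
apply/cvgr0Pnorm_le => e e0.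
have p0 : 0 < `|h'| + 1 by rewrite ltr_wpDl.
have e'0 : 0 < e / (`|h'| + 1) by rewrite divr_gt0.
have Hr := differentiable_epsP du e'0.
have Hr2 : \forall t \near 0^', `|rho t| <= e / (`|h'| + 1) * `|h t - h 0|.
  have Hr' : \forall t \near 0^', `|u (h t - h 0 + h 0) - u (h 0)
      - 'd u (h 0) (h t - h 0)| <= e / (`|h'| + 1) * `|h t - h 0|.
    exact: (velocity_to0 vh Hr).
  by near=> t; have := near Hr' t; rewrite /rho subrK; apply.
have HQ : \forall t \near 0^', `|Q t| <= `|h'| + 1.
  have /cvgrPdist_le/(_ 1 ltr01) Hv := vh; near=> t.
  have Ht : `|h' - Q t| <= 1 by near: t.
  rewrite -lerBlDl; apply: le_trans Ht.
  by rewrite distrC; exact: lerB_dist.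
near=> t.
have t0 : inj t != 0 by rewrite fmorph_eq0; near: t; exact: nbhs_dnbhs_neq.
rewrite normrZ normfV mulrC ler_pdivrMr ?normr_gt0 //.
have H1 : `|rho t| <= e / (`|h'| + 1) * `|h t - h 0| by near: t.
apply: le_trans H1 _.
have -> : h t - h 0 = inj t *: Q t by rewrite /Q scalerA divff // scale1r.
rewrite normrZ mulrCA mulrC ler_wpM2r //.
rewrite -mulrA ger_pMr // ler_pdivrMl // mulr1.
by near: t.
Unshelve. all: by end_near. Qed.

Lemma velocity_affine V (x v : V) : velocity (fun t => x + inj t *: v) v.
Proof.
rewrite /velocity; have : (fun=> v) @ (0 : R)^' --> v by exact: cvg_cst.
apply: cvg_trans; apply: near_eq_cvg; near=> t.
rewrite rmorph0 scale0r addr0 addrC addKr scalerA mulVf ?scale1r //.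
rewrite fmorph_eq0; near: t; exact: nbhs_dnbhs_neq.
Unshelve. all: by end_near. Qed.

Lemma velocity_pair V W (h : R -> V) (k : R -> W) h' k' :
  velocity h h' -> velocity k k' ->
  velocity (fun t => (h t, k t)) (h', k').
Proof. by move=> a b; apply: cvg_pair. Qed.

Lemma velocity_near V (h k : R -> V) a :
  (\forall t \near 0, h t = k t) -> velocity h a -> velocity k a.
Proof.
move=> hk; apply: cvg_trans; apply: near_eq_cvg.
apply: nbhs_dnbhs; near=> t; rewrite (nbhs_singleton hk); congr (_ *: (_ - _)).
by near: t.
Unshelve. all: by end_near. Qed.

Lemma velocity_cst V (c : V) : velocity (fun=> c) 0.
Proof.
by rewrite /velocity subrr; under eq_fun do rewrite scaler0; exact: cvg_cst.
Qed.

Lemma velocity_cont V (h : R -> V) h' : velocity h h' -> {for 0, continuous h}.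
Proof.
move=> /velocity_to0 H; apply/cvgrPdist_lt => e e0.
have /cvgr0Pnorm_lt/(_ e e0) := H.
rewrite near_withinE => He; near=> t.
have [->|t0] := eqVneq t 0; first by rewrite subrr normr0.
by rewrite distrC; apply: (near He t).
Unshelve. all: by end_near. Qed.

Lemma velocityD V (F G : R -> V) a b : velocity F a -> velocity G b ->
  velocity (fun t => F t + G t) (a + b).
Proof.
move=> Fa Gb; rewrite /velocity.
under eq_fun do rewrite opprD addrACA scalerDr.
exact: cvgD Fa Gb.
Qed.

Lemma velocityM (F G : R -> K^o) a b : velocity F a -> velocity G b ->
  velocity (fun t => F t * G t : K^o) (a * G 0 + F 0 * b).
Proof.
move=> Fa Gb; have H := velocity_pair Fa Gb.
have D := @is_diff_mulr K (F 0, G 0).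
have := @velocity_chain (K^o * K^o)%type K^o (fun q => q.1 * q.2)
  (fun t => (F t, G t)) (a, b) (@ex_diff _ _ _ _ _ _ _ D) H.
rewrite deriveE; last exact: ex_diff.
by rewrite diff_val /= addrC.
Qed.

Lemma velocityV (F : R -> K^o) a : velocity F a -> F 0 != 0 ->
  velocity (fun t => (F t)^-1 : K^o) (- a / F 0 ^+ 2).
Proof.
move=> Fa F0; have D := differentiable_Rinv F0.
have := velocity_chain D Fa.
by rewrite deriveE // diff_Rinv //= /GRing.scale /= mulrC mulrN mulNr.
Qed.

End VelocityK.

(** * Real and complex scalars *)

Section ComplexReal.
Context {R : realType}.
Local Notation C := R[i].

Lemma normC_real (x : R) : `|x%:C%C| = (`|x|)%:C%C :> C.
Proof. by rewrite normc_def /= expr0n addr0 sqrtr_sqr. Qed.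

Lemma Re_le_norm (z : C) : (`|complex.Re z|)%:C%C <= `|z|.
Proof.
case: z => a b; rewrite normc_def lecR /= -sqrtr_sqr ler_wsqrtr //.
by rewrite lerDl sqr_ge0.
Qed.

Lemma Im_le_norm (z : C) : (`|complex.Im z|)%:C%C <= `|z|.
Proof.
case: z => a b; rewrite normc_def lecR /= -sqrtr_sqr ler_wsqrtr //.
by rewrite lerDr sqr_ge0.
Qed.

Lemma norm_le_ReIm (z : C) :
  `|z| <= (`|complex.Re z| + `|complex.Im z|)%:C%C.
Proof.
rewrite {1}[z]complexE (le_trans (ler_normD _ _)) // normrM !normC_real.
have -> : `|'i%C : C| = 1 by rewrite normc_def /= expr0n expr1n add0r sqrtr1.
by rewrite mul1r rmorphD.
Qed.

Lemma gt0_real (e : C) : 0 < e -> exists2 r : R, 0 < r & e = r%:C%C.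
Proof.
case: e => a b; rewrite ltcE /= => /andP[/eqP b0 a0]; exists a => //.
by rewrite b0.
Qed.

Lemma real_complex_cont : continuous (real_complex R : R -> C^o).
Proof.
move=> x; apply/cvgrPdist_lt => e /gt0_real[r r0 ->].
have H : \forall t \near x, `|x - t| < r.
  by apply/nbhs_ballP; exists r.
by near=> t; rewrite -rmorphB /= normC_real ltcR; near: t.
Unshelve. all: by end_near. Qed.

(** A type with a constructor rather than a definition, so that the limit
    behind it is not unfolded by unification. *)
Variant cder (F : R -> C) (l : C) : Prop :=
  Cder of velocity (real_complex R) (F : R -> C^o) l.

Lemma cder_uniq F a b : cder F a -> cder F b -> a = b.
Proof. by move=> [Fa] [Fb]; exact: cvg_unique Fa Fb. Qed.

Lemma cderM F G a b : cder F a -> cder G b ->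
  cder (fun t => F t * G t) (a * G 0 + F 0 * b).
Proof.
move=> [Fa] [Gb]; constructor.
exact: (velocityM real_complex_cont Fa Gb).
Qed.

Lemma cderD F G a b : cder F a -> cder G b ->
  cder (fun t => F t + G t) (a + b).
Proof. by move=> [Fa] [Gb]; constructor; exact: velocityD Fa Gb. Qed.

Lemma cder_cst c : cder (fun=> c) 0.
Proof. by constructor; exact: velocity_cst. Qed.

Lemma cder_near F G a :
  (\forall t \near 0, F t = G t) -> cder F a -> cder G a.
Proof.
by move=> FG [Fa]; constructor; exact: (@velocity_near R _ (real_complex R) C^o F G a).
Qed.

Lemma cder_ext F G a b : F =1 G -> a = b -> cder F a -> cder G b.
Proof. by move=> /boolp.funext-> ->. Qed.

Lemma cderZ c F a : cder F a -> cder (fun t => c * F t) (c * a).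
Proof.
by move=> Fa; apply: cder_ext (cderM (cder_cst c) Fa) => //; rewrite mul0r add0r.
Qed.

Lemma cder_sum n (F : 'I_n -> R -> C) a : (forall i, cder (F i) (a i)) ->
  cder (fun t => \sum_i F i t) (\sum_i a i).
Proof.
elim: n F a => [|n IH] F a H.
  apply: cder_ext (cder_cst 0) => [t|]; by rewrite big_ord0.
apply: cder_ext (cderD (IH _ _ (fun i => H (widen_ord (leqnSn n) i))) (H ord_max)).
  by move=> t; rewrite [RHS]big_ord_recr.
by rewrite [RHS]big_ord_recr.
Qed.

Lemma cder_cont F a : cder F a -> {for 0, continuous (F : R -> C^o)}.
Proof. by move=> [Fa]; exact: (velocity_cont real_complex_cont Fa). Qed.

Lemma cderV F a : cder F a -> F 0 != 0 ->
  cder (fun t => (F t)^-1) (- a / F 0 ^+ 2).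
Proof.
by move=> [Fa] F0; constructor; exact: (velocityV real_complex_cont Fa F0).
Qed.

Lemma real_mvi (f df : R -> R) (c : R) :
  (forall t : R, 0 <= t <= 1 -> is_derive t 1 f (df t)) ->
  (forall t : R, 0 <= t <= 1 -> `|df t| <= c) -> `|f 1 - f 0| <= c.
Proof.
move=> fd dfc.
have fd' (x : R) : x \in `]0, 1[%R -> is_derive x 1 f (df x).
  by rewrite in_itv /= => /andP[a b]; apply: fd; rewrite !ltW.
have fc : {within `[0, 1], continuous f}.
  by apply: derivable_within_continuous => x; rewrite in_itv /= => /fd; case.
have [x x01 ->] := MVT ltr01 fd' fc.
rewrite subr0 mulr1; apply: dfc; move: x01; rewrite in_itv /= => /andP[a b].
by rewrite !ltW.
Qed.

Section RealLinear.
Context (phi : {additive C -> R}).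
Hypothesis phi_le : forall z, (`|phi z|)%:C%C <= `|z|.
Hypothesis phi_scale : forall (x : R) z, phi (x%:C%C * z) = x * phi z.

(** The lemmas of this section are applied to the real and imaginary
    parts. *)
Lemma real_linear_cont : continuous (phi : C^o -> R).
Proof.
move=> z; apply/(@cvgrPdist_lt _ _ _ (nbhs (z : C^o)) (nbhs_filter _)) => e e0.
have e0' : 0 < e%:C%C :> C by rewrite ltcR.
have H : \forall t \near (z : C^o), `|z - t| < e%:C%C.
  by apply/nbhs_ballP; exists e%:C%C.
near=> t; rewrite -ltcR; apply: le_lt_trans (_ : `|z - t| < _); last by near: t.
by apply: le_trans (phi_le _); rewrite raddfB.
Unshelve. all: by end_near. Qed.

Lemma real_linear_velocity F l : cder F l ->
  velocity (idfun : {rmorphism R -> R}) (fun t => phi (F t) : R^o) (phi l).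
Proof.
move=> [H]; rewrite /velocity.
have -> : (fun t : R => t^-1 *: (phi (F t) - phi (F 0) : R^o)) =
    (fun t => phi ((t%:C%C)^-1 * (F t - F 0))).
  apply: boolp.funext => t; have -> : (t%:C%C)^-1 = (t^-1)%:C%C :> C by rewrite fmorphV.
  by rewrite phi_scale [phi (_ - _)]raddfB.
exact: (cvg_comp _ _ H (@real_linear_cont l)).
Qed.

Lemma real_linear_derive t0 F l : cder (fun t => F (t0 + t)) l ->
  is_derive t0 1 (fun t => phi (F t)) (phi l).
Proof.
move=> /real_linear_velocity X.
have E : (fun t : R => t^-1 *: (phi (F (t0 + t)) - phi (F (t0 + 0)) : R^o)) =
   (fun h => h^-1 *: (((fun t => phi (F t)) \o shift t0) (h *: 1) - phi (F t0))).
  by apply: boolp.funext => t /=; rewrite addr0 /GRing.scale /= mulr1 [t + t0]addrC.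
rewrite /velocity E in X.
by apply: DeriveDef; [apply/cvg_ex; exists (phi l)|exact: cvg_lim X].
Qed.

Lemma real_linear_mvi (F l : R -> C) (c : R) :
  (forall t : R, 0 <= t <= 1 -> cder (fun s => F (t + s)) (l t)) ->
  (forall t : R, 0 <= t <= 1 -> `|l t| <= c%:C%C) -> `|phi (F 1 - F 0)| <= c.
Proof.
move=> Fd lc; rewrite raddfB; apply: (@real_mvi (fun t => phi (F t)) (fun t => phi (l t))).
  by move=> t t01; exact/real_linear_derive/Fd.
by move=> t t01; rewrite -lecR; apply: le_trans (lc _ t01).
Qed.

End RealLinear.

Lemma Re_scale (x : R) (z : C) : complex.Re (x%:C%C * z) = x * complex.Re z.
Proof. by case: z => a b /=; rewrite mul0r subr0. Qed.

Lemma Im_scale (x : R) (z : C) : complex.Im (x%:C%C * z) = x * complex.Im z.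
Proof. by case: z => a b /=; rewrite mul0r addr0. Qed.

(** The real mean value theorem applies to the real and the imaginary part
    separately; this is where the factor 2 comes from. *)
Lemma cder_mvi (F l : R -> C) (c : R) :
  (forall t : R, 0 <= t <= 1 -> cder (fun s => F (t + s)) (l t)) ->
  (forall t : R, 0 <= t <= 1 -> `|l t| <= c%:C%C) -> `|F 1 - F 0| <= (c *+ 2)%:C%C.
Proof.
move=> Fd lc; apply: le_trans (norm_le_ReIm _) _; rewrite lecR mulr2n lerD //.
  exact: (real_linear_mvi Re_le_norm Re_scale Fd lc).
exact: (real_linear_mvi Im_le_norm Im_scale Fd lc).
Qed.

End ComplexReal.

(** * The mean value inequality and the symmetry of second derivatives *)

(** The order of the complex field makes [0 <= t <= 1] imply that [t] is real,
    so that this is a statement about the real unit segment for both fields.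
    The factor 2 is that of [cder_mvi]. *)
Definition mvi (K : numFieldType) : Prop :=
  forall (w l : K^o -> K^o) (C : K),
    (forall t : K^o, 0 <= t <= 1 -> is_derive t 1 w (l t)) ->
    (forall t : K^o, 0 <= t <= 1 -> `|l t| <= C) -> `|w 1 - w 0| <= C *+ 2.

Lemma mvi_real (R : realType) : mvi R.
Proof.
move=> w l C wl lC; apply: le_trans (real_mvi wl lC) _.
rewrite mulr2n lerDl; apply: le_trans (lC 0 _) => //.
by rewrite lexx ler01.
Qed.

Lemma velocity_derive (R : realType) (K : numFieldType)
    (inj : {rmorphism R -> K}) (w : K^o -> K^o) (t : R) l :
  continuous (inj : R -> K^o) -> is_derive (inj t : K^o) 1 w l ->
  velocity inj (fun s => w (inj (t + s))) l.
Proof.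
move=> cinj [dw <-].
have E : (fun s => w (inj (t + s))) = w \o (fun s : R => inj t + inj s *: (1 : K^o)).
  by apply: boolp.funext => s /=; rewrite rmorphD /GRing.scale /= mulr1.
rewrite E.
have h0 : inj t + inj 0 *: (1 : K^o) = inj t by rewrite rmorph0 scale0r addr0.
have dw' : differentiable w (inj t + inj 0 *: (1 : K^o)).
  by rewrite h0; exact/derivable1_diffP.
have := velocity_chain cinj dw' (@velocity_affine R K inj K^o (inj t) 1).
by rewrite h0.
Qed.

Lemma mvi_complex (R : realType) : mvi R[i].
Proof.
move=> w l C wl lC.
have lC0 : `|l 0| <= C by apply: lC; rewrite lexx ler01.
have C0 : 0 <= C by apply: le_trans lC0.
have [c Cc] : exists c : R, C = c%:C%C.
  by exists (complex.Re C); rewrite RRe_real // realE C0.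
have t01 (t : R) : 0 <= t <= 1 -> (0 : R[i]) <= t%:C%C <= 1.
  by move=> t01; rewrite ler0c -(rmorph1 (real_complex R)) lecR.
have := @cder_mvi R (fun t => w t%:C%C) (fun t => l t%:C%C) c.
rewrite rmorph0 rmorph1 Cc rmorphMn /=; apply => [t /t01 H|t /t01 /lC]; last first.
  by rewrite Cc.
constructor; exact: (velocity_derive real_complex_cont (wl _ H)).
Qed.

Section Schwarz.
Context {K : numFieldType} (mviK : mvi K).
Implicit Types V : normedModType K.

Lemma is_derive_line V (W : normedModType K) (u : V -> W) (p h : V) (t : K^o) :
  differentiable u (p + t *: h) ->
  is_derive t 1 (fun s : K^o => u (p + s *: h)) ('D_h u (p + t *: h)).
Proof.
move=> du; have hL (x y : K^o) : p + (x + y) *: h = scalel h x + (p + y *: h).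
  by rewrite /scalel scalerDl addrCA addrA.
have A := differentiable_affine t hL (@scalel_cont _ _ h).
apply: DeriveDef.
  apply: diff_derivable.
  exact: (differentiable_comp A du).
have X : 'D_1 (fun s : K^o => u (p + s *: h)) t = 'D_(scalel h 1) u (p + t *: h).
  exact: (derive_affine u (1 : K^o) t hL).
by rewrite X /scalel scale1r.
Qed.

Lemma is_derive_scale (c t : K^o) : is_derive t 1 (fun s : K^o => s *: c) c.
Proof.
have d : differentiable (id : K^o -> K^o) (0 + t *: c) by [].
have := is_derive_line d; rewrite derive_id.
by under eq_fun do rewrite add0r.
Qed.

Lemma mvi_segment V (u : V -> K^o) (p h : V) (C : K) :
  (forall t : K, 0 <= t <= 1 -> differentiable u (p + t *: h)) ->
  (forall t : K, 0 <= t <= 1 -> `|'D_h u (p + t *: h)| <= C) ->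
  `|u (p + h) - u p| <= C *+ 2.
Proof.
move=> du dC.
have := mviK (w := fun s : K^o => u (p + s *: h))
  (l := fun s => 'D_h u (p + s *: h)) (C := C).
rewrite scale1r scale0r addr0; apply => // t t01.
exact/is_derive_line/du.
Qed.

(** The second difference of [u] over the parallelogram on [s v] and [s e]
    is [s ^+ 2] times the mixed derivative at [x], up to [o(s ^+ 2)]: the mean
    value inequality is applied once along [v] and once along [e]. *)
Lemma second_difference V (D : set V) (u : V -> K^o) (v e x : V) (eps : K) :
  open D -> D x -> diff_upto 3 D u -> 0 < eps ->
  exists2 d : K, 0 < d & forall s : K, 0 < s <= d ->
    `|u (x + s *: v + s *: e) - u (x + s *: v) - u (x + s *: e) + u x
       - s ^+ 2 * 'D_e (fun y => 'D_v u y) x| <= s ^+ 2 * eps *+ 4.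
Proof.
move=> oD Dx [u1 u2] e0.
have [u3 u4] := u2 v; have [u5 _] := u4 e.
set A := 'D_e _ x.
have cA : {for x, continuous (fun y => 'D_e (fun y => 'D_v u y) y)}.
  exact/differentiable_continuous/u5.
have /(@nbhs_ballP K V) [r /= r0 Hr] : nbhs x (D `&`
    [set y | `|A - 'D_e (fun y => 'D_v u y) y| <= eps]).
  apply: filterI; first exact: open_nbhs_nbhs.
  by have /cvgrPdist_le := cA; apply.
have m0 : 0 < `|v| + `|e| + 1 by rewrite ltr_wpDl // addr_ge0.
(* The parallelogram then stays in the ball of radius [r]. *)
exists (r / (`|v| + `|e| + 1)); first by rewrite divr_gt0.
move=> s /andP[s0]; rewrite ler_pdivlMr // => sr.
have inr (a b : K) : 0 <= a <= s -> 0 <= b <= s ->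
    (D `&` [set y | `|A - 'D_e (fun y => 'D_v u y) y| <= eps]) (x + a *: v + b *: e).
  move=> /andP[a0 as_] /andP[b0 bs]; apply: Hr.
  rewrite -ball_normE /= -addrA opprD addNKr normrN.
  apply: le_lt_trans (ler_normD _ _) _; rewrite !normrZ !ger0_norm //.
  apply: lt_le_trans sr; rewrite mulrDr mulr1 mulrDr.
  by rewrite ltr_pwDr // lerD // ler_wpM2r.
have sc (t : K) : 0 <= t <= 1 -> 0 <= t * s <= s.
  by move=> /andP[t0 t1]; rewrite mulr_ge0 ?(ltW s0) //= ler_piMl // ltW.
have ss : 0 <= s <= s by rewrite lexx ltW.
have s20 : 0 <= s ^+ 2 by rewrite exprn_ge0 // ltW.
(* [w 1 - w 0] is the quantity to be bounded, [l] the derivative of [w]. *)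
pose w (t : K^o) : K^o :=
  u (x + s *: e + t *: (s *: v)) - u (x + t *: (s *: v)) - t *: (s ^+ 2 * A : K^o).
pose l (t : K^o) : K^o := 'D_(s *: v) u (x + s *: e + t *: (s *: v))
   - 'D_(s *: v) u (x + t *: (s *: v)) - (s ^+ 2 * A : K^o).
have inD (t b : K) : 0 <= t <= 1 -> 0 <= b <= s -> D (x + t *: (s *: v) + b *: e).
  by move=> /sc /inr H /H; rewrite scalerA => -[].
have wl (t : K^o) : 0 <= t <= 1 -> is_derive t 1 w (l t).
  move=> t01.
  have D1 : D (x + s *: e + t *: (s *: v)) by rewrite addrAC; exact: inD.
  have D2 : D (x + t *: (s *: v)).
    by have := @inD t 0 t01; rewrite scale0r addr0; apply; rewrite lexx ltW.
  have i1 := is_derive_line (u1 _ D1); have i2 := is_derive_line (u1 _ D2).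
  have i3 : is_derive t 1 (fun t : K^o => t *: (s ^+ 2 * A : K^o)) (s ^+ 2 * A : K^o).
    exact: is_derive_scale.
  exact: is_deriveB.
have lb (t : K^o) : 0 <= t <= 1 -> `|l t| <= s ^+ 2 * eps *+ 2.
  move=> t01.
  have D2 b (bs : 0 <= b <= s) : D (x + t *: (s *: v) + b *: e) by exact: inD.
  have lin y : D y -> 'D_(s *: v) u y = s *: 'D_v u y.
    by move=> Dy; rewrite !deriveE ?linearZ //; exact: u1.
  (* The derivative [l t] is itself an increment, along [e]. *)
  pose k (b : K^o) : K^o := s *: 'D_v u (x + t *: (s *: v) + b *: (s *: e))
      - b *: (s ^+ 2 * A : K^o).
  pose kl (b : K^o) : K^o := s *: 'D_(s *: e) (fun y => 'D_v u y)
      (x + t *: (s *: v) + b *: (s *: e)) - (s ^+ 2 * A : K^o).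
  have -> : l t = k 1 - k 0.
    rewrite /l /k !scale1r !scale0r !addr0 subr0 !lin.
    - by rewrite [x + s *: e + _]addrAC; exact: addrAC.
    - by have := D2 0; rewrite scale0r addr0; apply; rewrite lexx ltW.
    - by rewrite addrAC; exact: D2.
  apply: (mviK (w := k) (l := kl)) => b b01.
    have D3 : D (x + t *: (s *: v) + b *: (s *: e)).
      by rewrite [b *: _]scalerA; exact/D2/sc.
    have i1 := is_derive_line (u3 _ D3).
    have i3 : is_derive b 1 (fun t : K^o => t *: (s ^+ 2 * A : K^o)) (s ^+ 2 * A : K^o).
      exact: is_derive_scale.
    by apply: is_deriveB; exact: is_deriveZ.
  pose y := x + t *: (s *: v) + b *: (s *: e).
  have [Dy Ay] : (D `&` [set y | `|A - 'D_e (fun y => 'D_v u y) y| <= eps]) y.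
    by rewrite /y !scalerA; exact: inr (sc _ t01) (sc _ b01).
  have -> : kl b = s ^+ 2 * ('D_e (fun y => 'D_v u y) y - A).
    rewrite /kl -/y [in 'D_(s *: e) _ _]deriveE; last exact: u3.
    rewrite linearZ /= -deriveE; last exact: u3.
    by rewrite scalerA -expr2 [RHS]mulrBr.
  have aux (a z : K) : 0 <= a -> `|z| <= eps -> `|a * z| <= a * eps.
    by move=> a0 zeps; rewrite normrM (ger0_norm a0) ler_wpM2l.
  apply: aux s20 _.
  by rewrite distrC.
have := mviK wl lb; rewrite -mulrnA /w !scale1r !scale0r !addr0 subr0.
congr (`| _ | <= _).
rewrite [x + s *: e + _]addrAC [LHS]addrAC; congr (_ + _).
by rewrite opprB [u x - _]addrC addrA.
Qed.

Lemma eq_of_close (a b : K) :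
  (forall eps : K, 0 < eps -> `|a - b| <= eps *+ 8) -> a = b.
Proof.
move=> H; apply/eqP; rewrite -subr_eq0; apply/negPn/negP => ab.
have n0 : 0 < `|a - b| by rewrite normr_gt0.
have e0 : 0 < `|a - b| / 9 by rewrite divr_gt0.
have := H _ e0; rewrite -[_ *+ 8]mulr_natr -mulrA ler_pMr // ler_pdivlMl // mulr1.
by rewrite ler_nat.
Qed.

(** The second difference is symmetric in [v] and [e].  The order 3 gives
    the continuity of the second derivatives. *)
Lemma schwarz V (D : set V) (u : V -> K^o) (v e x : V) :
  open D -> D x -> diff_upto 3 D u ->
  'D_e (fun y => 'D_v u y) x = 'D_v (fun y => 'D_e u y) x.
Proof.
move=> oD Dx us; apply: eq_of_close => eps e0.
have [d1 d10 H1] := second_difference v e oD Dx us e0.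
have [d2 d20 H2] := second_difference e v oD Dx us e0.
have [s [s0 s1 s2]] : exists s, [/\ 0 < s, s <= d1 & s <= d2].
  (* A minimum is not at hand, the order of [K] being partial. *)
  exists (d1 * d2 / (d1 + d2)); have d0 : 0 < d1 + d2 by exact: addr_gt0.
  split; first by rewrite divr_gt0 // mulr_gt0.
    by rewrite ler_pdivrMr // ler_wpM2l ?(ltW d10) // lerDr ltW.
  by rewrite ler_pdivrMr // mulrC ler_wpM2l ?(ltW d20) // lerDl ltW.
have {H1} := H1 s; rewrite s0 s1 => /(_ isT) H1.
have {H2} := H2 s; rewrite s0 s2 => /(_ isT) H2.
have := lerD H1 H2; rewrite -mulrnDr [X in _ + X]distrC => H.
have := le_trans (ler_normD _ _) H.
rewrite [x + s *: e + s *: v]addrAC.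
have aux (T a b c A B : K) : `|T - a - b + c - s ^+ 2 * A +
  (s ^+ 2 * B - (T - b - a + c))| <= s ^+ 2 * eps *+ (4 + 4) -> `|A - B| <= eps *+ 8.
  have -> : T - a - b + c - s ^+ 2 * A + (s ^+ 2 * B - (T - b - a + c)) =
    s ^+ 2 * (B - A) by ring.
  have s20 : 0 < s ^+ 2 by rewrite exprn_gt0.
  by rewrite normrM gtr0_norm // -mulrnAr ler_pM2l // distrC.
exact: aux.
Qed.

End Schwarz.

(** * Hadamard's lemma along one direction *)

Section Hadamard.
Context {K : numFieldType} (mviK : mvi K) {V : normedModType K}.
Context (l : {linear V -> K^o}) (e z0 : V) (B : set V).
Hypotheses (l_cont : continuous l) (le1 : l e = 1) (B_open : open B).
Implicit Types (u f g : V -> K^o) (z v : V) (k : nat).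

Definition hcoord z : K^o := l (z - z0).
Definition hproj z : V := z - hcoord z *: e.

Hypothesis B_line : forall z s, B z -> `|s| <= `|hcoord z| -> B (hproj z + s *: e).

Let sm u := infinitely_diff B u.

Definition hproj_lin v : V := v - l v *: e.
Lemma hproj_lin_linear : linear hproj_lin.
Proof.
move=> a x y; rewrite /hproj_lin linearP scalerDl opprD addrACA -scalerA.
by rewrite -scalerBr.
Qed.
HB.instance Definition _ :=
  GRing.isLinear.Build K V V _ hproj_lin hproj_lin_linear.

Lemma hproj_lin_cont : continuous hproj_lin.
Proof.
move=> x; apply: cvgB; first exact: cvg_id.
by apply: cvgZr_tmp; exact: l_cont.
Qed.

Lemma hcoordD x y : hcoord (x + y) = l x + hcoord y.
Proof. by rewrite /hcoord -addrA linearD. Qed.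

Lemma hprojD x y : hproj (x + y) = hproj_lin x + hproj y.
Proof. by rewrite /hproj hcoordD scalerDl opprD addrACA. Qed.

Lemma hcoord_line z s : hcoord (hproj z + s *: e) = s.
Proof.
rewrite /hproj addrC addrA [s *: e + z]addrC -addrA addrC -scalerBl hcoordD linearZ /=.
by rewrite le1 /GRing.scale /= mulr1 subrK.
Qed.

Lemma hcoord_proj z : hcoord (hproj z) = 0.
Proof. by have := hcoord_line z 0; rewrite scale0r addr0. Qed.

Lemma hproj_line z s : hproj (hproj z + s *: e) = hproj z.
Proof. by rewrite {1}/hproj hcoord_line addrK. Qed.

Lemma hproj0 z : hcoord z = 0 -> hproj z = z.
Proof. by rewrite /hproj => ->; rewrite scale0r subr0. Qed.

Lemma hline z : hproj z + hcoord z *: e = z.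
Proof. by rewrite /hproj subrK. Qed.

Lemma B_proj z : B z -> B (hproj z).
Proof.
by move=> /(@B_line z 0); rewrite scale0r addr0 normr0; apply.
Qed.

Lemma hcoord_diff z : differentiable hcoord z.
Proof. exact: differentiable_affine hcoordD l_cont. Qed.

Lemma sm_ext u f : eq_on B u f -> sm u -> sm f.
Proof. by move=> uf us k; exact: diff_upto_ext B_open uf (us k). Qed.

Lemma sm_cst (c : K^o) : sm (fun=> c).
Proof. by move=> k; exact: diff_upto_cst. Qed.

Lemma sm_add u f : sm u -> sm f -> sm (fun z => u z + f z).
Proof. by move=> us fs k; exact: diff_upto_add. Qed.

Lemma sm_mul u f : sm u -> sm f -> sm (fun z => u z * f z : K^o).
Proof. by move=> us fs k; exact: diff_upto_mul. Qed.

Lemma sm_D u v : sm u -> sm (fun z => 'D_v u z).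
Proof. by move=> us k; have [_] := us k.+1; apply. Qed.

Lemma sm_diff u z : sm u -> B z -> differentiable u z.
Proof. by move=> us Bz; have [H _] := us 1%N; exact: H. Qed.

Lemma sm_hcoord : sm hcoord.
Proof.
have H := sm_add (fun k => diff_upto_lin k B l_cont) (@sm_cst (- l z0)).
by apply: sm_ext H => z _; rewrite /hcoord linearB.
Qed.

Lemma sm_X u k : sm u -> sm (fun z => u z ^+ k : K^o).
Proof.
move=> us; elim: k => [|k IH]; first exact: sm_cst.
by apply: sm_ext (sm_mul us IH) => z _; rewrite exprS.
Qed.

Lemma sm_sub u f : sm u -> sm f -> sm (fun z => u z - f z).
Proof.
move=> us fs; have H := sm_add us (sm_mul (@sm_cst (-1)) fs).
by apply: sm_ext H => z _; rewrite mulN1r.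
Qed.

Lemma sm_proj u : sm u -> sm (fun z => u (hproj z)).
Proof.
move=> us k; apply: (@diff_upto_sub _ _ _ _ (hproj @^-1` B)); first exact: B_proj.
exact: (diff_upto_affine hprojD hproj_lin_cont (us k)).
Qed.

Lemma D_hcoord v z : 'D_v hcoord z = l v.
Proof.
have X := derive_affine (id : K^o -> K^o) v z hcoordD.
by rewrite derive_id in X.
Qed.

Lemma D_sub u f v z : sm u -> sm f -> B z ->
  'D_v (fun z => u z - f z) z = 'D_v u z - 'D_v f z.
Proof.
by move=> us fs Bz; rewrite deriveB //; apply: diff_derivable; exact: sm_diff.
Qed.

Lemma D_mul u f v z : sm u -> sm f -> B z ->
  'D_v (fun z => u z * f z : K^o) z = u z * 'D_v f z + f z * 'D_v u z.
Proof.
by move=> us fs Bz; rewrite deriveM //; apply: diff_derivable; exact: sm_diff.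
Qed.

Lemma D_hcoordX v z k : B z ->
  'D_v (fun z => hcoord z ^+ k : K^o) z = k%:R * hcoord z ^+ k.-1 * l v.
Proof.
move=> Bz; elim: k => [|k IH]; first by rewrite derive_cst !mul0r.
have -> : (fun z => hcoord z ^+ k.+1 : K^o) = (fun z => hcoord z * hcoord z ^+ k : K^o).
  by apply: boolp.funext => y; rewrite exprS.
rewrite D_mul //; [|exact: sm_hcoord|exact: sm_X sm_hcoord].
have aux (h L : K) n : h * (n%:R * h ^+ n.-1 * L) + h ^+ n * L = n.+1%:R * h ^+ n * L.
  by case: n => [|n] /=; rewrite ?exprS -?natr1; ring.
by rewrite IH D_hcoord; exact: aux.
Qed.

(** The linear form [l] is a coordinate in the direction [e], and [hproj]
    projects along [e] onto the hyperplane of the points with the same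
    coordinate as [z0].  [tcoef k u] is the k-th Taylor coefficient of [u] in
    the direction [e] at the projected point, and [trem k u] the Taylor
    remainder. *)
Fixpoint tcoef k u : V -> K^o :=
  if k is k'.+1 then fun z => k%:R^-1 * tcoef k' (fun y => 'D_e u y) z
  else fun z => u (hproj z).

Fixpoint trem k u : V -> K^o :=
  if k is k'.+1 then fun z => trem k' u z - hcoord z ^+ k' * tcoef k' u z
  else u.

(** Hadamard's lemma asks for the smoothness of [tquo 1 u] only.  All orders
    are treated together because the derivative of [tquo k u] involves
    [tquo k.+1 u], see [tquo_diff]: the family is stable under derivation,
    which replaces the differentiation of an integral depending on a parameter. *)
Definition tquo k u : V -> K^o := fun z =>
  if hcoord z == 0 then tcoef k u z else trem k u z / hcoord z ^+ k.

Lemma tcoef_ext k u f : eq_on B u f -> eq_on B (tcoef k u) (tcoef k f).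
Proof.
elim: k u f => [|k IH] u f uf z Bz /=; first exact/uf/B_proj.
by rewrite (IH _ (fun y => 'D_e f y)) //; exact: derive_ext.
Qed.

Lemma tcoef_D k u z : tcoef k (fun y => 'D_e u y) z = k.+1%:R * tcoef k.+1 u z.
Proof. by rewrite /= mulrA divff ?mul1r // pnatr_eq0. Qed.

Lemma sm_tcoef k u : sm u -> sm (tcoef k u).
Proof.
elim: k u => [|k IH] u us /=; first exact: sm_proj.
by apply: sm_mul (@sm_cst _) (IH _ _); exact: sm_D.
Qed.

(** When [z] moves with velocity [v], its projection moves with velocity
    [v - l v *: e]; hence the correction term. *)
Lemma D_tcoef k u v z : sm u -> B z ->
  'D_v (tcoef k u) z
    = tcoef k (fun y => 'D_v u y) z - l v * k.+1%:R * tcoef k.+1 u z.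
Proof.
elim: k u => [|k IH] u us Bz.
  rewrite /= (derive_affine u v z hprojD) /= invr1 mul1r mulr1.
  have du := sm_diff us (B_proj Bz).
  by rewrite !deriveE // -[X in 'd _ _ X]/(v - l v *: e) linearB linearZ.
have dus := sm_D e us; have cs := sm_tcoef k dus.
have -> : 'D_v (tcoef k.+1 u) z = k.+1%:R^-1 * 'D_v (tcoef k (fun y => 'D_e u y)) z.
  rewrite /= D_mul //; last exact: sm_cst.
  by rewrite derive_cst mulr0 addr0.
rewrite (IH _ dus Bz).
have -> : tcoef k (fun y => 'D_v (fun y => 'D_e u y) y) z =
          tcoef k (fun y => 'D_e (fun y => 'D_v u y) y) z.
  by apply: tcoef_ext Bz => y By; exact: (schwarz mviK _ _ B_open By (us 3)).
rewrite tcoef_D (tcoef_D k.+1 u).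
have aux (a b L x y : K) : a != 0 -> a^-1 * (a * x - L * a * (b * y)) = x - L * b * y.
  by move=> a0; field.
by apply: aux; rewrite pnatr_eq0.
Qed.

Lemma sm_trem k u : sm u -> sm (trem k u).
Proof.
move=> us; elim: k => [|k IH] //=; apply: sm_sub IH _.
by apply: sm_mul; [exact: sm_X sm_hcoord|exact: sm_tcoef].
Qed.

Lemma D_trem k u v z : sm u -> B z ->
  'D_v (trem k u) z = trem k (fun y => 'D_v u y) z
    + l v * k%:R * hcoord z ^+ k.-1 * tcoef k u z.
Proof.
move=> us Bz; elim: k => [|k IH].
  have aux (a b c d : K) : a = a + d * 0 * b * c by ring.
  exact: aux.
have cs := sm_tcoef k us; have hs := sm_X k sm_hcoord.
have -> : 'D_v (trem k.+1 u) z = 'D_v (trem k u) z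
    - (hcoord z ^+ k * 'D_v (tcoef k u) z
       + tcoef k u z * (k%:R * hcoord z ^+ k.-1 * l v)).
  rewrite /= D_sub; [|exact: sm_trem|exact: sm_mul|by []].
  by rewrite D_mul // D_hcoordX.
rewrite IH (D_tcoef k v us Bz).
have aux (T L n h' c h ck m c1 : K) :
  T + L * n * h' * c - (h * (ck - L * m * c1) + c * (n * h' * L)) =
  T - h * ck + L * m * h * c1 by ring.
exact: aux.
Qed.

Lemma D_trem_e k u z : sm u -> B z ->
  'D_e (trem k.+1 u) z = trem k (fun y => 'D_e u y) z.
Proof.
move=> us Bz; rewrite D_trem // le1.
have -> : trem k.+1 (fun y => 'D_e u y) z = trem k (fun y => 'D_e u y) z
   - hcoord z ^+ k * tcoef k (fun y => 'D_e u y) z by [].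
rewrite tcoef_D.
have aux (T h a c : K) : T - h * (a * c) + 1 * a * h * c = T by ring.
exact: aux.
Qed.

Lemma trem_proj k u z : hcoord z = 0 -> trem k.+1 u z = 0.
Proof.
move=> hz; elim: k => [|k IH].
  by rewrite /= (hproj0 hz) expr0 mul1r subrr.
rewrite -[LHS]/(trem k.+1 u z - hcoord z ^+ k.+1 * tcoef k.+1 u z).
by rewrite IH hz exprS mul0r mul0r subrr.
Qed.

(** Taylor's estimate: [k] applications of the mean value inequality along
    [e], each of which costs a factor 2. *)
Lemma trem_bound k u z (C : K) : sm u -> B z ->
  (forall s, `|s| <= `|hcoord z| ->
     `|iter k (fun f y => 'D_e f y) u (hproj z + s *: e)| <= C) ->
  `|trem k u z| <= C * 2 ^+ k * `|hcoord z| ^+ k.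
Proof.
elim: k u z => [|k IH] u z us Bz HC.
  by rewrite !expr0 !mulr1; have := HC (hcoord z) (lexx _); rewrite hline.
have C0 : 0 <= C by apply: le_trans (HC _ (lexx _)).
have bnd (t : K) : 0 <= t <= 1 -> `|t * hcoord z| <= `|hcoord z|.
  move=> /andP[t0 t1]; rewrite normrM (ger0_norm t0); exact: ler_piMl.
have := @mvi_segment K mviK V (trem k.+1 u) (hproj z) (hcoord z *: e)
   (`|hcoord z| * (C * 2 ^+ k * `|hcoord z| ^+ k)).
rewrite hline (trem_proj k u (hcoord_proj z)) subr0 => H.
have -> : C * 2 ^+ k.+1 * `|hcoord z| ^+ k.+1 =
  `|hcoord z| * (C * 2 ^+ k * `|hcoord z| ^+ k) *+ 2.
  by rewrite !exprS -mulr_natl; ring.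
apply: H => t t01; rewrite scalerA.
  by apply: sm_diff; [exact: sm_trem|exact: B_line Bz (bnd _ t01)].
have By : B (hproj z + (t * hcoord z) *: e) by exact: B_line Bz (bnd _ t01).
have dr : differentiable (trem k.+1 u) (hproj z + (t * hcoord z) *: e).
  by apply: sm_diff => //; exact: sm_trem.
rewrite deriveE // linearZ /= -deriveE // D_trem_e // normrZ.
apply: ler_wpM2l => //.
have := IH (fun y => 'D_e u y) _ (sm_D e us) By.
rewrite hcoord_line hproj_line => /(_ _)/le_trans; apply.
  move=> s sh; have E := iterSr k (fun f y => 'D_e f y) u.
  rewrite -[iter k _ _]E.
  by apply: HC; apply: le_trans sh (bnd _ t01).
apply: ler_wpM2l; first by rewrite mulr_ge0 // exprn_ge0.
by rewrite lerXn2r ?nnegrE // bnd.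
Qed.

(** One step of Taylor's formula.  On the hyperplane, where the coordinate
    vanishes, a bound on [tquo k.+1 u] thus gives the continuity of [tquo k u],
    and the continuity of [tquo k.+1 u] the differentiability of [tquo k u]. *)
Lemma tquo_rec k u z : tquo k u z = tcoef k u z + hcoord z * tquo k.+1 u z.
Proof.
rewrite /tquo; case: eqP => [->|/eqP h0]; first by rewrite mul0r addr0.
rewrite -[trem k.+1 u z]/(trem k u z - hcoord z ^+ k * tcoef k u z).
have aux (h T c : K) (n : nat) : h != 0 -> T / h ^+ n = c + h * ((T - h ^+ n * c) / h ^+ n.+1).
  by move=> hn0; rewrite exprS; field; rewrite hn0 expf_neq0.
exact: aux.
Qed.

Lemma tquo0 u z : tquo 0 u z = u z.
Proof.
rewrite /tquo /=; case: eqP => [/hproj0->//|_]; by rewrite expr0 divr1.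
Qed.

Lemma sm_iterD k u : sm u -> sm (iter k (fun f y => 'D_e f y) u).
Proof. by move=> us; elim: k => //= k IH; exact: sm_D. Qed.

Lemma near_bounded f z : {for z, continuous f} ->
  \forall y \near z, `|f y| <= `|f z| + 1.
Proof.
move=> /cvgrPdist_le /(_ 1 ltr01); apply: filterS => y H.
by rewrite -lerBlDl; apply: le_trans H; rewrite distrC lerB_dist.
Qed.

Lemma tquo_bounded k u z : sm u -> B z -> hcoord z = 0 ->
  exists2 C : K, 0 < C & \forall y \near z, `|tquo k u y| <= C.
Proof.
move=> us Bz hz.
set F := iter k (fun f y => 'D_e f y) u.
have cF := near_bounded (differentiable_continuous (sm_diff (sm_iterD k us) Bz)).
have cc := near_bounded (differentiable_continuous (sm_diff (sm_tcoef k us) Bz)).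
(* The first summand bounds the quotient off the hyperplane, the second the
   Taylor coefficient on it. *)
exists ((`|F z| + 1) * 2 ^+ k + (`|tcoef k u z| + 1)).
  by rewrite addr_gt0 // ?mulr_gt0 // ltr_wpDl.
have /nbhs_ballP [r /= r0 Hr] := cF.
have H : \forall y \near z, `|hproj z - hproj y| + `|hcoord z - hcoord y| * `|e| < r.
  have c1 : {for z, continuous hproj}.
    exact/differentiable_continuous/(differentiable_affine z hprojD hproj_lin_cont).
  have c2 : {for z, continuous hcoord} by exact/differentiable_continuous/hcoord_diff.
  have r2 : 0 < r / (1 + `|e|) by rewrite divr_gt0 // ltr_pwDl.
  have /cvgrPdist_lt /(_ _ r2) H1 := c1.
  have /cvgrPdist_lt /(_ _ r2) H2 := c2.
  near=> y.
  have h1 : `|hproj z - hproj y| < r / (1 + `|e|) by near: y.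
  have h2 : `|hcoord z - hcoord y| < r / (1 + `|e|) by near: y.
  have -> : r = r / (1 + `|e|) + r / (1 + `|e|) * `|e|.
    have ne : 1 + `|e| != 0 by rewrite gt_eqF // ltr_pwDl.
    by field.
  by rewrite ltr_leD // ler_wpM2r // ltW.
near=> y.
have By : B y by near: y; exact: open_nbhs_nbhs.
have Hy : `|hproj z - hproj y| + `|hcoord z - hcoord y| * `|e| < r by near: y.
have Hc : `|tcoef k u y| <= `|tcoef k u z| + 1 by near: y.
have p1 : 0 <= `|F z| + 1 by rewrite addr_ge0.
rewrite /tquo; case: eqP => [_|/eqP h0].
  by apply: le_trans Hc _; rewrite lerDr mulr_ge0 // exprn_ge0.
rewrite normf_div normrX ler_pdivrMr ?exprn_gt0 ?normr_gt0 //.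
apply: le_trans (trem_bound us By (C := `|F z| + 1) _) _.
  move=> s sh; apply: Hr; rewrite -ball_normE /= opprD addrA.
  apply: le_lt_trans (ler_normB _ _) _; rewrite normrZ.
  apply: le_lt_trans Hy; rewrite hz sub0r normrN -{1}(hproj0 hz) lerD2l.
  by rewrite ler_wpM2r.
by apply: ler_wpM2r; [rewrite exprn_ge0|rewrite lerDl addr_ge0].
Unshelve. all: by end_near. Qed.

Lemma tquo_cvg k u z : sm u -> B z -> hcoord z = 0 ->
  {for z, continuous (tquo k u)}.
Proof.
move=> us Bz hz.
have [C C0 HC] := tquo_bounded k.+1 us Bz hz.
have cc := differentiable_continuous (sm_diff (sm_tcoef k us) Bz).
have ch : {for z, continuous hcoord} by exact/differentiable_continuous/hcoord_diff.
apply/cvgrPdist_le => eps e0.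
have e2 : 0 < eps / 2 by rewrite divr_gt0.
have e3 : 0 < eps / 2 / C by rewrite divr_gt0.
have /cvgrPdist_le /(_ _ e2) H1 := cc.
have /cvgrPdist_le /(_ _ e3) H2 := ch.
near=> y.
rewrite tquo_rec hz mul0r addr0 (tquo_rec k u y) opprD addrA.
apply: le_trans (ler_normB _ _) _.
rewrite [eps]splitr; apply: lerD; first by near: y.
have h1 : `|hcoord z - hcoord y| <= eps / 2 / C by near: y.
have h2 : `|tquo k.+1 u y| <= C by near: y.
move: h1; rewrite hz sub0r normrN => h1.
have aux (a b : K) : `|a| <= eps / 2 / C -> `|b| <= C -> `|a * b| <= eps / 2.
  move=> ha hb; rewrite normrM -[eps / 2](divfK (lt0r_neq0 C0)).
  exact: ler_pM.
exact: aux.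
Unshelve. all: by end_near. Qed.

Lemma tquo_diff0 k u z v : sm u -> B z -> hcoord z = 0 ->
  differentiable (tquo k u) z /\
  'D_v (tquo k u) z = 'D_v (tcoef k u) z + l v * tquo k.+1 u z.
Proof.
move=> us Bz hz; have cR := tquo_cvg (k := k.+1) us Bz hz.
have dc : differentiable (tcoef k u) z by apply: sm_diff => //; exact: sm_tcoef.
pose f y : K^o := hcoord y * tquo k.+1 u y.
pose L v : K^o := l v * tquo k.+1 u z.
have L_lin : linear L.
  move=> a x y; rewrite /L linearP mulrDl /GRing.scale /=; by rewrite mulrA.
pose LL : {linear V -> K^o} := HB.pack L (GRing.isLinear.Build K V K^o _ L L_lin).
have LL_cont : continuous LL.
  move=> x; rewrite /LL /= /L; apply: cvgMr_tmp; exact: l_cont.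
have [kk k0 Hk] := linear_lipschitz l_cont.
have [] := @differentiable_eps K V K^o f LL z LL_cont.
  move=> eps e0.
  have e1 : 0 < eps / kk by rewrite divr_gt0.
  have H : \forall h \near 0, `|tquo k.+1 u z - tquo k.+1 u (h + z)| <= eps / kk.
    have /cvgrPdist_le /(_ _ e1) := cR.
    by rewrite [X in X -> _](near_shift 0) /=; apply: filterS => y /=; rewrite subr0.
  near=> h.
  have hh : `|tquo k.+1 u z - tquo k.+1 u (h + z)| <= eps / kk by near: h.
  rewrite /f hz mul0r subr0 hcoordD hz addr0 /LL /= /L.
  have aux (a b c n : K) : `|a| <= kk * n -> `|c - b| <= eps / kk -> `|a * b - a * c| <= eps * n.
    move=> ha hb; rewrite -mulrBr normrM distrC.
    have -> : eps * n = kk * n * (eps / kk) by field; rewrite gt_eqF.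
    exact: ler_pM.
  by apply: aux hh; exact: Hk.
move=> df ddf.
have E : tquo k u = (fun y => tcoef k u y + f y).
  by apply: boolp.funext => y; exact: tquo_rec.
rewrite E; split; first exact: differentiableD.
rewrite deriveD; try exact: diff_derivable.
by congr (_ + _); rewrite deriveE // ddf.
Unshelve. all: by end_near. Qed.

(** Off the hyperplane this is the rule for quotients; on it,
    [tquo_diff0]. *)
Lemma tquo_diff k u z v : sm u -> B z ->
  differentiable (tquo k u) z /\
  'D_v (tquo k u) z = tquo k (fun y => 'D_v u y) z - l v * k%:R * tquo k.+1 u z.
Proof.
move=> us Bz; have [h0|h0] := eqVneq (hcoord z) 0.
  have [d ->] := tquo_diff0 k v us Bz h0; split=> //.
  rewrite D_tcoef // (tquo_rec k _ z) h0 /tquo h0 eqxx.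
  have aux (a c L : K) n t : a - L * n.+1%:R * c + L * c = a + 0 * t - L * n%:R * c.
    by rewrite -natr1; ring.
  exact: aux.
have hn : \near z, hcoord z != 0.
  have ch : {for z, continuous hcoord} by exact/differentiable_continuous/hcoord_diff.
  exact: (cvgr_neq0 _ ch).
have dt : differentiable (trem k u) z by apply: sm_diff => //; exact: sm_trem.
have hk0 : hcoord z ^+ k != 0 by rewrite expf_neq0.
have dh : differentiable (fun y => hcoord y ^+ k : K^o) z.
  by apply: sm_diff => //; exact: sm_X sm_hcoord.
have dq : differentiable (tquo k u) z.
  have D1 := differentiableM dt (differentiableV dh hk0).
  apply: near_eq_differentiable D1; near=> y; rewrite /tquo ifF //.
  by apply/negbTE; near: y.
split=> //.
have E : 'D_v (trem k u) z = 'D_v (fun y => tquo k u y * hcoord y ^+ k : K^o) z.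
  apply: near_eq_derive; near=> y; rewrite /tquo ifF ?divfK //.
    by rewrite expf_neq0 //; near: y.
  by apply/negbTE; near: y.
rewrite deriveM in E; try exact: diff_derivable.
rewrite D_hcoordX // D_trem // in E.
rewrite (tquo_rec k u z) in E.
rewrite {2}/tquo (negbTE h0).
have aux (T L h h' c q D : K) (n : nat) : h ^+ n != 0 -> n%:R * (h * h') = n%:R * h ^+ n ->
  T + L * n%:R * h' * c = (c + h * q) *: (n%:R * h' * L) + h ^+ n *: D ->
  D = T / h ^+ n - L * n%:R * q.
  move=> hn0 hh' EE.
  have EE2 : T + L * n%:R * h' * c = (c + h * q) * (n%:R * h' * L) + h ^+ n * D by exact: EE.
  apply: (mulfI hn0); rewrite mulrBr [h ^+ n * (T / _)]mulrCA divff // mulr1.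
  have -> : h ^+ n * (L * n%:R * q) = L * q * (n%:R * h ^+ n) by ring.
  have -> : h ^+ n * D = T + L * n%:R * h' * c - (c + h * q) * (n%:R * h' * L).
    by rewrite EE2; ring.
  by rewrite -hh'; ring.
have hh : k%:R * (hcoord z * hcoord z ^+ k.-1) = k%:R * hcoord z ^+ k.
  by case: (k) => [|n]; [rewrite !mul0r|rewrite -exprS].
exact: aux hk0 hh E.
Unshelve. all: by end_near. Qed.

Lemma sm_tquo k u : sm u -> sm (tquo k u).
Proof.
move=> us n; elim: n k u us => //= n IH k u us; split=> [z Bz|v].
  by have [] := tquo_diff k 0 us Bz.
have H : diff_upto n B (fun z => tquo k (fun y => 'D_v u y) z
      + (- (l v * k%:R)) * tquo k.+1 u z).
  apply: diff_upto_add => //; first exact/IH/sm_D.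
  apply: diff_upto_mul => //; first exact: diff_upto_cst.
  exact: IH.
apply: diff_upto_ext B_open _ H => z Bz.
have [_ ->] := tquo_diff k v us Bz.
by rewrite mulNr.
Qed.

Lemma hadamard1 u : sm u ->
  exists2 g : V -> K^o, sm g & forall z, u z = u (hproj z) + hcoord z * g z.
Proof.
move=> us; exists (tquo 1 u); first exact: sm_tquo.
by move=> z; rewrite -{1}(tquo0 u z) (tquo_rec 0).
Qed.

End Hadamard.

(** * Hadamard's lemma in coordinates *)

Section HadamardRow.
Context {K : numFieldType} (mviK : mvi K) (n : nat) (z0 : 'rV[K]_n) (rho : K).
Implicit Types (i j : 'I_n) (z : 'rV[K]_n) (u : 'rV[K]_n -> K^o).

Definition row_coord i (z : 'rV[K]_n) : K^o := z 0 i.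
Lemma row_coord_linear i : linear (row_coord i).
Proof. by move=> a x y; rewrite /row_coord !mxE. Qed.
HB.instance Definition _ i :=
  GRing.isLinear.Build K 'rV[K]_n K^o _ (row_coord i) (row_coord_linear i).

Lemma row_coord_cont i : continuous (row_coord i).
Proof. exact: coord_continuous. Qed.

Let B := ball z0 rho.
Let P i := hproj (row_coord i) (delta_mx 0 i) z0.

Lemma row_projE i z j : P i z 0 j = if j == i then z0 0 i else z 0 j.
Proof.
rewrite -[P i z]/(z - row_coord i (z - z0) *: delta_mx 0 i) !mxE /row_coord !mxE.
rewrite eqxx /=; case: eqP => [->|_]; first by rewrite mulr1 opprB addrC subrK.
by rewrite mulr0 subr0.
Qed.

Lemma row_hcoordE i z : hcoord (row_coord i) z0 z = z 0 i - z0 0 i.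
Proof. by rewrite -[LHS]/((z - z0) 0 i) !mxE. Qed.

Lemma ball_row z : 0 < rho -> (forall j, `|z0 0 j - z 0 j| < rho) -> B z.
Proof. by move=> r0 H; split=> // a j; rewrite ord1 -ball_normE; exact: H. Qed.

Lemma ball_rowP z : B z -> 0 < rho /\ forall j, `|z0 0 j - z 0 j| < rho.
Proof. by move=> [r0 H]; split=> // j; have := H 0 j; rewrite -ball_normE. Qed.

Lemma ball_row_line i z (s : K) : B z ->
  `|s| <= `|hcoord (row_coord i) z0 z| -> B (P i z + s *: delta_mx 0 i).
Proof.
move=> /ball_rowP[r0 H] hs; apply: ball_row => // j.
rewrite mxE row_projE !mxE; have := H j.
rewrite eqxx /=; case: eqP => [->|ne] Hj.
  rewrite mulr1 opprD addNKr normrN; apply: le_lt_trans hs _.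
  by rewrite row_hcoordE distrC.
by rewrite mulr0 addr0.
Qed.

Lemma row_coord_delta i : row_coord i (delta_mx 0 i) = 1.
Proof. by rewrite /row_coord mxE !eqxx. Qed.

Fixpoint row_projs s z := if s is i :: s' then P i (row_projs s' z) else z.

(** The coordinates in [s] are moved to those of [z0] one after the other;
    each move contributes a term by [hadamard1]. *)
Lemma hadamard_list s u : infinitely_diff B u ->
  exists2 g : 'I_n -> 'rV[K]_n -> K^o, (forall i, infinitely_diff B (g i)) &
    forall z, u z = u (row_projs s z) + \sum_i (z 0 i - z0 0 i) * g i z.
Proof.
have oB : open B by exact: ball_open.
elim: s u => [|i s IH] u us.
  exists (fun=> fun=> 0) => [i k|z]; first exact: diff_upto_cst.
  by rewrite big1 ?addr0 // => i _; rewrite mulr0.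
have [g1 g1s E1] := hadamard1 mviK (@row_coord_cont i) (row_coord_delta i) oB
   (@ball_row_line i) us.
have us2 : infinitely_diff B (fun z => u (P i z)).
  exact: (sm_proj (@row_coord_cont i) (@ball_row_line i) us).
have [g gs E2] := IH _ us2.
exists (fun j z => if j == i then g1 z + g j z else g j z) => [j k|z].
  by case: (j == i); [apply: diff_upto_add => //; exact: gs|exact: gs].
rewrite E1 -/(P i z) E2 -addrA; congr (_ + _).
rewrite (bigD1 i) //= [in RHS](bigD1 i) //= eqxx mulrDr.
under [in RHS]eq_bigr => j ji do rewrite (negbTE ji).
rewrite -[row_coord i (z - z0)]/(hcoord (row_coord i) z0 z) row_hcoordE.
by rewrite [LHS]addrC addrA.
Qed.

Lemma row_projs_in s z i : i \in s -> row_projs s z 0 i = z0 0 i.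
Proof.
elim: s => //= j s IH; rewrite inE row_projE; case: eqP => [->//|_] /IH.
by [].
Qed.

Lemma hadamard_row u : infinitely_diff B u ->
  exists2 g : 'I_n -> 'rV[K]_n -> K^o, (forall i, infinitely_diff B (g i)) &
    forall z, u z = u z0 + \sum_i (z 0 i - z0 0 i) * g i z.
Proof.
move=> /(hadamard_list (enum 'I_n))[g gs E]; exists g => // z.
rewrite E; congr (u _ + _); apply/rowP => i.
by rewrite row_projs_in // mem_enum.
Qed.

End HadamardRow.

(** * The calculus shared by holomorphic and smooth functions *)

Section MoreDiff.
Context {K : numFieldType}.
Implicit Types V W : normedModType K.

Lemma diff_upto_inv V k (D : set V) (u : V -> K^o) : open D ->
  (forall x, D x -> u x != 0) ->
  diff_upto k D u -> diff_upto k D (fun x => (u x)^-1 : K^o).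
Proof.
move=> oD un0; elim: k => // k IH us.
have [u1 u2] := us; have us' := diff_upto_pred us; split=> [x Dx|v].
  by apply: differentiableV; [exact: u1|exact: un0].
have H : diff_upto k D (fun x => (-1) * 'D_v u x * ((u x)^-1 * (u x)^-1) : K^o).
  apply: diff_upto_mul => //; last by apply: diff_upto_mul => //; exact: IH.
  by apply: diff_upto_mul; [exact: oD|exact: diff_upto_cst|exact: u2].
apply: diff_upto_ext oD _ H => x Dx.
rewrite deriveV ?un0 //; last by apply: diff_derivable; exact: u1.
have aux (a b : K) : -1 * a * (b^-1 * b^-1) = - (b ^- 2) * a.
  by rewrite -expr2 exprVn mulN1r mulrC mulNr mulrN.
exact: aux.
Qed.

Lemma inf_diff_differentiable V W (D : set V) (u : V -> W) x :
  infinitely_diff D u -> D x -> differentiable u x.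
Proof. by move=> /(_ 1%N)[H _]; exact: H. Qed.

Lemma inf_diff_deriv V W (D : set V) (u : V -> W) v :
  infinitely_diff D u -> infinitely_diff D (fun x => 'D_v u x).
Proof. by move=> H k; have [_] := H k.+1; apply. Qed.

Lemma pair1_linear V W : linear (fun x : V => (x, 0 : W)).
Proof. by move=> a x y; apply: injective_projections => /=; rewrite ?scaler0 ?addr0. Qed.

Lemma pair2_linear V W : linear (fun y : W => (0 : V, y)).
Proof. by move=> a x y; apply: injective_projections => /=; rewrite ?scaler0 ?addr0. Qed.

Section Slices.
Context {V W : normedModType K}.
Definition pair1 (x : V) : V * W := (x, 0).
HB.instance Definition _ :=
  GRing.isLinear.Build K V (V * W)%type _ pair1 (@pair1_linear V W).
Definition pair2 (y : W) : V * W := (0, y).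
HB.instance Definition _ :=
  GRing.isLinear.Build K W (V * W)%type _ pair2 (@pair2_linear V W).

Lemma pair1_cont : continuous pair1.
Proof. by move=> x; apply: cvg_pair; [exact: cvg_id|exact: cvg_cst]. Qed.

Lemma pair2_cont : continuous pair2.
Proof. by move=> x; apply: cvg_pair; [exact: cvg_cst|exact: cvg_id]. Qed.

Lemma slice1D y x x' : (x + x', y) = pair1 x + (x', y) :> V * W.
Proof. by apply: injective_projections => /=; rewrite ?add0r. Qed.

Lemma slice2D x y y' : (x, y + y') = pair2 y + (x, y') :> V * W.
Proof. by apply: injective_projections => /=; rewrite ?add0r. Qed.

Lemma inf_diff_slice1 (U : normedModType K) (D : set (V * W)) (u : V * W -> U) y :
  infinitely_diff D u ->
  infinitely_diff [set x | D (x, y)] (fun x => u (x, y)).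
Proof.
move=> H k; exact: (diff_upto_affine (slice1D y) pair1_cont (H k)).
Qed.

Lemma inf_diff_slice2 (U : normedModType K) (D : set (V * W)) (u : V * W -> U) x :
  infinitely_diff D u ->
  infinitely_diff [set y | D (x, y)] (fun y => u (x, y)).
Proof.
move=> H k; exact: (diff_upto_affine (slice2D x) pair2_cont (H k)).
Qed.

Lemma derive_slice2 (U : normedModType K) (u : V * W -> U) w x y :
  'D_w (fun y => u (x, y)) y = 'D_((0, w)) u (x, y).
Proof. exact: (derive_affine u w y (slice2D x)). Qed.
End Slices.

Lemma velocity_row (R : realType) (inj : {rmorphism R -> K}) n
    (h : R -> 'rV[K]_n) (h' : 'rV[K]_n) :
  (forall i, velocity inj (fun t => h t 0 i : K^o) (h' 0 i)) -> velocity inj h h'.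
Proof.
move=> H; rewrite /velocity; apply/cvg_ballP => e e0.
have : \forall t \near 0^', forall i : 'I_n,
    ball (h' 0 i : K^o) e ((inj t)^-1 *: (h t 0 i - h 0 0 i : K^o)).
  apply: filter_forall => i.
  by have /cvg_ballP/(_ e e0) := H i.
apply: filterS => t Ht; split=> // a i; rewrite ord1 !mxE.
exact: Ht.
Qed.

End MoreDiff.

Local Notation nmod dm := (normedModType (dm_field dm)).

(** What the proof uses of a local model, with the inclusions [c_inj] of R in
    the field of the model and [c_emb] of this field in C.  Everything that
    happens in charts is derived from this list, hence done once for both
    models. *)
Record calculus (R : realType) (dm : diff_model R) := Calculus {
  c_inj : {rmorphism R -> dm_field dm};
  c_inj_cont : continuous (c_inj : R -> (dm_field dm)^o);
  c_emb : dm_field dm -> R[i];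
  c_embB : forall a b, c_emb (a - b) = c_emb a - c_emb b;
  c_inj_le1 : forall t, 0 <= t <= 1 -> `|c_inj t| <= 1;
  c_emb1 : c_emb 1 = 1;
  c_ext : forall (V : nmod dm) (D : set V) u w, open D ->
    eq_on D u w -> dm_fun dm D u -> dm_fun dm D w;
  c_sub : forall (V : nmod dm) (D D' : set V) u,
    D' `<=` D -> dm_fun dm D u -> dm_fun dm D' u;
  c_cst : forall (V : nmod dm) (D : set V) c,
    dm_fun dm D (fun=> c);
  c_add : forall (V : nmod dm) (D : set V) u w, open D ->
    dm_fun dm D u -> dm_fun dm D w -> dm_fun dm D (fun x => u x + w x);
  c_mul : forall (V : nmod dm) (D : set V) u w, open D ->
    dm_fun dm D u -> dm_fun dm D w -> dm_fun dm D (fun x => u x * w x);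
  c_inv : forall (V : nmod dm) (D : set V) u, open D ->
    (forall x, D x -> u x != 0) ->
    dm_fun dm D u -> dm_fun dm D (fun x => (u x)^-1);
  c_coord : forall n (D : set 'rV[dm_field dm]_n) i,
    dm_fun dm D (fun z => c_emb (z 0 i));
  c_cont : forall (V : nmod dm) (D : set V) u x,
    dm_fun dm D u -> D x -> {for x, continuous (u : V -> R[i]^o)};
  c_deriv : forall (V : nmod dm) (D : set V) u v,
    dm_fun dm D u -> dm_fun dm D (dm_deriv dm v u);
  c_slice1 : forall (V W : nmod dm) (D : set (V * W)) u y,
    dm_fun dm D u -> dm_fun dm [set x | D (x, y)] (fun x => u (x, y));
  c_slice2 : forall (V W : nmod dm) (D : set (V * W)) u x,
    dm_fun dm D u -> dm_fun dm [set y | D (x, y)] (fun y => u (x, y));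
  c_dslice2 : forall (V W : nmod dm) (u : V * W -> R[i]) w x y,
    dm_deriv dm w (fun y => u (x, y)) y = dm_deriv dm (0 : V, w) u (x, y);
  c_dadd : forall (V : nmod dm) (D : set V) u v w x,
    dm_fun dm D u -> D x ->
    dm_deriv dm (v + w) u x = dm_deriv dm v u x + dm_deriv dm w u x;
  c_dext : forall (V : nmod dm) (D : set V) u w v, open D ->
    eq_on D u w -> eq_on D (dm_deriv dm v u) (dm_deriv dm v w);
  c_chain : forall (V : nmod dm) (D : set V) u h (h' : V),
    dm_fun dm D u -> D (h 0) -> velocity c_inj h h' ->
    cder (fun t => u (h t)) (dm_deriv dm h' u (h 0));
  c_dcoord : forall n i (z v : 'rV[dm_field dm]_n),
    dm_deriv dm v (fun z => c_emb (z 0 i)) z = c_emb (v 0 i);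
  c_velocity : forall n (h : R -> 'rV[dm_field dm]_n),
    (forall i, exists l, cder (fun t => c_emb (h t 0 i)) l) ->
    exists h', velocity c_inj h h';
  c_schwarz : forall (V : nmod dm) (D : set V) u v w x,
    open D -> D x -> dm_fun dm D u ->
    dm_deriv dm w (dm_deriv dm v u) x = dm_deriv dm v (dm_deriv dm w u) x;
  c_hadamard : forall n (z0 : 'rV[dm_field dm]_n) rho u,
    dm_fun dm (ball z0 rho) u ->
    exists2 g : 'I_n -> 'rV[dm_field dm]_n -> R[i],
      forall i, dm_fun dm (ball z0 rho) (g i) &
      forall z, u z = u z0 + \sum_i c_emb (z 0 i - z0 0 i) * g i z }.

Section Holomorphic.
Context {R : realType}.
Local Notation C := R[i].
Local Notation inj := (real_complex R).

Lemma holo_chain (V : normedModType C) (D : set V) (u : V -> C) h (h' : V) :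
  @infinitely_diff C V C^o D u -> D (h 0) -> velocity inj h h' ->
  cder (fun t => u (h t)) (@derive C V C^o u (h 0) h').
Proof.
move=> us Dh vh; constructor.
have du : differentiable (u : V -> C^o) (h 0) by exact: inf_diff_differentiable us Dh.
exact: (velocity_chain real_complex_cont du vh).
Qed.

Lemma derive_coord (K : numFieldType) n i (z v : 'rV[K]_n) :
  'D_v (fun z : 'rV[K]_n => z 0 i : K^o) z = v 0 i.
Proof.
have d : differentiable (row_coord i) z.
  by apply: linear_differentiable; exact: row_coord_cont.
rewrite -[LHS]/('D_v (row_coord i) z) deriveE //.
by rewrite diff_lin //; exact: row_coord_cont.
Qed.

Lemma inf_diff_coord (K : numFieldType) n i (D : set 'rV[K]_n) :
  @infinitely_diff K _ K^o D (fun z => z 0 i).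
Proof. by move=> k; exact: (diff_upto_lin k D (@row_coord_cont K n i)). Qed.

Lemma inf_diff_deriveD (K : numFieldType) (V : normedModType K) (D : set V)
    (u : V -> K^o) (v w x : V) :
  @infinitely_diff K V K^o D u -> D x -> 'D_(v + w) u x = 'D_v u x + 'D_w u x.
Proof.
move=> us Dx; have du := inf_diff_differentiable us Dx.
by rewrite !deriveE // linearD.
Qed.

Lemma inf_diff_schwarz (K : numFieldType) (mviK : mvi K) (V : normedModType K)
    (D : set V) (u : V -> K^o) (v w x : V) :
  open D -> D x -> @infinitely_diff K V K^o D u ->
  'D_w (fun y => 'D_v u y) x = 'D_v (fun y => 'D_w u y) x.
Proof. by move=> oD Dx us; exact: (schwarz mviK v w oD Dx (us 3)). Qed.

Lemma inf_diff_cont (K : numFieldType) (V W : normedModType K) (D : set V)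
    (u : V -> W) x :
  infinitely_diff D u -> D x -> {for x, continuous u}.
Proof.
by move=> us Dx; apply/differentiable_continuous/(inf_diff_differentiable us Dx).
Qed.

Lemma holo_velocity n (h : R -> 'rV[C]_n) :
  (forall i, exists l, cder (fun t => h t 0 i) l) ->
  exists h', velocity inj h h'.
Proof.
move=> /boolp.choice[l Hl]; exists (\row_i l i); apply: velocity_row => i.
by rewrite mxE; case: (Hl i).
Qed.

Definition holomorphic_calculus : calculus (holomorphic_model R).
Proof.
unshelve eapply (@Calculus R (holomorphic_model R)
  (real_complex R : {rmorphism R -> dm_field (holomorphic_model R)}) _ id).
- exact: real_complex_cont.
- by [].
- move=> t /andP[t0 t1]; rewrite normC_real -(rmorph1 (real_complex R)) lecR.
  by rewrite ger0_norm.
- by [].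
- by move=> V D u w oD uw us k; exact: (@diff_upto_ext C V C^o k D u w oD uw (us k)).
- by move=> V D D' u DD us k; exact: (@diff_upto_sub C V C^o k D D' u DD (us k)).
- by move=> V D c k; exact: (@diff_upto_cst C V C^o k D c).
- by move=> V D u w oD us ws k;
    exact: (@diff_upto_add C V C^o k D u w oD (us k) (ws k)).
- by move=> V D u w oD us ws k;
    exact: (@diff_upto_mul C V k D u w oD (us k) (ws k)).
- by move=> V D u oD u0 us k; exact: (@diff_upto_inv C V k D u oD u0 (us k)).
- by move=> n D i; exact: (@inf_diff_coord C n i D).
- by move=> V D u x us Dx; exact: (@inf_diff_cont C V C^o D u x us Dx).
- by move=> V D u v us; exact: (@inf_diff_deriv C V C^o D u v us).
- by move=> V W D u y us; exact: (@inf_diff_slice1 C V W C^o D u y us).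
- by move=> V W D u y us; exact: (@inf_diff_slice2 C V W C^o D u y us).
- by move=> V W u v x y; exact: (@derive_slice2 C V W C^o u v x y).
- by move=> V D u v w x us Dx; exact: (@inf_diff_deriveD C V D u v w x us Dx).
- by move=> V D u w v oD uw; exact: (@derive_ext C V C^o D u w v oD uw).
- by move=> V D u h h' us Dh vh; exact: (@holo_chain V D u h h' us Dh vh).
- by move=> n i z v; exact: (@derive_coord C n i z v).
- by move=> n h H; exact: (@holo_velocity n h H).
- by move=> V D u v w x oD Dx us;
    exact: (@inf_diff_schwarz C (@mvi_complex R) V D u v w x oD Dx us).
- move=> n z0 rho u us.
  by have [g gs E] := @hadamard_row C (@mvi_complex R) n z0 rho u us; exists g.
Defined.

End Holomorphic.

Section Smooth.
Context {R : realType}.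
Local Notation C := R[i].

Lemma eq_ReIm (a b : C) :
  complex.Re a = complex.Re b -> complex.Im a = complex.Im b -> a = b.
Proof. by case: a b => [a1 a2] [b1 b2] /= -> ->. Qed.

Lemma cder_ReIm (F : R -> C) (a b : R) :
  velocity (idfun : {rmorphism R -> R}) (fun t => complex.Re (F t) : R^o) a ->
  velocity (idfun : {rmorphism R -> R}) (fun t => complex.Im (F t) : R^o) b ->
  cder F (a +i* b)%C.
Proof.
move=> Ha Hb; constructor; apply/(@cvgrPdist_le _ C^o) => e /gt0_real[r r0 ->].
have r2 : 0 < r / 2 by rewrite divr_gt0.
have /cvgrPdist_le/(_ _ r2) H1 := Ha.
have /cvgrPdist_le/(_ _ r2) H2 := Hb.
near=> t; apply: le_trans (norm_le_ReIm _) _; rewrite lecR [r]splitr.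
have E : (t%:C%C)^-1 = (t^-1)%:C%C by rewrite fmorphV.
have h1 : `|a - t^-1 * (complex.Re (F t) - complex.Re (F 0))| <= r / 2 by near: t.
have h2 : `|b - t^-1 * (complex.Im (F t) - complex.Im (F 0))| <= r / 2 by near: t.
have aux (z w : C) (s : R) : complex.Re ((a +i* b)%C - s%:C%C * (z - w)) =
   a - s * (complex.Re z - complex.Re w) /\
   complex.Im ((a +i* b)%C - s%:C%C * (z - w)) =
   b - s * (complex.Im z - complex.Im w).
  by case: z w => [z1 z2] [w1 w2] /=; split; ring.
have [e1 e2] := aux (F t) (F 0) t^-1.
have -> : (a +i* b)%C - (t%:C%C)^-1 *: (F t - F 0 : C^o) =
          (a +i* b)%C - (t^-1)%:C%C * (F t - F 0) by rewrite E.
by rewrite e1 e2; apply: lerD.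
Unshelve. all: by end_near. Qed.

Definition smooth_fun (V : normedModType R) (D : set V) (u : V -> C) :=
  @infinitely_diff R V R^o D (fun x => complex.Re (u x)) /\
  @infinitely_diff R V R^o D (fun x => complex.Im (u x)).

Definition smooth_deriv (V : normedModType R) (v : V) (u : V -> C) (x : V) : C :=
  (@derive R V R^o (fun y => complex.Re (u y)) x v +i*
   @derive R V R^o (fun y => complex.Im (u y)) x v)%C.

Lemma inf_diff_sub (V : normedModType R) (D : set V) (u w : V -> R^o) : open D ->
  infinitely_diff D u -> infinitely_diff D w ->
  infinitely_diff D (fun x => u x - w x : R^o).
Proof.
move=> oD us ws k.
have H := diff_upto_add oD (us k)
  (diff_upto_mul oD (@diff_upto_cst R V R^o k D (-1)) (ws k)).
by apply: diff_upto_ext oD _ H => x _; rewrite mulN1r.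
Qed.

Lemma inf_diff_mul (V : normedModType R) (D : set V) (u w : V -> R^o) : open D ->
  infinitely_diff D u -> infinitely_diff D w ->
  infinitely_diff D (fun x => u x * w x : R^o).
Proof. by move=> oD us ws k; exact: diff_upto_mul. Qed.

Lemma inf_diff_add (V : normedModType R) (D : set V) (u w : V -> R^o) : open D ->
  infinitely_diff D u -> infinitely_diff D w ->
  infinitely_diff D (fun x => u x + w x : R^o).
Proof. by move=> oD us ws k; exact: diff_upto_add. Qed.

Lemma inf_diff_ext (V : normedModType R) (D : set V) (u w : V -> R^o) : open D ->
  eq_on D u w -> infinitely_diff D u -> infinitely_diff D w.
Proof. by move=> oD uw us k; exact: diff_upto_ext oD uw (us k). Qed.

Lemma smooth_mul (V : normedModType R) (D : set V) (u w : V -> C) : open D ->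
  smooth_fun D u -> smooth_fun D w -> smooth_fun D (fun x => u x * w x).
Proof.
move=> oD [u1 u2] [w1 w2]; split.
  apply: inf_diff_ext oD _ (inf_diff_sub oD (inf_diff_mul oD u1 w1) (inf_diff_mul oD u2 w2)).
  by move=> x _; case: (u x) (w x) => [a b] [c d].
apply: inf_diff_ext oD _ (inf_diff_add oD (inf_diff_mul oD u1 w2) (inf_diff_mul oD u2 w1)).
by move=> x _; case: (u x) (w x) => [a b] [c d].
Qed.

Lemma smooth_inv (V : normedModType R) (D : set V) (u : V -> C) : open D ->
  (forall x, D x -> u x != 0) ->
  smooth_fun D u -> smooth_fun D (fun x => (u x)^-1).
Proof.
move=> oD u0 [u1 u2].
pose q x : R^o := complex.Re (u x) * complex.Re (u x) + complex.Im (u x) * complex.Im (u x).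
have qs : infinitely_diff D q.
  by apply: inf_diff_add => //; exact: inf_diff_mul.
have q0 x : D x -> q x != 0.
  move=> /u0; rewrite /q; case: (u x) => a b /=; apply: contraNN.
  rewrite -!expr2 paddr_eq0 ?sqr_ge0 // !sqrf_eq0 => /andP[/eqP-> /eqP->].
  by [].
have is_ : infinitely_diff D (fun x => (q x)^-1 : R^o).
  by move=> k; exact: diff_upto_inv oD q0 (qs k).
have zs : @infinitely_diff R V R^o D (fun=> 0) by move=> k; exact: diff_upto_cst.
split.
  apply: inf_diff_ext oD _ (inf_diff_mul oD u1 is_) => x _.
  by rewrite /q; case: (u x) => a b /=; rewrite !expr2.
apply: inf_diff_ext oD _ (inf_diff_sub oD zs (inf_diff_mul oD u2 is_)) => x _.
by rewrite /q; case: (u x) => a b /=; rewrite !expr2 sub0r.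
Qed.

Lemma smooth_cont (V : normedModType R) (D : set V) (u : V -> C) x :
  smooth_fun D u -> D x -> {for x, continuous (u : V -> C^o)}.
Proof.
move=> [u1 u2] Dx; apply/(@cvgrPdist_le _ C^o) => e /gt0_real[r r0 ->].
have r2 : 0 < r / 2 by rewrite divr_gt0.
have /cvgrPdist_le/(_ _ r2) H1 := inf_diff_cont u1 Dx.
have /cvgrPdist_le/(_ _ r2) H2 := inf_diff_cont u2 Dx.
near=> t; apply: le_trans (norm_le_ReIm _) _; rewrite lecR [r]splitr.
rewrite !raddfB; apply: lerD; by near: t.
Unshelve. all: by end_near. Qed.

Lemma idfun_cont : continuous (idfun : R -> R^o).
Proof. by move=> x; exact: cvg_id. Qed.

Lemma smooth_chain (V : normedModType R) (D : set V) (u : V -> C) h (h' : V) :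
  smooth_fun D u -> D (h 0) -> velocity (idfun : {rmorphism R -> R}) h h' ->
  cder (fun t => u (h t)) (smooth_deriv h' u (h 0)).
Proof.
move=> [u1 u2] Dh vh; apply: cder_ReIm.
  exact: (velocity_chain (idfun_cont) (inf_diff_differentiable u1 Dh) vh).
exact: (velocity_chain (idfun_cont) (inf_diff_differentiable u2 Dh) vh).
Qed.

Lemma smooth_hadamard n (z0 : 'rV[R]_n) rho (u : 'rV[R]_n -> C) :
  smooth_fun (ball z0 rho) u ->
  exists2 g : 'I_n -> 'rV[R]_n -> C,
    forall i, smooth_fun (ball z0 rho) (g i) &
    forall z, u z = u z0 + \sum_i (z 0 i - z0 0 i)%:C%C * g i z.
Proof.
move=> [u1 u2].
have [g1 g1s E1] := hadamard_row (@mvi_real R) u1.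
have [g2 g2s E2] := hadamard_row (@mvi_real R) u2.
exists (fun i z => (g1 i z +i* g2 i z)%C) => [i|z].
  by split; [exact: g1s|exact: g2s].
apply: eq_ReIm.
  rewrite raddfD raddf_sum E1; congr (_ + _); apply: eq_bigr => i _ /=.
  by rewrite mul0r subr0.
rewrite raddfD raddf_sum E2; congr (_ + _); apply: eq_bigr => i _ /=.
by rewrite mul0r addr0.
Qed.

Lemma smooth_velocity n (h : R -> 'rV[R]_n) :
  (forall i, exists l, cder (fun t => (h t 0 i)%:C%C) l) ->
  exists h', velocity (idfun : {rmorphism R -> R}) h h'.
Proof.
move=> /boolp.choice[l Hl]; exists (\row_i complex.Re (l i)); apply: velocity_row => i.
by rewrite mxE; exact: (real_linear_velocity (@Re_le_norm R) (@Re_scale R) (Hl i)).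
Qed.

Definition smooth_calculus : calculus (smooth_model R).
Proof.
unshelve eapply (@Calculus R (smooth_model R)
  (idfun : {rmorphism R -> dm_field (smooth_model R)}) _ (real_complex R)).
- exact: idfun_cont.
- by move=> a b; rewrite rmorphB.
- by move=> t /andP[t0 t1]; rewrite ger0_norm.
- exact: rmorph1.
- move=> V D u w oD uw [u1 u2]; split.
    by apply: (@inf_diff_ext V D _ _ oD _ u1) => x /uw ->.
  by apply: (@inf_diff_ext V D _ _ oD _ u2) => x /uw ->.
- move=> V D D' u DD [u1 u2].
  by split=> k; [exact: (@diff_upto_sub R V R^o k D D' _ DD (u1 k))
    |exact: (@diff_upto_sub R V R^o k D D' _ DD (u2 k))].
- by move=> V D c; split=> k; exact: (@diff_upto_cst R V R^o k D).
- move=> V D u w oD [u1 u2] [w1 w2]; split.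
    apply: (@inf_diff_ext V D _ _ oD _ (@inf_diff_add V D _ _ oD u1 w1)) => x _.
    by rewrite raddfD.
  apply: (@inf_diff_ext V D _ _ oD _ (@inf_diff_add V D _ _ oD u2 w2)) => x _.
  by rewrite raddfD.
- by move=> V D u w oD us ws; exact: (@smooth_mul V D u w oD us ws).
- by move=> V D u oD u0 us; exact: (@smooth_inv V D u oD u0 us).
- move=> n D i; split; first exact: (@inf_diff_coord R n i D).
  by move=> k; exact: (@diff_upto_cst R _ R^o k D).
- by move=> V D u x us Dx; exact: (@smooth_cont V D u x us Dx).
- by move=> V D u v [u1 u2]; split; [exact: (@inf_diff_deriv R V R^o D _ v u1)
    |exact: (@inf_diff_deriv R V R^o D _ v u2)].
- by move=> V W D u y [u1 u2]; split; [exact: (@inf_diff_slice1 R V W R^o D _ y u1)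
    |exact: (@inf_diff_slice1 R V W R^o D _ y u2)].
- by move=> V W D u y [u1 u2]; split; [exact: (@inf_diff_slice2 R V W R^o D _ y u1)
    |exact: (@inf_diff_slice2 R V W R^o D _ y u2)].
- move=> V W u v x y; apply: eq_ReIm => /=.
    exact: (@derive_slice2 R V W R^o (fun p => complex.Re (u p)) v x y).
  exact: (@derive_slice2 R V W R^o (fun p => complex.Im (u p)) v x y).
- move=> V D u v w x [u1 u2] Dx; apply: eq_ReIm => /=.
    exact: (@inf_diff_deriveD R V D _ v w x u1 Dx).
  exact: (@inf_diff_deriveD R V D _ v w x u2 Dx).
- move=> V D u w v oD uw x Dx; apply: eq_ReIm => /=.
    by apply: (@derive_ext R V R^o D _ _ v oD) => // y /uw ->.
  by apply: (@derive_ext R V R^o D _ _ v oD) => // y /uw ->.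
- by move=> V D u h h' us Dh vh; exact: (@smooth_chain V D u h h' us Dh vh).
- move=> n i z v; apply: eq_ReIm => /=; first exact: (@derive_coord R n i z v).
  exact: (@derive_cst R _ R^o).
- by move=> n h H; exact: (@smooth_velocity n h H).
- move=> V D u v w x oD Dx [u1 u2]; apply: eq_ReIm => /=.
    exact: (@inf_diff_schwarz R (@mvi_real R) V D _ v w x oD Dx u1).
  exact: (@inf_diff_schwarz R (@mvi_real R) V D _ v w x oD Dx u2).
- by move=> n z0 rho u us; exact: (@smooth_hadamard n z0 rho u us).
Defined.

End Smooth.

Definition category_calculus (R : realType) (k : category) :
    calculus (model_of R k) :=
  match k with
  | Analytic => holomorphic_calculus
  | Smooth => smooth_calculus
  | Algebraic => holomorphic_calculus
  end.

(** * Derivations of a sheaf of functions, and charts *)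

Section SpaceFunctions.
Context {R : realType} {X : space R}.
Implicit Types (V W D : set X) (a b : X -> R[i]).

Lemma fn_cmul V c a : fn X V a -> fn X V (fun p => c * a p).
Proof. by move=> Va; apply: fn_mul => //; exact: fn_cst (fn_open Va). Qed.

Lemma fn_opp V a : fn X V a -> fn X V (fun p => - a p).
Proof.
by move=> Va; apply: fn_eq (fn_cmul (-1) Va) _ => p _; rewrite mulN1r.
Qed.

Lemma fn_sub V a b : fn X V a -> fn X V b -> fn X V (fun p => a p - b p).
Proof. by move=> Va Vb; apply: fn_add => //; exact: fn_opp. Qed.

Lemma fn_lin V c a b : fn X V a -> fn X V b -> fn X V (fun p => c * a p + b p).
Proof. by move=> Va Vb; apply: fn_add => //; exact: fn_cmul. Qed.

Lemma fn_sum V (I : Type) (r : seq I) (F : I -> X -> R[i]) : open V ->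
  (forall i, fn X V (F i)) -> fn X V (fun p => \sum_(i <- r) F i p).
Proof.
move=> oV HF; elim: r => [|i r IH].
  by apply: fn_eq (fn_cst 0 oV) _ => p _; rewrite big_nil.
by apply: fn_eq (fn_add (HF i) IH) _ => p _; rewrite big_cons.
Qed.

Section Derivations.
Context {D : set X} {xi : op X} (xiD : derivation D xi).

Lemma der_fn V a : V `<=` D -> fn X V a -> fn X V (xi V a).
Proof. by case: xiD => + _ _ _ _; exact. Qed.

Lemma der_eq V a b : V `<=` D -> fn X V a -> eq_on V a b ->
  eq_on V (xi V a) (xi V b).
Proof. by case: xiD => _ + _ _ _; exact. Qed.

Lemma der_res V W a : V `<=` D -> open W -> W `<=` V -> fn X V a ->
  eq_on W (xi W a) (xi V a).
Proof. by case: xiD => _ _ + _ _; exact. Qed.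

Lemma der_lin V c a b : V `<=` D -> fn X V a -> fn X V b ->
  eq_on V (xi V (fun p => c * a p + b p)) (fun p => c * xi V a p + xi V b p).
Proof. by case: xiD => _ _ _ + _; exact. Qed.

Lemma der_mul V a b : V `<=` D -> fn X V a -> fn X V b ->
  eq_on V (xi V (fun p => a p * b p)) (fun p => xi V a p * b p + a p * xi V b p).
Proof. by case: xiD => _ _ _ _; exact. Qed.

Lemma der_restrict D' : D' `<=` D -> derivation D' xi.
Proof.
move=> DD; split=> V.
- by move=> a VD; apply: der_fn; exact: subset_trans VD DD.
- by move=> a b VD; apply: der_eq; exact: subset_trans VD DD.
- by move=> W a VD; apply: der_res; exact: subset_trans VD DD.
- by move=> c a b VD; apply: der_lin; exact: subset_trans VD DD.
- by move=> a b VD; apply: der_mul; exact: subset_trans VD DD.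
Qed.

Lemma op_congr V p a b : a =1 b -> xi V a p = xi V b p.
Proof. by move=> /boolp.funext ->. Qed.

Lemma der_0 V : V `<=` D -> open V -> eq_on V (xi V (fun=> 0)) (fun=> 0).
Proof.
move=> VD oV p Vp; have f0 := fn_cst 0 oV.
have := der_lin 1 VD f0 f0 Vp.
rewrite (@op_congr _ _ _ (fun=> 0)) => [|y]; last by rewrite mulr0 addr0.
by rewrite mul1r => /esym/eqP; rewrite -subr_eq0 addrK => /eqP.
Qed.

Lemma der_add V a b : V `<=` D -> fn X V a -> fn X V b ->
  eq_on V (xi V (fun p => a p + b p)) (fun p => xi V a p + xi V b p).
Proof.
move=> VD Va Vb p Vp; rewrite -[xi V a p]mul1r -(der_lin 1 VD Va Vb Vp).
by apply: op_congr => y; rewrite mul1r.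
Qed.

Lemma der_cmul V c a : V `<=` D -> fn X V a ->
  eq_on V (xi V (fun p => c * a p)) (fun p => c * xi V a p).
Proof.
move=> VD Va p Vp; have oV := fn_open Va.
have := der_lin c VD Va (fn_cst 0 oV) Vp; rewrite (der_0 VD oV Vp) addr0 => <-.
by apply: op_congr => y; rewrite addr0.
Qed.

Lemma der_cst V c : V `<=` D -> open V -> eq_on V (xi V (fun=> c)) (fun=> 0).
Proof.
move=> VD oV p Vp; have f1 := fn_cst 1 oV.
have e1 : xi V (fun=> 1) p = 0.
  have := der_mul VD f1 f1 Vp.
  rewrite (@op_congr _ _ _ (fun=> 1)) => [|y]; last by rewrite mulr1.
  by rewrite mulr1 mul1r => /esym/eqP; rewrite -subr_eq0 addrK => /eqP.
have := der_cmul c VD f1 Vp; rewrite e1 mulr0 => <-.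
by apply: op_congr => y; rewrite mulr1.
Qed.

Lemma der_opp V a : V `<=` D -> fn X V a ->
  eq_on V (xi V (fun p => - a p)) (fun p => - xi V a p).
Proof.
move=> VD Va p Vp; rewrite -mulN1r -(der_cmul (-1) VD Va Vp).
by apply: op_congr => y; rewrite mulN1r.
Qed.

Lemma der_sum V (I : Type) (r : seq I) (F : I -> X -> R[i]) :
  V `<=` D -> open V -> (forall i, fn X V (F i)) ->
  eq_on V (xi V (fun p => \sum_(i <- r) F i p))
          (fun p => \sum_(i <- r) xi V (F i) p).
Proof.
move=> VD oV HF p Vp; elim: r => [|i r IH].
  rewrite big_nil; apply: etrans (der_0 VD oV Vp).
  by apply: op_congr => y; rewrite big_nil.
rewrite big_cons -IH -(der_add VD (HF i) (fn_sum r oV HF) Vp).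
by apply: op_congr => y; rewrite big_cons.
Qed.

End Derivations.

(** A derivation at [q] sends the product of [g i] with a function vanishing
    at [q] to [g i q] times the derivative of that function. *)
Lemma der_combination D xi (n : nat) (a : X -> R[i]) (x g : 'I_n -> X -> R[i]) W q :
  derivation D xi -> W `<=` D -> open W -> W q ->
  fn X W a -> (forall i, fn X W (x i)) -> (forall i, fn X W (g i)) ->
  eq_on W a (fun p => a q + \sum_i (x i p - x i q) * g i p) ->
  xi W a q = \sum_i xi W (x i) q * g i q.
Proof.
move=> xiD WD oW Wq Wa Wx Wg E.
have Wy i : fn X W (fun p => x i p - x i q).
  by apply: fn_sub => //; exact: fn_cst.
have Wyg i : fn X W (fun p => (x i p - x i q) * g i p) by exact: fn_mul.
rewrite (der_eq xiD WD Wa E Wq) (der_add xiD WD (fn_cst _ oW)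
  (fn_sum _ oW Wyg) Wq) (der_cst xiD _ WD oW Wq) add0r.
rewrite (der_sum xiD _ WD oW Wyg Wq); apply: eq_bigr => i _.
rewrite (der_mul xiD WD (Wy i) (Wg i) Wq) subrr mul0r addr0; congr (_ * _).
rewrite (der_add xiD WD (Wx i) (fn_opp (fn_cst _ oW)) Wq).
rewrite (der_opp xiD WD (fn_cst _ oW) Wq) (der_cst xiD _ WD oW Wq).
by rewrite oppr0 addr0.
Qed.

End SpaceFunctions.

Section Charts.
Context {R : realType} {dm : diff_model R} (cal : calculus dm) {X : space R}.
Local Notation K := (dm_field dm).

Lemma line0 (V : normedModType K) (x v : V) : x + c_inj cal 0 *: v = x.
Proof. by rewrite rmorph0 scale0r addr0. Qed.

Lemma dm_line (V : normedModType K) (D : set V) u (x v : V) :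
  dm_fun dm D u -> D x -> cder (fun t => u (x + c_inj cal t *: v)) (dm_deriv dm v u x).
Proof.
move=> Du Dx; have := @c_chain _ _ cal V D u (fun t => x + c_inj cal t *: v) v.
by rewrite line0; apply => //; exact: velocity_affine.
Qed.

Lemma dm_deriv_lin (V : normedModType K) (D : set V) u w (c : R[i]) (x v : V) : open D ->
  dm_fun dm D u -> dm_fun dm D w -> D x ->
  dm_deriv dm v (fun y => c * u y + w y) x
    = c * dm_deriv dm v u x + dm_deriv dm v w x.
Proof.
move=> oD Du Dw Dx.
have Dcu : dm_fun dm D (fun y => c * u y + w y).
  apply: (c_add cal oD) => //; apply: (c_mul cal oD) => //; exact: (c_cst cal).
apply: cder_uniq (dm_line v Dcu Dx) _.
exact: (cderD (cderZ c (dm_line v Du Dx)) (dm_line v Dw Dx)).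
Qed.

Lemma dm_deriv_mul (V : normedModType K) (D : set V) u w (x v : V) : open D ->
  dm_fun dm D u -> dm_fun dm D w -> D x ->
  dm_deriv dm v (fun y => u y * w y) x
    = dm_deriv dm v u x * w x + u x * dm_deriv dm v w x.
Proof.
move=> oD Du Dw Dx; have Duw := c_mul cal oD Du Dw.
apply: cder_uniq (dm_line v Duw Dx) _.
have := cderM (dm_line v Du Dx) (dm_line v Dw Dx).
by rewrite line0.
Qed.

Section Chart.
Context {n : nat} (c : chart dm X n).

Lemma chart_open V : open V -> V `<=` ch_dom c -> open (ch_map c @` V).
Proof.
move=> oV Vd; rewrite openE => _ [p Vp <-].
have dp := Vd _ Vp.
have H1 : nbhs (ch_map c p) (ch_map c @` ch_dom c).
  by apply: open_nbhs_nbhs; split; [exact: ch_open_im|exists p].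
have H2 : nbhs (ch_map c p) [set z | V (ch_inv c z)].
  apply: (ch_inv_cont dp); rewrite (ch_mapK dp).
  exact: open_nbhs_nbhs.
near=> z; have [p' dp' E] : (ch_map c @` ch_dom c) z by near: z.
exists p' => //; rewrite -(ch_mapK dp') E; by near: z.
Unshelve. all: by end_near. Qed.

Lemma chart_fn V a : V `<=` ch_dom c -> fn X V a ->
  dm_fun dm (ch_map c @` V) (fun z => a (ch_inv c z)).
Proof. by move=> Vd Va; have [H _] := @ch_fn _ _ _ _ c V a (fn_open Va) Vd; exact: H. Qed.

Lemma chart_fnI V a u : open V -> V `<=` ch_dom c ->
  dm_fun dm (ch_map c @` V) u -> (forall p, V p -> a p = u (ch_map c p)) ->
  fn X V a.
Proof.
move=> oV Vd Du E; have [_] := @ch_fn _ _ _ _ c V a oV Vd; apply; apply: (c_ext cal (chart_open oV Vd)) Du.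
by move=> _ [p Vp <-]; rewrite (ch_mapK (Vd _ Vp)) E.
Qed.

Definition crd (i : 'I_n) : X -> R[i] := fun p => c_emb cal (ch_map c p 0 i).

Lemma fn_crd V i : open V -> V `<=` ch_dom c -> fn X V (crd i).
Proof. by move=> oV Vd; apply: (chart_fnI oV Vd (c_coord cal _ i)). Qed.

Lemma coord_field_derivation (i : 'I_n) : derivation (ch_dom c) (coord_field c i).
Proof.
split.
- move=> V a Vd Va;
  by apply: (chart_fnI (fn_open Va) Vd
    (c_deriv cal (delta_mx 0 i : 'rV_n) (chart_fn Vd Va))).
- move=> V a b Vd Va ab p Vp.
  apply: (c_dext cal _ (chart_open (fn_open Va) Vd)); last by exists p.
  by move=> _ [q Vq <-]; rewrite (ch_mapK (Vd _ Vq)) ab.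
- by [].
- move=> V k a b Vd Va Vb p Vp.
  apply: (dm_deriv_lin k (delta_mx 0 i) (chart_open (fn_open Va) Vd)
    (chart_fn Vd Va) (chart_fn Vd Vb)).
  by exists p.
- move=> V a b Vd Va Vb p Vp.
  have := dm_deriv_mul (delta_mx 0 i) (chart_open (fn_open Va) Vd)
    (chart_fn Vd Va) (chart_fn Vd Vb) (ex_intro2 _ _ p Vp (erefl _)).
  by rewrite (ch_mapK (Vd _ Vp)).
Qed.

Lemma coord_field_crd V i j p : open V -> V `<=` ch_dom c -> V p ->
  coord_field c j V (crd i) p = (i == j)%:R.
Proof.
move=> oV Vd Vp; have Wp : (ch_map c @` V) (ch_map c p) by exists p.
rewrite /coord_field (c_dext cal (w := fun z : 'rV_n => c_emb cal (z 0 i)) _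
  (chart_open oV Vd) _ Wp); last first.
  by move=> _ [q Vq <-]; rewrite /crd (ch_mapK (Vd _ Vq)).
rewrite c_dcoord mxE eqxx /=; case: eqP => _; first exact: c_emb1.
by rewrite -[X in c_emb _ X](subrr 1) c_embB subrr.
Qed.

(** Hadamard's lemma brings [a] near [q] into the form required by
    [der_combination]; the same identity for the coordinate fields computes the
    coefficients [g i q]. *)
Lemma derivation_formula D xi W q a : derivation D xi -> W `<=` D ->
  W `<=` ch_dom c -> W q -> fn X W a ->
  xi W a q = \sum_i xi W (crd i) q * coord_field c i W a q.
Proof.
move=> xiD WD Wd Wq Wa; have oW := fn_open Wa.
have oI := chart_open oW Wd.
have : nbhs (ch_map c q) (ch_map c @` W) by apply: open_nbhs_nbhs; split=> //; exists q.
move=> /nbhs_ballP[rho /= rho0 Hrho].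
pose W' := W `&` [set p | ball (ch_map c q) rho (ch_map c p)].
have W'W : W' `<=` W by move=> p [].
have oW' : open W'.
  rewrite openE => p [Wp Bp]; apply: filterI; first exact: open_nbhs_nbhs.
  apply: (ch_cont (Wd _ Wp)); apply: open_nbhs_nbhs; split=> //.
  exact: ball_open.
have W'q : W' q by split=> //; exact: ballxx.
have W'd : W' `<=` ch_dom c by exact: subset_trans W'W Wd.
have imW' : ch_map c @` W' `<=` ball (ch_map c q) rho by move=> _ [p [_ Bp] <-].
have Du : dm_fun dm (ball (ch_map c q) rho) (fun z => a (ch_inv c z)).
  exact: (c_sub cal Hrho (chart_fn Wd Wa)).
have [g gs E] := c_hadamard cal Du.
have W'g i : fn X W' (fun p => g i (ch_map c p)).
  by apply: (chart_fnI oW' W'd (c_sub cal imW' (gs i))).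
have W'a := fn_res oW' W'W Wa.
have W'x i := fn_crd i oW' W'd.
have Ea : eq_on W' a (fun p => a q + \sum_i (crd i p - crd i q) * g i (ch_map c p)).
  move=> p W'p; have := E (ch_map c p).
  rewrite (ch_mapK (W'd _ W'p)) (ch_mapK (W'd _ W'q)) => ->.
  by congr (_ + _); apply: eq_bigr => i _; rewrite c_embB.
have W'D := subset_trans W'W WD.
have key D' xi' : derivation D' xi' -> W `<=` D' ->
    xi' W a q = \sum_i xi' W (crd i) q * g i (ch_map c q).
  move=> dD' WD'; rewrite -(der_res dD' WD' oW' W'W Wa W'q).
  rewrite (der_combination dD' (subset_trans W'W WD') oW' W'q W'a W'x W'g Ea).
  apply: eq_bigr => i _; congr (_ * _).
  by apply: (der_res dD' WD' oW' W'W _ W'q); exact: fn_crd.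
rewrite (key _ _ xiD WD); apply: eq_bigr => i _; congr (_ * _).
rewrite (key _ _ (coord_field_derivation i) Wd).
rewrite (bigD1 i) //= coord_field_crd // eqxx mul1r big1 ?addr0 // => j ji.
by rewrite coord_field_crd // (negbTE ji) mul0r.
Qed.

End Chart.
End Charts.

(** * Curves, and functions on a product *)

Section Curves.
Context {R : realType}.
Implicit Types (X Y : space R).

(** Differentiability at the time 0 suffices, and it is tested on sections,
    which makes sense on an algebraic variety as well; there the first clause is
    about Zariski open sets. *)
Definition smooth_curve X (s : R -> X) : Prop :=
  (forall V, open V -> V (s 0) -> \forall t \near 0, V (s t)) /\
  (forall V u, fn X V u -> V (s 0) -> exists l, cder (fun t => u (s t)) l).

Definition cdv (F : R -> R[i]) : R[i] := xget 0 [set l | cder F l].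

Lemma cdvE F l : cder F l -> cdv F = l.
Proof.
by move=> Fl; rewrite /cdv; case: xgetP => [x -> Fx|/(_ l)//]; exact: cder_uniq Fx Fl.
Qed.

Lemma cdvP F : (exists l, cder F l) -> cder F (cdv F).
Proof. by move=> [l Fl]; rewrite (cdvE Fl). Qed.

Lemma smooth_curve_cdv X (s : R -> X) V u : smooth_curve s -> fn X V u ->
  V (s 0) -> cder (fun t => u (s t)) (cdv (fun t => u (s t))).
Proof. by move=> [_ H] Vu V0; apply: cdvP; exact: H Vu V0. Qed.

End Curves.

Section Products.
Context {R : realType} {dm : diff_model R} (cal : calculus dm).
Local Notation K := (dm_field dm).
Implicit Types (X Y : space R).

Lemma curve_velocity X n (c : chart dm X n) (s : R -> X) : smooth_curve s ->
  ch_dom c (s 0) ->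
  exists h', velocity (c_inj cal) (fun t => ch_map c (s t)) h'.
Proof.
move=> [_ sm] d0; apply: c_velocity => i.
exact: (sm _ _ (fn_crd cal i (ch_open c) (@subset_refl _ (ch_dom c))) d0).
Qed.

Lemma segment_curve X n (c : chart dm X n) (z v : 'rV[K]_n) :
  (ch_map c @` ch_dom c) z ->
  smooth_curve (fun t => ch_inv c (z + c_inj cal t *: v)).
Proof.
move=> [p dp <-].
have cl : {for 0, continuous (fun t : R => ch_map c p + c_inj cal t *: v)}.
  exact: (velocity_cont (@c_inj_cont _ _ cal)
    (@velocity_affine R K (c_inj cal) _ (ch_map c p) v)).
split=> [V oV|V u Vu]; rewrite line0 (ch_mapK dp) => Vp.
  have H : nbhs (ch_map c p + c_inj cal 0 *: v) [set z | V (ch_inv c z)].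
    by rewrite line0; apply: (ch_inv_cont dp); rewrite (ch_mapK dp);
      exact: open_nbhs_nbhs.
  exact: (cl _ H).
pose W := V `&` ch_dom c.
have oW : open W by apply: openI; [exact: fn_open Vu|exact: ch_open].
have Wu : fn X W u by apply: fn_res Vu => // q [].
have Wd : W `<=` ch_dom c by move=> q [].
eexists; apply: (dm_line cal v (chart_fn Wd Wu)).
by exists p.
Qed.

Section Product.
Context {X Y : space R} {D : set (X * Y)} {F : X -> Y -> R[i]}.
Hypothesis FD : fn_prod dm D F.

Lemma open_slice1 y : open [set x | D (x, y)].
Proof.
rewrite openE => x Dxy; have : nbhs (x, y) D by apply: open_nbhs_nbhs; case: FD.
move=> [[A B] [/= Ax By] AB]; apply: filterS Ax => x' Ax'.
by apply: AB; split=> //; exact: nbhs_singleton.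
Qed.

Lemma open_slice2 x : open [set y | D (x, y)].
Proof.
rewrite openE => y Dxy; have : nbhs (x, y) D by apply: open_nbhs_nbhs; case: FD.
move=> [[A B] [/= Ax By] AB]; apply: filterS By => y' By'.
by apply: AB; split=> //; exact: nbhs_singleton.
Qed.

Definition prod_dom m n (c : chart dm X m) (d : chart dm Y n) :
    set ('rV[K]_m * 'rV[K]_n) :=
  [set z | [/\ (ch_map c @` ch_dom c) z.1, (ch_map d @` ch_dom d) z.2 &
               D (ch_inv c z.1, ch_inv d z.2)]].

Definition prod_fun m n (c : chart dm X m) (d : chart dm Y n) :
    'rV[K]_m * 'rV[K]_n -> R[i] := fun z => F (ch_inv c z.1) (ch_inv d z.2).

Lemma prod_dom_open m n (c : chart dm X m) (d : chart dm Y n) :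
  open (prod_dom c d).
Proof.
rewrite openE => -[z1 z2] [/= [x dx xz] [y dy yz]].
rewrite -xz -yz (ch_mapK dx) (ch_mapK dy) => Dxy.
have : nbhs (x, y) D by apply: open_nbhs_nbhs; case: FD.
move=> [[A B] [/= Ax By] AB].
have nx : nbhs (ch_map c x) ((ch_map c @` ch_dom c) `&` [set z | A (ch_inv c z)]).
  apply: filterI.
    by apply: open_nbhs_nbhs; split; [exact: ch_open_im|exists x].
  by apply: (ch_inv_cont dx); rewrite (ch_mapK dx).
have ny : nbhs (ch_map d y) ((ch_map d @` ch_dom d) `&` [set z | B (ch_inv d z)]).
  apply: filterI.
    by apply: open_nbhs_nbhs; split; [exact: ch_open_im|exists y].
  by apply: (ch_inv_cont dy); rewrite (ch_mapK dy).
exists (((ch_map c @` ch_dom c) `&` [set z | A (ch_inv c z)]),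
        ((ch_map d @` ch_dom d) `&` [set z | B (ch_inv d z)])) => //=.
by move=> [w1 w2] [/= [h1 h2] [h3 h4]]; split=> //; exact: AB.
Qed.

Lemma prod_dom_in m n (c : chart dm X m) (d : chart dm Y n) x y :
  ch_dom c x -> ch_dom d y -> D (x, y) -> prod_dom c d (ch_map c x, ch_map d y).
Proof.
move=> dx dy Dxy; split; [by exists x|by exists y|].
by rewrite /= (ch_mapK dx) (ch_mapK dy).
Qed.

Lemma prod_funE m n (c : chart dm X m) (d : chart dm Y n) x y :
  ch_dom c x -> ch_dom d y -> prod_fun c d (ch_map c x, ch_map d y) = F x y.
Proof. by move=> dx dy; rewrite /prod_fun /= (ch_mapK dx) (ch_mapK dy). Qed.

Lemma fn_prodP x y : D (x, y) -> exists m n (c : chart dm X m) (d : chart dm Y n),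
  [/\ ch_dom c x, ch_dom d y & dm_fun dm (prod_dom c d) (prod_fun c d)].
Proof. by case: FD => _; exact. Qed.

Lemma fn_slice2 x : fn Y [set y | D (x, y)] (F x).
Proof.
apply: fn_glue; first exact: open_slice2.
move=> y Dxy; have [m [n [c [d [dx dy Fs]]]]] := fn_prodP Dxy.
exists (ch_dom d `&` [set y | D (x, y)]); split => [//|? []//|].
have oW : open (ch_dom d `&` [set y | D (x, y)]).
  by apply: openI; [exact: ch_open|exact: open_slice2].
have S := c_slice2 cal (ch_map c x) Fs.
apply: (chart_fnI cal (c := d) (u := fun w => prod_fun c d (ch_map c x, w)) oW).
- by move=> ? [].
- apply: (c_sub cal _ S) => _ [y' [dy' Dxy'] <-]; exact: prod_dom_in.
- by move=> y' [dy' Dxy']; rewrite prod_funE.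
Qed.

Lemma fn_slice1 y : fn X [set x | D (x, y)] (F^~ y).
Proof.
apply: fn_glue; first exact: open_slice1.
move=> x Dxy; have [m [n [c [d [dx dy Fs]]]]] := fn_prodP Dxy.
exists (ch_dom c `&` [set x | D (x, y)]); split => [//|? []//|].
have oW : open (ch_dom c `&` [set x | D (x, y)]).
  by apply: openI; [exact: ch_open|exact: open_slice1].
have S := c_slice1 cal (ch_map d y) Fs.
apply: (chart_fnI cal (c := c) (u := fun w => prod_fun c d (w, ch_map d y)) oW).
- by move=> ? [].
- apply: (c_sub cal _ S) => _ [x' [dx' Dxy'] <-]; exact: prod_dom_in.
- by move=> x' [dx' Dxy']; rewrite prod_funE.
Qed.

Lemma cder_prod m n (c : chart dm X m) (d : chart dm Y n)
    (s : R -> X) (t : R -> Y) h k :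
  dm_fun dm (prod_dom c d) (prod_fun c d) ->
  smooth_curve s -> smooth_curve t ->
  ch_dom c (s 0) -> ch_dom d (t 0) -> D (s 0, t 0) ->
  velocity (c_inj cal) (fun e => ch_map c (s e)) h ->
  velocity (c_inj cal) (fun e => ch_map d (t e)) k ->
  cder (fun e => F (s e) (t e))
    (dm_deriv dm (h, k) (prod_fun c d) (ch_map c (s 0), ch_map d (t 0))).
Proof.
move=> Fs [s1 _] [t1 _] ds dt Dst vs vt.
have V := velocity_pair vs vt.
apply: (cder_near _ (@c_chain _ _ cal _ _ _ _ _ Fs (prod_dom_in ds dt Dst) V)).
near=> e; rewrite prod_funE //; near: e.
  exact: s1 (ch_open c) ds.
exact: t1 (ch_open d) dt.
Unshelve. all: by end_near. Qed.

Lemma cst_curve (Z : space R) (z : Z) : smooth_curve (fun=> z).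
Proof.
split=> [V oV Vz|V u Vu Vz]; first by near=> t.
by exists 0; exact: cder_cst.
Unshelve. all: by end_near. Qed.

(** Differentiate along both variables at once, using the additivity of
    the derivative in its direction. *)
Lemma cder_diagonal (s : R -> X) (t : R -> Y) : smooth_curve s -> smooth_curve t ->
  D (s 0, t 0) -> exists l1 l2,
  [/\ cder (fun e => F (s e) (t 0)) l1, cder (fun e => F (s 0) (t e)) l2 &
      cder (fun e => F (s e) (t e)) (l1 + l2)].
Proof.
move=> ss st Dst; have [m [n [c [d [dx dy Fs]]]]] := fn_prodP Dst.
have [h vs] := curve_velocity ss dx; have [k vt] := curve_velocity st dy.
have v0 : velocity (c_inj cal) (fun=> ch_map c (s 0)) 0 by exact: velocity_cst.
have w0 : velocity (c_inj cal) (fun=> ch_map d (t 0)) 0 by exact: velocity_cst.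
pose z := (ch_map c (s 0), ch_map d (t 0)).
exists (dm_deriv dm (h, 0) (prod_fun c d) z).
exists (dm_deriv dm (0, k) (prod_fun c d) z); split.
- exact: (cder_prod Fs ss (cst_curve (t 0)) dx dy Dst vs w0).
- exact: (cder_prod Fs (cst_curve (s 0)) st dx dy Dst v0 vt).
- rewrite -(c_dadd cal _ _ Fs (prod_dom_in dx dy Dst)).
  have -> : ((h, 0) + (0, k) : 'rV_m * 'rV_n) = (h, k).
    by apply: injective_projections => /=; rewrite ?addr0 ?add0r.
  exact: (cder_prod Fs ss st dx dy Dst vs vt).
Qed.

(** This is what makes [curve_field] an operator on the sheaf. *)
Lemma fn_partial2 (t : R -> Y) : smooth_curve t ->
  fn X [set x | D (x, t 0)] (fun x => cdv (fun e => F x (t e))) /\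
  forall x, D (x, t 0) -> exists l, cder (fun e => F x (t e)) l.
Proof.
move=> st.
have key x : D (x, t 0) -> exists W, [/\ W x, open W, W `<=` [set x | D (x, t 0)] &
    exists2 u, fn X W u & forall x', W x' -> cder (fun e => F x' (t e)) (u x')].
  move=> Dx; have [m [n [c [d [dx dy Fs]]]]] := fn_prodP Dx.
  have [k vt] := curve_velocity st dy.
  have oW : open (ch_dom c `&` [set x | D (x, t 0)]).
    by apply: openI; [exact: ch_open|exact: open_slice1].
  exists (ch_dom c `&` [set x | D (x, t 0)]); split => [//|//|? []//|].
  exists (fun x => dm_deriv dm (0, k) (prod_fun c d) (ch_map c x, ch_map d (t 0))).
    have S := c_slice1 cal (ch_map d (t 0)) (c_deriv cal (0, k) Fs).
    apply: (chart_fnI cal (c := c) (u := fun w => dm_deriv dm (0, k) (prod_fun c d)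
      (w, ch_map d (t 0))) oW).
    - by move=> ? [].
    - apply: (c_sub cal _ S) => _ [x' [dx' Dxy'] <-]; exact: prod_dom_in.
    - by [].
  move=> x' [dx' Dx'].
  have v0 : velocity (c_inj cal) (fun=> ch_map c x') 0 by exact: velocity_cst.
  exact: (cder_prod Fs (cst_curve x') st dx' dy Dx' v0 vt).
split=> [|x Dx].
  apply: fn_glue; first exact: open_slice1.
  move=> x /key[W [Wx oW WD [u Wu Hu]]]; exists W; split=> //.
  by apply: fn_eq Wu _ => x' Wx'; rewrite (cdvE (Hu _ Wx')).
by have [W [Wx _ _ [u _ Hu]]] := key x Dx; exists (u x); exact: Hu.
Qed.

End Product.
End Products.

(** * Curves in a Lie group *)

Section GroupLaw.
Context {T : Type} (gl : group_law T).
Implicit Types x y z : T.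

Lemma gmulr_inv x : gmul gl x (ginv gl x) = gone gl.
Proof.
rewrite -{1}(gmul1 gl x) -{1}(gmulV gl (ginv gl x)) -!gmulA.
by rewrite [gmul gl (ginv gl x) (gmul gl x _)]gmulA gmulV gmul1 gmulV.
Qed.

Lemma gmulr1 x : gmul gl x (gone gl) = x.
Proof. by rewrite -(gmulV gl x) gmulA gmulr_inv gmul1. Qed.

Lemma gmulK x y : gmul gl (ginv gl x) (gmul gl x y) = y.
Proof. by rewrite gmulA gmulV gmul1. Qed.

Lemma gmulVK x y : gmul gl x (gmul gl (ginv gl x) y) = y.
Proof. by rewrite gmulA gmulr_inv gmul1. Qed.

Lemma ginvK x : ginv gl (ginv gl x) = x.
Proof. by rewrite -[RHS](gmulK (ginv gl x)) gmulV gmulr1. Qed.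

Lemma ginv1 : ginv gl (gone gl) = gone gl.
Proof. by rewrite -[LHS]gmulr1 gmulV. Qed.

Lemma ginvM x y : ginv gl (gmul gl x y) = gmul gl (ginv gl y) (ginv gl x).
Proof.
rewrite -[RHS](gmulK (gmul gl x y)) -[gmul gl (gmul gl x y) _]gmulA gmulVK.
by rewrite gmulr_inv gmulr1.
Qed.
End GroupLaw.

Section LieGroup.
Context {R : realType} {dm : diff_model R} (cal : calculus dm) (G : lie_group dm).
Local Notation gl := (lg_law G).
Local Notation "x ** y" := (gmul gl x y) (at level 40, left associativity).
Local Notation "x ^-" := (ginv gl x) (at level 3, format "x ^-").
Local Notation e1 := (gone gl).

Lemma fn_inv V u : fn G V u -> fn G [set y | V (ginv gl y)] (fun y => u (ginv gl y)).
Proof.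
move=> Vu; have := fn_slice2 cal (lg_div Vu) e1.
have -> : [set y | [set z : G * G | V (gmul gl z.1 (ginv gl z.2))] (e1, y)]
   = [set y | V (ginv gl y)].
  by apply: boolp.funext => y /=; rewrite gmul1.
by move=> H; apply: fn_eq H _ => y _; rewrite gmul1.
Qed.

Lemma fn_ltrans V u k : fn G V u -> fn G [set y | V (gmul gl k y)] (fun y => u (gmul gl k y)).
Proof.
move=> Vu; have := fn_inv (fn_slice2 cal (lg_div Vu) k).
have -> : [set y | [set y | [set z : G * G | V (gmul gl z.1 (ginv gl z.2))] (k, y)] (ginv gl y)]
   = [set y | V (gmul gl k y)].
  by apply: boolp.funext => y /=; rewrite ginvK.
by move=> H; apply: fn_eq H _ => y _; rewrite ginvK.
Qed.

Lemma curve_pullback (X Y : space R) (f : X -> Y) (s : R -> X) :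
  (forall V u, fn Y V u -> fn X [set x | V (f x)] (fun x => u (f x))) ->
  smooth_curve s -> smooth_curve (fun t => f (s t)).
Proof.
move=> H [s1 s2]; split=> [V oV V0|V u Vu V0].
  by apply: (s1 [set x | V (f x)]) => //; exact: fn_open (H _ _ (fn_cst 0 oV)).
exact: s2 (H _ _ Vu) V0.
Qed.

Lemma curve_inv s : smooth_curve s -> smooth_curve (fun t => ginv gl (s t) : G).
Proof. by apply: curve_pullback; exact: fn_inv. Qed.

Lemma curve_ltrans k s : smooth_curve s -> smooth_curve (fun t => gmul gl k (s t) : G).
Proof. by apply: curve_pullback => V u; exact: fn_ltrans. Qed.

Section Velocity.
Context {s : R -> G} (ss : smooth_curve s) (s0 : s 0 = e1).

(** The derivation induced by right translations along a curve through the
    unit.  It is left-invariant because left and right translations commute. *)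
Definition curve_field : op G := fun V u y =>
  cdv (fun t => u (gmul gl y (ginv gl (s t)))).

Lemma curve_field_partial V u : fn G V u -> fn G V (curve_field V u) /\
  forall y, V y -> cder (fun t => u (gmul gl y (ginv gl (s t)))) (curve_field V u y).
Proof.
move=> Vu; have := fn_partial2 cal (lg_div Vu) ss.
rewrite s0 -/(curve_field V u).
have -> : [set x | [set z : G * G | V (gmul gl z.1 (ginv gl z.2))] (x, e1)] = V.
  by apply: boolp.funext => y /=; rewrite ginv1 gmulr1.
move=> [H1 H2]; split => // y Vy; apply: cdvP; apply: H2.
by rewrite /= ginv1 gmulr1.
Qed.

Lemma curve_field_derivation : derivation setT curve_field.
Proof.
have near_y V u y : fn G V u -> V y ->
    \forall t \near 0, V (gmul gl y (ginv gl (s t))).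
  move=> Vu Vy; have [H _] := curve_ltrans y (curve_inv ss).
  by apply: (H V (fn_open Vu)); rewrite s0 ginv1 gmulr1.
split.
- by move=> V a _ Va; have [] := curve_field_partial Va.
- move=> V a b _ Va ab y Vy; have [_ H] := curve_field_partial Va.
  apply/esym/cdvE; apply: cder_near (H y Vy).
  have := near_y _ _ _ Va Vy; apply: filterS => t Vt; exact: ab.
- by [].
- move=> V c a b _ Va Vb y Vy.
  have [_ Ha] := curve_field_partial Va; have [_ Hb] := curve_field_partial Vb.
  by apply: cdvE; exact: (cderD (cderZ c (Ha y Vy)) (Hb y Vy)).
- move=> V a b _ Va Vb y Vy.
  have [_ Ha] := curve_field_partial Va; have [_ Hb] := curve_field_partial Vb.
  apply: cdvE; have := cderM (Ha y Vy) (Hb y Vy).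
  by rewrite s0 ginv1 gmulr1.
Qed.

Lemma curve_field_left_invariant : left_invariant curve_field.
Proof.
move=> k V u Vu y Vy; rewrite /curve_field /tr_fun; congr cdv.
by apply: boolp.funext => t; rewrite -gmulA gmulK.
Qed.

(** The Lie algebra contains all left-invariant derivations. *)
Lemma curve_field_element (g : lie_algebra_of G) : exists x : g,
  forall V u y, fn G V u -> V y ->
    cder (fun t => u (gmul gl y (ginv gl (s t)))) (la_field x V u y).
Proof.
have [x Hx] := @la_field_surj _ _ _ g _ curve_field_derivation curve_field_left_invariant.
exists x => V u y Vu Vy; have [_ H] := curve_field_partial Vu.
by rewrite -(Hx V u Vu y Vy); exact: H.
Qed.

(** Differentiate the constant curve [s t * (s t)^-1] by the rule for the
    diagonal. *)
Lemma cder_inv_curve V u : fn G V u -> V e1 -> exists l,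
  cder (fun t => u (s t)) l /\ cder (fun t => u (ginv gl (s t))) (- l).
Proof.
move=> Vu V1.
have D0 : [set z : G * G | V (gmul gl z.1 (ginv gl z.2))] (s 0, s 0).
  by rewrite /= gmulr_inv.
have [l1 [l2 [h1 h2 h3]]] := cder_diagonal cal (lg_div Vu) ss ss D0.
have E : l1 + l2 = 0.
  apply: cder_uniq h3 _; apply: cder_ext (cder_cst (u e1)) => // t.
  by rewrite gmulr_inv.
have -> : (fun t => u (s t)) = (fun t => u (gmul gl (s t) (ginv gl (s 0)))).
  by apply: boolp.funext => t; rewrite s0 ginv1 gmulr1.
exists l1; split => //.
have -> : - l1 = l2 by apply/eqP; rewrite eq_sym -addr_eq0 addrC E.
by apply: cder_ext h2 => // t; rewrite s0 gmul1.
Qed.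

End Velocity.

(** A point close to [y0] is joined to it by a segment in a chart, along
    which the derivative of [f] vanishes by hypothesis.  So [f] is locally
    constant, and [G] is connected. *)
Lemma constant_on_group (f : G -> R[i]) : connected [set: G] ->
  (forall (y : G) (s : R -> G), smooth_curve s -> s 0 = e1 ->
     cder (fun t => f (gmul gl y (s t))) 0) ->
  forall y, f y = f e1.
Proof.
move=> Gconn H.
have loc y0 : \forall y \near y0, f y = f y0.
  have [_ _ /(_ y0)[n [c dy0]]] := lg_manifold G.
  have [z0 Hz0] : exists z0, z0 = ch_map c y0 by exists (ch_map c y0).
  have : nbhs z0 (ch_map c @` ch_dom c).
    by rewrite Hz0; apply: open_nbhs_nbhs; split; [exact: ch_open_im|exists y0].
  move=> /nbhs_ballP[rho /= rho0 Hr].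
  have near1 : \forall y \near y0, ch_dom c y.
    by apply: open_nbhs_nbhs; split; [exact: ch_open|].
  have near2 : \forall y \near y0, ball z0 rho (ch_map c y).
    apply: (ch_cont dy0); rewrite Hz0.
    exact: nbhsx_ballx.
  near=> y.
  have dy : ch_dom c y by near: y.
  have By : ball z0 rho (ch_map c y) by near: y.
  pose v := ch_map c y - z0.
  pose s t := ch_inv c (z0 + c_inj cal t *: v).
  have inim t : 0 <= t <= 1 -> (ch_map c @` ch_dom c) (z0 + c_inj cal t *: v).
    move=> t01; apply: Hr; move: By; rewrite -!ball_normE /= => By.
    rewrite opprD addNKr normrN normrZ; apply: le_lt_trans By.
    rewrite -[leRHS]mul1r -/v distrC -/v; apply: ler_wpM2r => //.
    exact: c_inj_le1.
  have s1 : s 1 = y.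
    by rewrite /s rmorph1 scale1r /v addrC subrK (ch_mapK dy).
  have s0 : s 0 = y0 by rewrite /s line0 Hz0 (ch_mapK dy0).
  have Hd t : 0 <= t <= 1 -> cder (fun e => f (s (t + e))) 0.
    move=> t01.
    have sc : smooth_curve (fun e => s (t + e)).
      have -> : (fun e => s (t + e)) =
        (fun e => ch_inv c ((z0 + c_inj cal t *: v) + c_inj cal e *: v)).
        by apply: boolp.funext => e; rewrite /s rmorphD scalerDl addrA.
      exact: segment_curve (inim t t01).
    have := H (s t) _ (curve_ltrans (ginv gl (s t)) sc).
    rewrite addr0 gmulV => /(_ erefl); apply: cder_ext => // e.
    by rewrite gmulVK.
  have X : `|f (s 1) - f (s 0)| <= (0 *+ 2)%:C%C.
    by apply: (@cder_mvi R (fun t => f (s t)) (fun=> 0) 0 Hd) => t _; rewrite normr0.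
  by move: X; rewrite mul0rn normr_le0 subr_eq0 s1 s0 => /eqP.
have clopen (P : R[i] -> Prop) : open [set y | P (f y)].
  rewrite openE => y /= Py; have := loc y; apply: filterS => y' /= ->; exact: Py.
(* Being locally constant, [f] has open level sets with open complements. *)
have AT : [set y | f y = f e1] = [set: G].
  apply: (Gconn [set y | f y = f e1]).
  - by exists e1.
  - exists [set y | f y = f e1]; last by rewrite setTI.
    exact: (clopen (fun z => z = f e1)).
  - exists [set y | f y = f e1]; last by rewrite setTI.
    rewrite -[X in closed X]setCK; apply: open_closedC.
    exact: (clopen (fun z => ~ (z = f e1))).
by move=> y; have : [set: G] y by []; rewrite -AT.
Unshelve. all: by end_near. Qed.

End LieGroup.

(** * First-order expansion of translated functions: actions in charts *)

(** Closure of the sheaf under inversion is not part of the notion of a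
    space; both manifolds and varieties have it. *)
Definition fn_invertible (R : realType) (X : space R) : Prop :=
  forall V u x, fn X V u -> V x -> u x != 0 ->
    exists W, [/\ W x, W `<=` V, fn X W (fun y => (u y)^-1) &
                  forall y, W y -> u y != 0].

Section Invertible.
Context {R : realType}.

Lemma manifold_invertible (dm : diff_model R) (cal : calculus dm) (X : space R) :
  manifold dm X -> fn_invertible X.
Proof.
move=> [_ _ H] V u x Vu Vx ux; have [n [c dx]] := H x.
pose U := V `&` ch_dom c.
have oU : open U by apply: openI; [exact: fn_open Vu|exact: ch_open].
have Ud : U `<=` ch_dom c by move=> ? [].
have Uu : fn X U u by apply: fn_res Vu => // ? [].
pose W := U `&` [set y | u y != 0].
have oW : open W.
  rewrite openE => y [Uy uy]; apply: filterI; first exact: open_nbhs_nbhs.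
  have Iy : (ch_map c @` U) (ch_map c y) by exists y.
  have cu := c_cont cal (chart_fn Ud Uu) Iy.
  have n1 : \forall z \near ch_map c y, u (ch_inv c z) != 0.
    have E : u (ch_inv c (ch_map c y)) != 0 by rewrite (ch_mapK (Ud _ Uy)).
    exact: (@cvgr_neq0 _ R[i]^o _ _ _ _ _ cu E).
  have n2 : \forall y' \near y, u (ch_inv c (ch_map c y')) != 0.
    exact: (ch_cont (Ud _ Uy) n1).
  have n3 : \forall y' \near y, U y' by exact: open_nbhs_nbhs.
  near=> y' => /=; have Uy' : U y' by near: y'.
  rewrite -(ch_mapK (Ud _ Uy')); by near: y'.
exists W; split=> [//|y [[Vy _] _] //||y [_ uy] //].
have Wd : W `<=` ch_dom c by move=> ? [/Ud].
have WU : W `<=` U by move=> ? [].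
have Wu := fn_res oW WU Uu.
apply: (chart_fnI cal oW Wd (u := fun z => (u (ch_inv c z))^-1)).
  apply: (c_inv cal (chart_open oW Wd)) (chart_fn Wd Wu) => _ [y Wy <-].
  by rewrite (ch_mapK (Wd _ Wy)); case: Wy.
by move=> y Wy; rewrite (ch_mapK (Wd _ Wy)).
Unshelve. all: by end_near. Qed.

Lemma variety_invertible (X : space R) : smooth_variety X -> fn_invertible X.
Proof.
move=> [_ _ H] V u x Vu Vx ux; have [n [c dx]] := H x.
pose U := V `&` ac_dom c.
have oU : open U by apply: openI; [exact: fn_open Vu|exact: ac_open].
have Ud : U `<=` ac_dom c by move=> ? [].
have Uu : fn X U u by apply: fn_res Vu => // ? [].
have [+ _] := ac_fn u oU Ud; move=> /(_ Uu x (conj Vx dx)) [F [P [Fp Pp Px E]]].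
pose W := U `&` [set y | P (ac_map c y) != 0 /\ F (ac_map c y) != 0].
have Wd : W `<=` ac_dom c by move=> ? [/Ud].
have oW : open W.
  apply/(ac_zariski Wd) => y [Uy [Py Fy]].
  have [+ _] := ac_zariski Ud; move=> /(_ oU y Uy)[Q [Qp Qy HQ]].
  exists (fun z => Q z * (P z * F z)); split.
  - by apply: polyfun_mul => //; exact: polyfun_mul.
  - by rewrite !mulf_neq0.
  - move=> y' dy'; rewrite !mulf_eq0 !negb_or => /and3P[Qy' Py' Fy'].
    by split => //; exact: HQ.
have Wx : W x.
  split=> //; split=> //; move: ux; rewrite (E x) //.
  by apply: contraNneq => ->; rewrite mul0r.
have WU : W `<=` U by move=> ? [].
have Wu0 y : W y -> u y != 0.
  move=> [Uy [Py Fy]]; rewrite (E y Uy Py) mulf_neq0 //.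
  by rewrite invr_neq0.
exists W; split=> // [y [[Vy _] _] //|].
have [_] := ac_fn (fun y => (u y)^-1) oW Wd; apply=> y [Uy [Py Fy]].
exists P, F; split=> // y' [Uy' [Py' Fy']] _.
by rewrite (E y' Uy' Py') invf_div.
Qed.

End Invertible.

Section Action.
Context {R : realType} {dm : diff_model R} (cal : calculus dm).
Context (G : lie_group dm) (M : space R) (act : G -> M -> M).
Local Notation gl := (lg_law G).
Local Notation e1 := (gone gl).

(** The common consequences of the two notions of a regular action. *)
Record regular_action : Prop := RegularAction {
  ra_act1 : forall p, act e1 p = p;
  ra_actM : forall x y p, act (gmul gl x y) p = act x (act y p);
  ra_translate : forall V a y, fn M V a ->
    fn M [set p | V (act y p)] (fun p => a (act y p));
  ra_orbit : forall V a p, fn M V a ->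
    fn G [set y | V (act y p)] (fun y => a (act y p)) }.

Section Regular.
Context (ra : regular_action).

Lemma actKV y p : act y (act (ginv gl y) p) = p.
Proof. by rewrite -(ra_actM ra) gmulr_inv (ra_act1 ra). Qed.

Context {s : R -> G} (ss : smooth_curve s) (s0 : s 0 = e1).

Definition velocity_field (v : op M) : Prop :=
  derivation setT v /\ forall V a p, fn M V a -> V p ->
    cder (fun t => a (act (s t) p)) (v V a p).

Lemma act_inv_curve q : smooth_curve (fun t => act (ginv gl (s t)) q).
Proof.
apply: (curve_pullback (f := act^~ q) (s := fun t => ginv gl (s t) : G)).
  by move=> V u Vu; exact: ra_orbit.
exact: curve_inv.
Qed.

Lemma act_inv_curve_near V q : open V -> V q ->
  \forall t \near 0, V (act (ginv gl (s t)) q).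
Proof.
move=> oV Vq; have [H _] := act_inv_curve q.
by apply: H => //; rewrite s0 ginv1 (ra_act1 ra).
Qed.

Lemma velocity_field_inv v V a q : velocity_field v -> fn M V a -> V q ->
  cder (fun t => a (act (ginv gl (s t)) q)) (- v V a q).
Proof.
move=> [_ Hv] Va Vq; have V1 : [set y | V (act y q)] e1 by rewrite /= (ra_act1 ra).
have [l [h1 h2]] := cder_inv_curve cal ss s0 (ra_orbit ra q Va) V1.
by rewrite -(cder_uniq h1 (Hv V a q Va Vq)).
Qed.

(** As far as derivations can see, the translate of [a] by [s t], at the
    moving point [(s t)^-1 q], is a combination of fixed functions [gs i] with
    differentiable coefficients.  Transporting back by [s t] gives
    [xi a q = sum_i al i t * xi (gs i o (s t)^-1) q]; the last clause is the
    derivative of this identity at [t = 0]. *)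
Definition expansion (v : op M) : Prop := forall V a q, fn M V a -> V q ->
  exists (W : set M) (n : nat) (gs : 'I_n -> M -> R[i]) (al : 'I_n -> R -> R[i])
         (al' : 'I_n -> R[i]),
  [/\ open W, W q, forall i, fn M W (gs i) & forall i, cder (al i) (al' i)] /\
  (\forall t \near 0, forall W' xi, open W' -> W' `<=` W ->
     W' (act (ginv gl (s t)) q) -> fn M W' (fun p => a (act (s t) p)) ->
     derivation W' xi ->
     xi W' (fun p => a (act (s t) p)) (act (ginv gl (s t)) q) =
       \sum_i al i t * xi W' (gs i) (act (ginv gl (s t)) q)) /\
  (forall W' xi, open W' -> W' `<=` W -> W' q -> derivation W' xi ->
     \sum_i al' i * xi W' (gs i) q = \sum_i al i 0 * xi W' (v W' (gs i)) q).

Section Smooth.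
Hypothesis reg : forall V a, fn M V a ->
  fn_prod dm [set z : G * M | V (act z.1 z.2)] (fun x p => a (act x p)).

(** In a chart, the [gs i] are the coordinates and the [al i t] the partial
    derivatives of the translated function, by [derivation_formula].  The last
    clause rests on the symmetry of second derivatives. *)
Lemma smooth_expansion v : velocity_field v -> expansion v.
Proof.
move=> vf V a q Va Vq; have [vD vH] := vf; have FD := reg Va.
pose tau t := act (ginv gl (s t)) q.
have tau0 : tau 0 = q by rewrite /tau s0 ginv1 (ra_act1 ra).
have D1 : [set z : G * M | V (act z.1 z.2)] (e1, q) by rewrite /= (ra_act1 ra).
have [m [n [c [d [d1 dq Us]]]]] := fn_prodP FD D1.
set U := prod_fun c d in Us; set P := prod_dom c d in Us.
have oDD := @prod_dom_open _ _ _ _ _ _ FD m n c d.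
have ds : ch_dom c (s 0) by rewrite s0.
have dt : ch_dom d (tau 0) by rewrite tau0.
have [h vh] := curve_velocity cal ss ds.
have [kk vk] := curve_velocity cal (act_inv_curve q) dt.
pose W := V `&` ch_dom d.
have oW : open W by apply: openI; [exact: fn_open Va|exact: ch_open].
have Wd : W `<=` ch_dom d by move=> ? [].
have Wa : fn M W a by apply: fn_res Va => // ? [].
pose Ui (i : 'I_n) := dm_deriv dm (0, delta_mx 0 i : 'rV_n) U.
have Uis i : dm_fun dm P (Ui i) by exact: (c_deriv cal _ Us).
pose z0 := (ch_map c (s 0), ch_map d (tau 0)).
have Dz0 : P z0.
  by apply: prod_dom_in => //; rewrite /= s0 tau0.
pose al i t := Ui i (ch_map c (s t), ch_map d (tau t)).
exists W, n, (crd cal d), al, (fun i => dm_deriv dm (h, kk) (Ui i) z0).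
split.
  split=> //; first by move=> i; exact: fn_crd.
  by move=> i; exact: (@c_chain _ _ cal _ _ _ _ _ (Uis i) Dz0 (velocity_pair vh vk)).
have UE x i : ch_dom c x -> forall W' p,
    coord_field d i W' (fun p => a (act x p)) p = Ui i (ch_map c x, ch_map d p).
  move=> dx W' p; rewrite /coord_field /Ui -(c_dslice2 cal).
  congr dm_deriv; apply: boolp.funext => w.
  by rewrite /U /prod_fun /= (ch_mapK dx).
split.
  have [sn _] := ss; have := sn _ (ch_open c) ds; apply: filterS => t dst W' xi oW' W'W W't W'a xiD.
  rewrite (derivation_formula cal (c := d) xiD (@subset_refl _ _)
    (subset_trans W'W Wd) W't W'a).
  by apply: eq_bigr => i _; rewrite UE // mulrC.
move=> W' xi oW' W'W W'q xiD.
have W'd := subset_trans W'W Wd.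
have W'a := fn_res oW' W'W Wa.
have W'V : W' `<=` V by move=> p /W'W[].
have dD i := coord_field_derivation cal d i.
pose dl i : op M := coord_field d i.
have fda i : fn M W' (dl i W' a) by exact: (der_fn (dD i)).
have fva : fn M W' (v W' a) by exact: (der_fn vD).
have fvx i : fn M W' (v W' (crd cal d i)) by apply: (der_fn vD) => //; exact: fn_crd.
have al0 i : al i 0 = dl i W' a q.
  rewrite /al -(UE _ _ ds W') /dl s0 tau0; apply: (der_eq (dD i) W'd _ _ W'q).
    by apply: fn_eq W'a _ => p _; rewrite (ra_act1 ra).
  by move=> p _; rewrite (ra_act1 ra).
(* The derivative along [s] is exchanged with the coordinate field and gives
   [v]; the point moves backwards, whence the sign of the other term. *)
have al'E i : dm_deriv dm (h, kk) (Ui i) z0 = dl i W' (v W' a) q - v W' (dl i W' a) q.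
  have -> : (h, kk) = (h, 0) + (0, kk) :> 'rV_m * 'rV_n.
    by apply: injective_projections => /=; rewrite ?addr0 ?add0r.
  rewrite (c_dadd cal _ _ (Uis i) Dz0); congr (_ + _).
    rewrite (c_schwarz cal _ _ oDD Dz0 Us) /z0 -(c_dslice2 cal) tau0.
    apply: (c_dext cal _ (chart_open oW' W'd)); last by exists q.
    move=> _ [p W'p <-]; rewrite (ch_mapK (W'd _ W'p)).
    have Dp : [set z : G * M | V (act z.1 z.2)] (s 0, p).
      by rewrite /= s0 (ra_act1 ra); exact: W'V.
    apply: cder_uniq (vH _ _ _ W'a W'p).
    have w0 : velocity (c_inj cal) (fun=> ch_map d p) 0 by exact: velocity_cst.
    have X := cder_prod Us ss (cst_curve p) ds (W'd _ W'p) Dp vh w0.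
    exact: X.
  apply: cder_uniq (velocity_field_inv vf (fda i) W'q).
  have w0 : velocity (c_inj cal) (fun=> ch_map c (s 0)) 0 by exact: velocity_cst.
  have := @c_chain _ _ cal _ _ _ (fun t => (ch_map c (s 0), ch_map d (tau t))) _ (Uis i) Dz0
    (velocity_pair w0 vk).
  apply: cder_near; have := act_inv_curve_near oW' W'q; apply: filterS => t W't.
  rewrite -(UE _ _ ds W') /dl s0; apply: (der_eq (dD i) W'd _ _ W't).
    by apply: fn_eq W'a _ => p _; rewrite (ra_act1 ra).
  by move=> p _; rewrite (ra_act1 ra).
have form zeta b p : derivation W' zeta -> W' p -> fn M W' b ->
    zeta W' b p = \sum_i zeta W' (crd cal d i) p * dl i W' b p.
  move=> zD W'p W'b; exact: (derivation_formula cal zD (@subset_refl _ _) W'd W'p W'b).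
have vD' : derivation W' v by exact: (der_restrict vD (@subsetT _ _)).
have dlC i j : dl i W' (dl j W' a) q = dl j W' (dl i W' a) q.
  have oI := chart_open oW' W'd.
  have Iq : (ch_map d @` W') (ch_map d q) by exists q.
  have aux i' j' : dl i' W' (dl j' W' a) q =
     dm_deriv dm (delta_mx 0 i') (dm_deriv dm (delta_mx 0 j') (fun z => a (ch_inv d z)))
       (ch_map d q).
    apply: (c_dext cal _ oI) Iq => _ [p W'p <-].
    by rewrite /dl /coord_field (ch_mapK (W'd _ W'p)).
  by rewrite !aux; exact: (c_schwarz cal _ _ oI Iq (chart_fn W'd W'a)).
under eq_bigr => i _ do rewrite al'E mulrBl.
under [RHS]eq_bigr => i _ do rewrite al0.
rewrite sumrB.
have -> : \sum_i dl i W' (v W' a) q * xi W' (crd cal d i) q = xi W' (v W' a) q.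
  by rewrite (form _ _ _ xiD W'q fva); apply: eq_bigr => i _; rewrite mulrC.
have va_eq : eq_on W' (v W' a) (fun p => \sum_j v W' (crd cal d j) p * dl j W' a p).
  by move=> p W'p; exact: form.
have fvj j : fn M W' (fun p => v W' (crd cal d j) p * dl j W' a p) by exact: fn_mul.
rewrite (der_eq xiD (@subset_refl _ _) fva va_eq W'q).
rewrite (der_sum xiD _ (@subset_refl _ _) oW' fvj W'q).
rewrite (eq_bigr _ (fun j _ => der_mul xiD (@subset_refl _ _) (fvx j) (fda j) W'q)).
rewrite big_split /= -addrA -[RHS]addr0; congr (_ + _).
  by apply: eq_bigr => j _; rewrite mulrC.
apply/eqP; rewrite subr_eq0; apply/eqP.
under eq_bigr => j _ do rewrite (form _ _ _ xiD W'q (fda j)) mulr_sumr.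
under [RHS]eq_bigr => i _ do rewrite (form _ _ _ vD' W'q (fda i)) mulr_suml.
rewrite exchange_big; apply: eq_bigr => i _; apply: eq_bigr => j _ /=.
by rewrite dlC mulrAC mulrA.
Qed.

End Smooth.
End Regular.
End Action.

(** * First-order expansion: algebraic actions *)

Section ActionCases.
Context {R : realType} {dm : diff_model R} (cal : calculus dm).
Context {G : lie_group dm} {M : space R} {act : G -> M -> M}.
Local Notation gl := (lg_law G).
Local Notation e1 := (gone gl).
Hypothesis act1 : forall p, act e1 p = p.
Hypothesis actM : forall x y p, act (gmul gl x y) p = act x (act y p).

Lemma smooth_regular_action :
  (forall V a, fn M V a ->
    fn_prod dm [set z : G * M | V (act z.1 z.2)] (fun x p => a (act x p))) ->
  regular_action act.
Proof.
move=> reg; split=> // V a y Va.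
  exact: (fn_slice2 cal (reg _ _ Va) y).
exact: (fn_slice1 cal (reg _ _ Va) y).
Qed.

Section Algebraic.
Hypotheses (alg : algebraic_action act) (G_inv : fn_invertible G)
  (M_inv : fn_invertible M).

(** The elements of C[G] (x) A(W) whose quotients describe the action. *)
Definition pairing n (u : 'I_n -> G -> R[i]) (b : 'I_n -> M -> R[i]) y p :=
  \sum_i u i y * b i p.

Lemma fn_pairing_M n (u : 'I_n -> G -> R[i]) b W y : open W ->
  (forall i, fn M W (b i)) -> fn M W (pairing u b y).
Proof. by move=> oW Wb; apply: fn_sum => // i; exact: fn_cmul. Qed.

Lemma fn_pairing_G n (u : 'I_n -> G -> R[i]) (b : 'I_n -> M -> R[i]) p :
  (forall i, fn G setT (u i)) -> fn G setT (pairing u b^~ p).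
Proof.
move=> Gu; apply: fn_sum => [|i]; first exact: openT.
by apply: fn_eq (fn_cmul (b i p) (Gu i)) _ => y _; rewrite mulrC.
Qed.

Lemma alg_local V a x p : fn M V a -> V (act x p) ->
  exists (W : set M) n (u v : 'I_n -> G -> R[i]) (b c : 'I_n -> M -> R[i]),
  [/\ W p /\ open W, forall i, fn G setT (u i) /\ fn G setT (v i),
      forall i, fn M W (b i) /\ fn M W (c i), pairing v c x p != 0 &
      forall y q, W q -> pairing v c y q != 0 ->
        V (act y q) /\ a (act y q) = pairing u b y q / pairing v c y q].
Proof.
move=> Va Vxp; have [W [n [u [v [b [c [Wp uv bc d0 H]]]]]]] := alg Va Vxp.
exists W, n, u, v, b, c; split=> //.
  split=> //; case: n u v b c uv bc d0 H => [|n] u v b c _ bc + _.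
    by rewrite big_ord0 eqxx.
  by move=> _; have [/fn_open] := bc ord0.
by move=> i; have [[U1 _] [V1 _]] := uv i.
Qed.

Lemma fn_local_quotient (X : space R) V (a : X -> R[i]) : fn_invertible X ->
  (forall x, V x -> exists W N D, [/\ W x, fn X W N, fn X W D, D x != 0 &
     forall y, W y -> D y != 0 -> V y /\ a y = N y / D y]) -> fn X V a.
Proof.
move=> X_inv H.
have key x : V x -> exists W, [/\ W x, W `<=` V & fn X W a].
  move=> /H[W [N [D [Wx WN WD D0 E]]]].
  have [W' [W'x W'W W'i W'0]] := X_inv _ _ _ WD Wx D0.
  exists W'; split=> // [y W'y|]; first by have [] := E y (W'W _ W'y) (W'0 _ W'y).
  apply: fn_eq (fn_mul (fn_res (fn_open W'i) W'W WN) W'i) _ => y W'y.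
  by have [_ ->] := E y (W'W _ W'y) (W'0 _ W'y).
apply: fn_glue => //; rewrite openE => x /key[W [Wx WV Wa]].
by apply: filterS WV _; apply: open_nbhs_nbhs; split=> //; exact: fn_open Wa.
Qed.

Lemma alg_translate V a y : fn M V a ->
  fn M [set p | V (act y p)] (fun p => a (act y p)).
Proof.
move=> Va; apply: fn_local_quotient => // p Vp.
have [W [n [u [v [b [c [[Wp oW] uv bc d0 H]]]]]]] := alg_local Va Vp.
exists W, (pairing u b y), (pairing v c y); split=> //; last exact: H.
  by apply: fn_pairing_M => // i; case: (bc i).
by apply: fn_pairing_M => // i; case: (bc i).
Qed.

Lemma alg_orbit V a p : fn M V a ->
  fn G [set y | V (act y p)] (fun y => a (act y p)).
Proof.
move=> Va; apply: fn_local_quotient => // y Vp.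
have [W [n [u [v [b [c [[Wp oW] uv bc d0 H]]]]]]] := alg_local Va Vp.
exists setT, (pairing u b^~ p), (pairing v c^~ p); split=> // [||z _]; last exact: H.
  by apply: fn_pairing_G => i; case: (uv i).
by apply: fn_pairing_G => i; case: (uv i).
Qed.

Lemma alg_regular_action : regular_action act.
Proof. by split=> // V a y; [exact: alg_translate|exact: alg_orbit]. Qed.

Context {s : R -> G} (ss : smooth_curve s) (s0 : s 0 = e1).

(** Near [q] the translate of [a] by [y] is a quotient [N y / D y] of
    combinations, with coefficients depending on [y], of fixed functions [b i]
    and [c i].  By the rule for quotients [xi (N / D) = xi N / D - (N / D) xi D / D],
    where [N / D] takes the constant value [a q] at the moving point.  So the
    functions [gs] are the [b i] and the [c i] together. *)
Lemma alg_expansion v : velocity_field act (s := s) v -> expansion act (s := s) v.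
Proof.
move=> vf V a q Va Vq; have [vD vH] := vf.
have ra := alg_regular_action.
have V1q : V (act e1 q) by rewrite act1.
have [W [n [u [w [b [c [[Wq oW] uw bc d0 H]]]]]]] := alg_local Va V1q.
have Wb i : fn M W (b i) by case: (bc i).
have Wc i : fn M W (c i) by case: (bc i).
have WN y : fn M W (pairing u b y) by exact: fn_pairing_M.
have WD y : fn M W (pairing w c y) by exact: fn_pairing_M.
have us i : cder (fun t => u i (s t)) (cdv (fun t => u i (s t))).
  by have [U1 _] := uw i; exact: (smooth_curve_cdv ss U1 I).
have ws i : cder (fun t => w i (s t)) (cdv (fun t => w i (s t))).
  by have [_ U1] := uw i; exact: (smooth_curve_cdv ss U1 I).
set u' := (fun i => cdv (fun t => u i (s t))).
set w' := (fun i => cdv (fun t => w i (s t))).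
(* The denominator is evaluated at the moving point. *)
pose tau (t : R) := act (ginv gl (s t)) q.
have tau0 : tau 0 = q by rewrite /tau s0 ginv1 act1.
pose den (t : R) : R[i] := pairing w c (s t) (tau t).
have den0 : den 0 != 0 by rewrite /den s0 tau0.
have cs f : fn M W f -> cder (fun t => f (tau t)) (- v W f q).
  by move=> Wf; exact: (velocity_field_inv cal ra ss s0 vf Wf Wq).
pose den' := \sum_i (w' i * c i (tau 0) + w i (s 0) * (- v W (c i) q)).
have dend : cder den den'.
  by apply: cder_sum => i; apply: cderM; [exact: ws|exact/cs].
have deni := cderV dend den0.
(* The [b i] carry the weight [u i / D], the [c i] the weight [- a q * w i / D]. *)
pose al (k : 'I_(n + n)) (t : R) : R[i] := match fintype.split k with
  | inl i => u i (s t) * (den t)^-1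
  | inr i => (- a q) * (w i (s t) * (den t)^-1) end.
pose gs (k : 'I_(n + n)) := match fintype.split k with inl i => b i | inr i => c i end.
pose r0 := (den 0)^-1.
pose r' := - den' / den 0 ^+ 2.
pose al' (k : 'I_(n + n)) : R[i] := match fintype.split k with
  | inl i => u' i * r0 + u i (s 0) * r'
  | inr i => (- a q) * (w' i * r0 + w i (s 0) * r') end.
have sumsplit (F1 F2 : 'I_n -> R[i]) :
   \sum_(k < n + n) (match fintype.split k with inl i => F1 i | inr i => F2 i end)
     = \sum_i F1 i + \sum_i F2 i.
  rewrite big_split_ord /=; congr (_ + _); apply: eq_bigr => i _.
    by rewrite (unsplitK (inl i)).
  by rewrite (unsplitK (inr i)).
exists W, (n + n)%N, gs, al, al'; split.
  split=> // k; first by rewrite /gs; case: (fintype.split k).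
  rewrite /al /al'; case: (fintype.split k) => i.
    by exact: (cderM (us i) deni).
  by apply: cderZ; exact: (cderM (ws i) deni).
split.
  have dn : \forall t \near 0, den t != 0.
    exact: (@cvgr_neq0 _ R[i]^o _ _ _ _ _ (cder_cont dend) den0).
  near=> t => W' xi oW' W'W W't W'a xiD.
  have dt : den t != 0 by near: t.
  have [W2 [W2t W2W W2i W20]] := M_inv (fn_res oW' W'W (WD (s t))) W't dt.
  have oW2 := fn_open W2i.
  have W2a := fn_res oW2 W2W W'a.
  have W2W_ : W2 `<=` W by exact: subset_trans W2W W'W.
  have W2D := fn_res oW2 W2W_ (WD (s t)).
  have W2b i := fn_res oW2 W2W_ (Wb i).
  have W2c i := fn_res oW2 W2W_ (Wc i).
  have E : eq_on W2 (fun p => a (act (s t) p) * pairing w c (s t) p)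
      (pairing u b (s t)).
    move=> p W2p; have [_ ->] := H (s t) p (W2W_ _ W2p) (W20 _ W2p).
    by rewrite divfK // W20.
  have xiP (f : 'I_n -> G -> R[i]) g : (forall i, fn M W2 (g i)) ->
      xi W2 (pairing f g (s t)) (tau t) = \sum_i f i (s t) * xi W2 (g i) (tau t).
    move=> W2g; rewrite /pairing.
    have W2fg i : fn M W2 (fun p => f i (s t) * g i p) by exact: fn_cmul.
    rewrite (der_sum xiD _ W2W oW2 W2fg W2t); apply: eq_bigr => i _.
    exact: (der_cmul xiD _ W2W (W2g i) W2t).
  have W2aD := fn_mul W2a W2D.
  have := der_eq xiD W2W W2aD E W2t.
  rewrite (der_mul xiD W2W W2a W2D W2t) -/(tau t) !xiP //.
  rewrite /tau (actKV ra) -/(tau t) => E2.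
  have rw f : fn M W' f -> xi W' f (tau t) = xi W2 f (tau t).
    by move=> W'f; rewrite -(der_res xiD (@subset_refl _ _) oW2 W2W W'f W2t).
  rewrite rw //.
  have -> : \sum_k al k t * xi W' (gs k) (tau t) =
     (den t)^-1 * \sum_i u i (s t) * xi W2 (b i) (tau t)
     + (- a q / den t) * \sum_i w i (s t) * xi W2 (c i) (tau t).
    rewrite !mulr_sumr -sumsplit; apply: eq_bigr => k _.
    rewrite /al /gs; case: (fintype.split k) => i; rewrite rw //.
    - by rewrite mulrA; congr (_ * _); rewrite mulrC.
    - exact: fn_res oW' W'W (Wb i).
    - by rewrite -!mulrA; congr (_ * _); rewrite mulrCA.
    - exact: fn_res oW' W'W (Wc i).
  rewrite -E2 -/(den t).
  have aux (x d y A : R[i]) : d != 0 -> x = d^-1 * (x * d + A * y) + (- A / d) * y.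
    by move=> d_0; field.
  exact: aux.
move=> W' xi oW' W'W W'q xiD.
have D0 : pairing w c e1 q != 0 by exact: d0.
have [W2 [W2q W2W W2i W20]] := M_inv (fn_res oW' W'W (WD e1)) W'q D0.
have oW2 := fn_open W2i.
have W2W_ : W2 `<=` W by exact: subset_trans W2W W'W.
have W2V : W2 `<=` V.
  by move=> p W2p; have [] := H e1 p (W2W_ _ W2p) (W20 _ W2p); rewrite act1.
have W2a := fn_res oW2 W2V Va.
have W2b i := fn_res oW2 W2W_ (Wb i).
have W2c i := fn_res oW2 W2W_ (Wc i).
have rx f : fn M W' f -> xi W' f q = xi W2 f q.
  by move=> W'f; rewrite -(der_res xiD (@subset_refl _ _) oW2 W2W W'f W2q).
have rv f : fn M W f -> v W f q = v W2 f q.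
  by move=> Wf; rewrite -(der_res vD (@subsetT _ _) oW2 W2W_ Wf W2q).
have W'v f : fn M W f -> fn M W' (v W' f).
  by move=> Wf; apply: (der_fn vD) => //; exact: fn_res Wf.
have rxv f : fn M W f -> xi W' (v W' f) q = xi W2 (v W2 f) q.
  move=> Wf; rewrite rx; last exact: W'v.
  apply: (der_eq xiD W2W (fn_res oW2 W2W (W'v _ Wf)) _ W2q) => p W2p.
  by rewrite -(der_res vD (@subsetT _ _) oW2 W2W (fn_res oW' W'W Wf) W2p).
pose lin (f : 'I_n -> R[i]) (g : 'I_n -> M -> R[i]) p := \sum_i f i * g i p.
have W2lin f g : (forall i, fn M W2 (g i)) -> fn M W2 (lin f g).
  by move=> W2g; apply: fn_sum => // i; exact: fn_cmul.
have linD D xi' f g p : derivation D xi' -> W2 `<=` D -> W2 p ->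
   (forall i, fn M W2 (g i)) ->
   xi' W2 (lin f g) p = \sum_i f i * xi' W2 (g i) p.
  move=> dx W2D W2p W2g.
  have W2fg i : fn M W2 (fun p => f i * g i p) by exact: fn_cmul.
  rewrite (der_sum dx _ W2D oW2 W2fg W2p); apply: eq_bigr => i _.
  exact: (der_cmul dx _ W2D (W2g i) W2p).
pose N0 := lin (u^~ e1) b; pose D_0 := lin (w^~ e1) c.
pose N1 := lin u' b; pose D1 := lin w' c.
have W2D0 : fn M W2 D_0 by exact: W2lin.
have W2D1 : fn M W2 D1 by exact: W2lin.
have E0 : eq_on W2 (fun p => a p * D_0 p) N0.
  move=> p W2p; have [_] := H e1 p (W2W_ _ W2p) (W20 _ W2p).
  by rewrite act1 => ->; rewrite divfK // W20.
have W2va : fn M W2 (v W2 a) by exact: (der_fn vD).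
(* The derivative at [t = 0] of the identity [a (s t p) * D = N]; [D1] and [N1]
   have the derivatives of the coefficients of [D] and [N] as coefficients. *)
have E1 : eq_on W2 (fun p => v W2 a p * D_0 p + a p * D1 p) N1.
  move=> p W2p.
  have cD : cder (fun t => pairing w c (s t) p) (D1 p).
    apply: cder_sum => i; have := cderM (ws i) (cder_cst (c i p)).
    by rewrite mulr0 addr0.
  have cN : cder (fun t => pairing u b (s t) p) (N1 p).
    apply: cder_sum => i; have := cderM (us i) (cder_cst (b i p)).
    by rewrite mulr0 addr0.
  have := cderM (vH _ _ _ W2a W2p) cD; rewrite s0 act1 => cA.
  apply: cder_uniq cA _; apply: cder_near cN.
  have dn : \forall t \near 0, pairing w c (s t) p != 0.
    apply: (@cvgr_neq0 _ R[i]^o _ _ _ _ _ (cder_cont cD)).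
    by rewrite s0; exact: W20.
  near=> t; have dt : pairing w c (s t) p != 0 by near: t.
  by have [_ ->] := H (s t) p (W2W_ _ W2p) dt; rewrite divfK.
have xE0 := der_eq xiD W2W (fn_mul W2a W2D0) E0 W2q.
rewrite (der_mul xiD W2W W2a W2D0 W2q) in xE0.
have vE0 : eq_on W2 (fun p => v W2 a p * D_0 p + a p * v W2 D_0 p) (v W2 N0).
  move=> p W2p; rewrite -(der_eq vD (@subsetT _ _) (fn_mul W2a W2D0) E0 W2p).
  by rewrite (der_mul vD (@subsetT _ _) W2a W2D0 W2p).
have W2vD0 : fn M W2 (v W2 D_0) by exact: (der_fn vD).
have f1 := fn_mul W2va W2D0; have f2 := fn_mul W2a W2vD0; have f3 := fn_mul W2a W2D1.
have xvE0 := der_eq xiD W2W (fn_add f1 f2) vE0 W2q.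
rewrite (der_add xiD W2W f1 f2 W2q) (der_mul xiD W2W W2va W2D0 W2q)
  (der_mul xiD W2W W2a W2vD0 W2q) in xvE0.
have xE1 := der_eq xiD W2W (fn_add f1 f3) E1 W2q.
rewrite (der_add xiD W2W f1 f3 W2q) (der_mul xiD W2W W2va W2D0 W2q)
  (der_mul xiD W2W W2a W2D1 W2q) in xE1.
have xl f g : (forall i, fn M W2 (g i)) -> xi W2 (lin f g) q = \sum_i f i * xi W2 (g i) q.
  by move=> W2g; exact: (linD _ _ _ _ _ xiD W2W W2q W2g).
have xvl f g : (forall i, fn M W2 (g i)) ->
    xi W2 (v W2 (lin f g)) q = \sum_i f i * xi W2 (v W2 (g i)) q.
  move=> W2g; have W2vg i : fn M W2 (v W2 (g i)) by exact: (der_fn vD).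
  rewrite -(xl f _ W2vg); apply: (der_eq xiD W2W _ _ W2q).
    by apply: (der_fn vD) => //; exact: W2lin.
  by move=> p W2p; exact: (linD _ _ _ _ _ vD (@subsetT _ _) W2p W2g).
have DE : den 0 = D_0 q by rewrite /den s0 tau0.
have den'E : den' = D1 q - v W2 D_0 q.
  rewrite /den' tau0 s0 (linD _ _ _ _ _ vD (@subsetT _ _) W2q W2c) -sumrB.
  by apply: eq_bigr => i _; rewrite mulrN rv.
have LHS : \sum_k al' k * xi W' (gs k) q =
   r0 * (xi W2 N1 q - a q * xi W2 D1 q) + r' * (xi W2 N0 q - a q * xi W2 D_0 q).
  rewrite !xl //.
  transitivity (\sum_i (u' i * r0 + u i e1 * r') * xi W2 (b i) q
    + \sum_i (- a q) * (w' i * r0 + w i e1 * r') * xi W2 (c i) q).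
    rewrite -sumsplit; apply: eq_bigr => k _; rewrite /al' /gs s0.
    case: (fintype.split k) => i; rewrite rx //.
      exact: fn_res oW' W'W (Wb i).
    exact: fn_res oW' W'W (Wc i).
  have lc (f g h : 'I_n -> R[i]) (x y z : R[i]) :
     \sum_i z * (f i * x + g i * y) * h i =
     z * (x * (\sum_i f i * h i) + y * (\sum_i g i * h i)).
    rewrite !mulr_sumr -big_split mulr_sumr; apply: eq_bigr => i _ /=; ring.
  have := lc u' (u^~ e1) (fun i => xi W2 (b i) q) r0 r' 1.
  under eq_bigr do rewrite mul1r.
  move=> ->; rewrite lc; ring.
have RHS : \sum_k al k 0 * xi W' (v W' (gs k)) q =
   r0 * (xi W2 (v W2 N0) q - a q * xi W2 (v W2 D_0) q).
  rewrite !xvl //.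
  have -> : r0 * (\sum_i u i e1 * xi W2 (v W2 (b i)) q
       - a q * \sum_i w i e1 * xi W2 (v W2 (c i)) q) =
    r0 * (\sum_i u i e1 * xi W2 (v W2 (b i)) q)
    + r0 * (- a q * \sum_i w i e1 * xi W2 (v W2 (c i)) q) by ring.
  rewrite !mulr_sumr -sumsplit; apply: eq_bigr => k _.
  rewrite /al /gs s0 -/r0; case: (fintype.split k) => i; rewrite rxv //; by ring.
rewrite LHS RHS /r0 /r' den'E DE -xE0 -xE1 -xvE0.
have D0q : D_0 q != 0 by exact: D0.
have aux (va d A dd xva xd xa x1 d1 xvd : R[i]) : d != 0 ->
  d^-1 * ((xva * d + va * xd + (xa * d1 + A * x1)) - A * x1)
   + - (d1 - dd) / d ^+ 2 * ((xa * d + A * xd) - A * xd) =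
  d^-1 * ((xva * d + va * xd + (xa * dd + A * xvd)) - A * xvd).
  by move=> dn0; field.
exact: aux.
Unshelve. all: by end_near. Qed.

End Algebraic.
End ActionCases.

(** * From infinitesimal invariance to invariance *)

Section Brackets.
Context {R : realType} {k : category} {G : lie_group (model_of R k)}.
Context {M : G_manifold G}.
Implicit Types (V W : set M) (a b c : M -> R[i]).

Section Bracket.
Context {f : biop M} (fB : bracket f).

Lemma br_fn V a b : fn M V a -> fn M V b -> fn M V (f V a b).
Proof. by case: fB => + _ _ _ _; exact. Qed.

Lemma br_eq V a b a' b' : fn M V a -> fn M V b -> eq_on V a a' ->
  eq_on V b b' -> eq_on V (f V a b) (f V a' b').
Proof. by case: fB => _ + _ _ _; exact. Qed.

Lemma br_res V W a b : open W -> W `<=` V -> fn M V a -> fn M V b ->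
  eq_on W (f W a b) (f V a b).
Proof. by case: fB => _ _ + _ _; exact. Qed.

Lemma br_lin V (c : R[i]) a b d : fn M V a -> fn M V b -> fn M V d ->
  eq_on V (f V (fun p => c * a p + b p) d) (fun p => c * f V a d p + f V b d p).
Proof. by case: fB => _ _ _ + _; exact. Qed.

Lemma br_skew V a b : fn M V a -> fn M V b ->
  eq_on V (f V a b) (fun p => - f V b a p).
Proof. by case: fB => _ _ _ _ [+ _]; exact. Qed.

Lemma br_leibniz V a b c : fn M V a -> fn M V b -> fn M V c ->
  eq_on V (f V (fun p => a p * b p) c) (fun p => a p * f V b c p + f V a c p * b p).
Proof. by case: fB => _ _ _ _ [_ +]; exact. Qed.

Lemma bracket_derivation W b : fn M W b -> derivation W (fun V a => f V a b).
Proof.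
move=> Wb.
have Vb V a : V `<=` W -> fn M V a -> fn M V b.
  by move=> VW Va; exact: fn_res (fn_open Va) VW Wb.
split=> V.
- by move=> a VW Va; apply: br_fn => //; exact: Vb Va.
- by move=> a b' VW Va ab; apply: br_eq => //; exact: Vb Va.
- by move=> W' a VW oW' W'V Va; apply: br_res => //; exact: Vb Va.
- by move=> c a b' VW Va Vb'; apply: br_lin => //; exact: Vb Va.
- move=> a b' VW Va Vb' p Vp; rewrite (br_leibniz Va Vb' (Vb _ _ VW Va) Vp).
  by rewrite addrC.
Qed.

End Bracket.

Section Integration.
Context (g : lie_algebra_of G).

Local Notation cal := (category_calculus R k).

Lemma manifold_regular_action : regular_action (@gm_act R k G M).
Proof.
have act1 := @gm_act1 R k G M; have actM := @gm_actM R k G M.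
have reg := @gm_regular R k G M; have mf := @gm_manifold R k G M.
have Gmf := lg_manifold G.
move: cal act1 actM reg mf Gmf; case: (k) G M.
- by move=> G' M' cal' a1 aM reg _ _; exact: (smooth_regular_action cal' a1 aM reg).
- by move=> G' M' cal' a1 aM reg _ _; exact: (smooth_regular_action cal' a1 aM reg).
- move=> G' M' cal' a1 aM reg mf Gmf.
  exact: (alg_regular_action a1 aM reg (manifold_invertible cal' Gmf)
    (variety_invertible mf)).
Qed.

Lemma manifold_expansion (s : R -> G) v : smooth_curve s -> s 0 = gone (lg_law G) ->
  velocity_field (@gm_act R k G M) (s := s) v -> expansion (@gm_act R k G M) (s := s) v.
Proof.
have act1 := @gm_act1 R k G M; have actM := @gm_actM R k G M.
have reg := @gm_regular R k G M; have mf := @gm_manifold R k G M.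
have Gmf := lg_manifold G; have ra := manifold_regular_action.
move: cal act1 actM reg mf Gmf ra; move: s v; case: (k) G M.
- move=> G' M' s v cal' a1 aM reg _ _ ra ss s0.
  exact: (smooth_expansion cal' ra ss s0 reg).
- move=> G' M' s v cal' a1 aM reg _ _ ra ss s0.
  exact: (smooth_expansion cal' ra ss s0 reg).
- move=> G' M' s v cal' a1 aM reg mf Gmf _ ss s0.
  exact: (alg_expansion cal' a1 aM reg (manifold_invertible cal' Gmf)
    (variety_invertible mf) ss s0).
Qed.

(** Both [inf_act] and [curve_field] involve an inverse; they compensate. *)
Lemma inf_act_velocity (s : R -> G) : smooth_curve s -> s 0 = gone (lg_law G) ->
  exists x : g, forall V a p, fn M V a -> V p ->
    cder (fun t => a (gm_act (s t) p)) (inf_act x V a p).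
Proof.
move=> ss s0; have [x Hx] := curve_field_element cal ss s0 g.
exists x => V a p Va Vp; have ra := manifold_regular_action.
have Wu := fn_inv cal (ra_orbit ra p Va).
have W1 : V (gm_act (ginv (lg_law G) (gone (lg_law G))) p) by rewrite ginv1 gm_act1.
have := Hx _ _ _ Wu W1; rewrite /inf_act; apply: cder_ext => // t.
by rewrite gmul1 ginvK.
Qed.

Context {f : biop M} (fB : bracket f).
Hypothesis g_der : forall x : g, derivation setT (inf_act x : op M).
Hypothesis g_inv : forall (x : g) V a b, fn M V a -> fn M V b ->
  eq_on V (inf_act x V (f V a b))
          (fun p => f V (inf_act x V a) b p + f V a (inf_act x V b) p).

(** Both arguments are expanded by [expansion], which leaves a double sum of
    products of differentiable functions of [t].  In its derivative at 0, the
    variation of the point contributes the action on [f W (g1 i) (g2 j)], and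
    infinitesimal invariance splits it into the two terms produced by the
    variation of the coefficients. *)
Lemma bracket_curve_cst (s : R -> G) V a b q : smooth_curve s ->
  s 0 = gone (lg_law G) -> fn M V a -> fn M V b -> V q ->
  cder (fun t => f [set p | V (gm_act (s t) p)] (fun p => a (gm_act (s t) p))
    (fun p => b (gm_act (s t) p)) (gm_act (ginv (lg_law G) (s t)) q)) 0.
Proof.
move=> ss s0 Va Vb Vq; have ra := manifold_regular_action.
have [x Hx] := inf_act_velocity ss s0.
set v : op M := inf_act x.
have vf : velocity_field (@gm_act R k G M) (s := s) v by split; [exact: g_der|exact: Hx].
have ex := manifold_expansion ss s0 vf.
have [W1 [n1 [g1 [al1 [al1' [[oW1 W1q W1g c1] [E1 I1]]]]]]] := ex V a q Va Vq.
have [W2 [n2 [g2 [al2 [al2' [[oW2 W2q W2g c2] [E2 I2]]]]]]] := ex V b q Vb Vq.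
pose W := W1 `&` W2.
have oW : open W by exact: openI.
have Wq : W q by [].
have WW1 : W `<=` W1 by move=> ? [].
have WW2 : W `<=` W2 by move=> ? [].
have Wg1 i := fn_res oW WW1 (W1g i).
have Wg2 i := fn_res oW WW2 (W2g i).
pose tau t := gm_act (ginv (lg_law G) (s t)) q.
have tau0 : tau 0 = q by rewrite /tau s0 ginv1 gm_act1.
pose F i j := f W (g1 i) (g2 j).
have WF i j : fn M W (F i j) by exact: br_fn.
have cF i j : cder (fun t => F i j (tau t)) (- v W (F i j) q).
  exact: (velocity_field_inv cal ra ss s0 vf (WF i j) Wq).
(* The derivative of the double expansion, before any simplification. *)
have D := cder_sum (fun i => cderM (c1 i)
   (cder_sum (fun j => cderM (c2 j) (cF i j)))).
apply: (cder_near _ (cder_ext (fun=> erefl) _ D)).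
  near=> t.
  have Wt : W (tau t).
    by near: t; exact: (act_inv_curve_near cal ra ss s0 oW Wq).
  have Vta := ra_translate ra (s t) Va.
  have Vtb := ra_translate ra (s t) Vb.
  pose W' := W `&` [set p | V (gm_act (s t) p)].
  have oW' : open W' by apply: openI => //; exact: fn_open Vta.
  have W't : W' (tau t) by split=> //; rewrite /= /tau (actKV ra).
  have W'W : W' `<=` W by move=> ? [].
  have W'V : W' `<=` [set p | V (gm_act (s t) p)] by move=> ? [].
  have W'W1 := subset_trans W'W WW1; have W'W2 := subset_trans W'W WW2.
  have W'a := fn_res oW' W'V Vta; have W'b := fn_res oW' W'V Vtb.
  rewrite -/(tau t) -(br_res fB oW' W'V Vta Vtb W't).
  have e1 : forall W' xi, open W' -> W' `<=` W1 ->
     W' (tau t) -> fn M W' (fun p => a (gm_act (s t) p)) ->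
     derivation W' xi -> xi W' (fun p => a (gm_act (s t) p)) (tau t) =
       \sum_i al1 i t * xi W' (g1 i) (tau t) by near: t.
  have e2 : forall W' xi, open W' -> W' `<=` W2 ->
     W' (tau t) -> fn M W' (fun p => b (gm_act (s t) p)) ->
     derivation W' xi -> xi W' (fun p => b (gm_act (s t) p)) (tau t) =
       \sum_i al2 i t * xi W' (g2 i) (tau t) by near: t.
  rewrite (e1 _ _ oW' W'W1 W't W'a (bracket_derivation fB W'b)).
  apply: eq_bigr => i _; congr (_ * _).
  have W'g1 := fn_res oW' W'W (Wg1 i).
  rewrite (br_skew fB W'g1 W'b W't).
  rewrite (e2 _ _ oW' W'W2 W't W'b (bracket_derivation fB W'g1)) -sumrN.
  apply: eq_bigr => j _; rewrite -mulrN; congr (_ * _).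
  have W'g2 := fn_res oW' W'W (Wg2 j).
  by rewrite /F -(br_res fB oW' W'W (Wg1 i) (Wg2 j) W't) (br_skew fB W'g1 W'g2 W't).
rewrite tau0.
have vE i j : v W (F i j) q = f W (v W (g1 i)) (g2 j) q + f W (g1 i) (v W (g2 j)) q.
  exact: (g_inv x (Wg1 i) (Wg2 j) Wq).
have i1 j := I1 W _ oW WW1 Wq (bracket_derivation fB (Wg2 j)).
have i2 i := I2 W _ oW WW2 Wq (bracket_derivation fB (Wg1 i)).
have Wv2 j : fn M W (v W (g2 j)) by apply: (der_fn (g_der x)).
have i2' i : \sum_j al2' j * F i j q = \sum_j al2 j 0 * f W (g1 i) (v W (g2 j)) q.
  apply: oppr_inj; rewrite -!sumrN.
  transitivity (\sum_j al2' j * f W (g2 j) (g1 i) q).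
    apply: eq_bigr => j _; rewrite /F (br_skew fB (Wg2 j) (Wg1 i) Wq); by rewrite mulrN.
  rewrite i2; apply: eq_bigr => j _.
  by rewrite (br_skew fB (Wv2 j) (Wg1 i) Wq) mulrN.
transitivity (\sum_i (al1' i * (\sum_j al2 j 0 * F i j q) +
   al1 i 0 * ((\sum_j al2' j * F i j q) + \sum_j al2 j 0 * (- v W (F i j) q)))).
  by apply: eq_bigr => i _; rewrite big_split.
transitivity (\sum_i \sum_j al2 j 0 * (al1' i * F i j q
    - al1 i 0 * f W (v W (g1 i)) (g2 j) q)).
  apply: eq_bigr => i _; rewrite i2' -big_split /= !mulr_sumr -big_split /=.
  apply: eq_bigr => j _; rewrite vE; ring.
rewrite exchange_big big1 // => j _.
rewrite -mulr_sumr sumrB i1 subrr mulr0 //.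
Unshelve. all: by end_near. Qed.

(** For fixed [q], the bracket of the translates of [a] and [b] by [y], taken
    at [y^-1 q], is constant in [y] by [constant_on_group]; compare [y = x^-1]
    with the unit. *)
Lemma bracket_G_invariant : connected [set: G] -> G_invariant f.
Proof.
move=> Gconn; have ra := manifold_regular_action.
move=> /= x V a b Va Vb q Vq.
pose psi (y : G) := f [set p | V (gm_act y p)] (fun p => a (gm_act y p))
   (fun p => b (gm_act y p)) (gm_act (ginv (lg_law G) y) q).
have H : forall y (s : R -> G), smooth_curve s -> s 0 = gone (lg_law G) ->
    cder (fun t => psi (gmul (lg_law G) y (s t))) 0.
  move=> y s ss s0.
  have V'q : V (gm_act y (gm_act (ginv (lg_law G) y) q)) by rewrite (actKV ra).
  have := bracket_curve_cst ss s0 (ra_translate ra y Va) (ra_translate ra y Vb) V'q.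
  apply: cder_ext => // t; rewrite /psi ginvM gm_actM.
  congr (f _ _ _ _).
  - by apply: boolp.funext => p /=; rewrite gm_actM.
  - by apply: boolp.funext => p /=; rewrite gm_actM.
  - by apply: boolp.funext => p /=; rewrite gm_actM.
have := constant_on_group cal Gconn H (ginv (lg_law G) x).
rewrite /psi ginvK ginv1 gm_act1 /tr_set /tr_fun => ->.
have e1 : (fun p => a (gm_act (gone (lg_law G)) p)) = a.
  by apply: boolp.funext => p; rewrite gm_act1.
have e2 : (fun p => b (gm_act (gone (lg_law G)) p)) = b.
  by apply: boolp.funext => p; rewrite gm_act1.
have e3 : [set p | V (gm_act (gone (lg_law G)) p)] = V.
  by apply: boolp.funext => p /=; rewrite gm_act1.
by rewrite e1 e2 e3.
Qed.

End Integration.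
End Brackets.

(** * Deformations of the product by bidifferential operators *)

Section Bidifferential.
Context {R : realType} {k : category} {G : lie_group (model_of R k)}.
Context {M : G_manifold G}.
Implicit Types (V W D : set M) (a b c : M -> R[i]).
Local Notation cal := (category_calculus R k).

Lemma frame_derivation D n (d : 'I_n -> op M) :
  frame D d -> forall i, derivation D (d i).
Proof.
move: cal; rewrite /frame; move: D d; case: (k) G M.
- by move=> G' M' D d cal' [c <- ->] i; exact: coord_field_derivation.
- by move=> G' M' D d cal' [c <- ->] i; exact: coord_field_derivation.
- by move=> G' M' D d _.
Qed.

(** What is used of bidifferential operators: they are local and bilinear. *)
Record bilocal (B : biop M) : Prop := Bilocal {
  bl_fn : forall V a b, fn M V a -> fn M V b -> fn M V (B V a b);
  bl_eq : forall V a b a' b', fn M V a -> fn M V b -> eq_on V a a' ->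
    eq_on V b b' -> eq_on V (B V a b) (B V a' b');
  bl_res : forall V W a b, open W -> W `<=` V -> fn M V a -> fn M V b ->
    eq_on W (B W a b) (B V a b);
  bl_linl : forall V (c : R[i]) a b d, fn M V a -> fn M V b -> fn M V d ->
    eq_on V (B V (fun p => c * a p + b p) d) (fun p => c * B V a d p + B V b d p);
  bl_linr : forall V (c : R[i]) a b d, fn M V a -> fn M V b -> fn M V d ->
    eq_on V (B V d (fun p => c * a p + b p)) (fun p => c * B V d a p + B V d b p) }.

Section Words.
Context {D : set M} {n : nat} {d : 'I_n -> op M} (dD : forall i, derivation D (d i)).
Local Notation word W al a := (foldr (fun i => d i W) a al).

Lemma word_fn W a al : W `<=` D -> fn M W a -> fn M W (word W al a).
Proof. by move=> WD Wa; elim: al => //= i al IH; exact: (der_fn (dD i)). Qed.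

Lemma word_eq W a b al : W `<=` D -> fn M W a -> eq_on W a b ->
  eq_on W (word W al a) (word W al b).
Proof.
move=> WD Wa ab; elim: al => //= i al IH.
by apply: (der_eq (dD i) WD) => //; exact: word_fn.
Qed.

Lemma word_lin W (e : R[i]) a b al : W `<=` D -> fn M W a -> fn M W b ->
  eq_on W (word W al (fun p : M => e * a p + b p))
          (fun p => e * word W al a p + word W al b p).
Proof.
move=> WD Wa Wb; elim: al => //= i al IH p Wp.
have W1 := word_fn al WD Wa; have W2 := word_fn al WD Wb.
have W3 := word_fn al WD (fn_lin e Wa Wb).
by rewrite (der_eq (dD i) WD W3 IH Wp) (der_lin (dD i) e WD W1 W2 Wp).
Qed.
End Words.

Lemma bidiff_swap B : bidiff_op B -> bidiff_op (fun V a b => B V b a).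
Proof.
move=> [Bfn Bloc]; split=> [V a b Va Vb|p]; first exact: Bfn.
have [D [n [d [N [c [al [be [oD Dp fd cD E]]]]]]]] := Bloc p.
exists D, n, d, N, c, be, al; split=> // V W a b Va Vb oW WV WD q Wq.
by rewrite (E V W b a Vb Va oW WV WD q Wq); apply: eq_bigr => t _; rewrite mulrAC.
Qed.

Lemma bidiff_linl B V (e : R[i]) a b d : bidiff_op B ->
  fn M V a -> fn M V b -> fn M V d ->
  eq_on V (B V (fun p => e * a p + b p) d) (fun p => e * B V a d p + B V b d p).
Proof.
move=> [_ Bloc] Va Vb Vd p Vp.
have [D [n [d' [N [c [al [be [oD Dp fd cD E]]]]]]]] := Bloc p.
have dD := frame_derivation fd.
have oW : open (V `&` D) by apply: openI => //; exact: fn_open Va.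
have WV : V `&` D `<=` V by move=> ? [].
have WD : V `&` D `<=` D by move=> ? [].
have Wp : (V `&` D) p by [].
have Wa := fn_res oW WV Va; have Wb := fn_res oW WV Vb.
rewrite (E V _ _ d (fn_lin e Va Vb) Vd oW WV WD p Wp).
rewrite (E V _ a d Va Vd oW WV WD p Wp) (E V _ b d Vb Vd oW WV WD p Wp).
rewrite mulr_sumr -big_split; apply: eq_bigr => t _ /=.
by rewrite (word_lin dD e (al t) WD Wa Wb Wp); ring.
Qed.

Lemma bidiff_bilocal B : bidiff_op B -> bilocal B.
Proof.
move=> Bd; have [Bfn Bloc] := Bd; split=> //.
- move=> V a b a' b' Va Vb aa bb p Vp.
  have [D [n [d [N [c [al [be [oD Dp fd cD E]]]]]]]] := Bloc p.
  have dD := frame_derivation fd.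
  have oW : open (V `&` D) by apply: openI => //; exact: fn_open Va.
  have WV : V `&` D `<=` V by move=> ? [].
  have WD : V `&` D `<=` D by move=> ? [].
  have Wp : (V `&` D) p by [].
  have Wa := fn_res oW WV Va; have Wb := fn_res oW WV Vb.
  have Va' := fn_eq Va aa; have Vb' := fn_eq Vb bb.
  rewrite (E V _ a b Va Vb oW WV WD p Wp) (E V _ a' b' Va' Vb' oW WV WD p Wp).
  apply: eq_bigr => t _; congr (_ * _ * _).
    by apply: (word_eq dD _ WD Wa) => // q [Vq _]; exact: aa.
  by apply: (word_eq dD _ WD Wb) => // q [Vq _]; exact: bb.
- move=> V W' a b oW' W'V Va Vb p W'p.
  have [D [n [d [N [c [al [be [oD Dp fd cD E]]]]]]]] := Bloc p.
  have oW : open (W' `&` D) by exact: openI.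
  have W2 : W' `&` D `<=` W' by move=> ? [].
  have WD : W' `&` D `<=` D by move=> ? [].
  have WV := subset_trans W2 W'V.
  have Wp : (W' `&` D) p by [].
  have W'a := fn_res oW' W'V Va; have W'b := fn_res oW' W'V Vb.
  by rewrite (E V _ a b Va Vb oW WV WD p Wp) (E W' _ a b W'a W'b oW W2 WD p Wp).
- by move=> V e a b d Va Vb Vd; exact: bidiff_linl.
- by move=> V e a b d Va Vb Vd; exact: (bidiff_linl e (bidiff_swap Bd)).
Qed.

Section Bilocal.
Context {B : biop M} (Bl : bilocal B).

Lemma bl_addl V a b d : fn M V a -> fn M V b -> fn M V d ->
  eq_on V (B V (fun p => a p + b p) d) (fun p => B V a d p + B V b d p).
Proof.
move=> Va Vb Vd p Vp; rewrite -[B V a d p]mul1r -(bl_linl Bl 1 Va Vb Vd Vp).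
by apply: (bl_eq Bl) Vp => //; [exact: fn_add|move=> q _; rewrite mul1r].
Qed.

Lemma bl_0l V d : open V -> fn M V d -> eq_on V (B V (fun=> 0) d) (fun=> 0).
Proof.
move=> oV Vd p Vp; have V0 := fn_cst (s := M) 0 oV.
have := bl_addl V0 V0 Vd Vp.
have -> : (fun p => 0 + 0) = (fun=> 0 : R[i]) :> (M -> R[i]).
  by apply: boolp.funext => q; rewrite addr0.
by move/esym/eqP; rewrite -subr_eq0 addrK => /eqP.
Qed.

Lemma bl_subl V a b d : fn M V a -> fn M V b -> fn M V d ->
  eq_on V (B V (fun p => a p - b p) d) (fun p => B V a d p - B V b d p).
Proof.
move=> Va Vb Vd p Vp.
have -> : B V a d p - B V b d p = -1 * B V b d p + B V a d p by ring.
rewrite -(bl_linl Bl (-1) Vb Va Vd Vp).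
by apply: (bl_eq Bl) Vp => //; [exact: fn_sub|move=> q _; rewrite mulN1r addrC].
Qed.

Lemma bilocal_swap : bilocal (fun V a b => B V b a).
Proof.
split=> *; [exact: (bl_fn Bl)|exact: (bl_eq Bl)|exact: (bl_res Bl)|..].
  exact: (bl_linr Bl).
exact: (bl_linl Bl).
Qed.

End Bilocal.

Lemma bl_0r B V d : bilocal B -> open V -> fn M V d -> eq_on V (B V d (fun=> 0)) (fun=> 0).
Proof. by move=> /bilocal_swap Bl; exact: (bl_0l Bl). Qed.

Lemma bl_subr B V a b d : bilocal B -> fn M V a -> fn M V b -> fn M V d ->
  eq_on V (B V d (fun p => a p - b p)) (fun p => B V d a p - B V d b p).
Proof. by move=> /bilocal_swap Bl; exact: (bl_subl Bl). Qed.

Section Associative.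
Context {m : nat -> biop M}.
Hypothesis m_0 : forall V a b, fn M V a -> fn M V b ->
  eq_on V (m 0 V a b) (fun p => a p * b p).
Hypothesis m_bidiff : forall i, (0 < i)%N -> bidiff_op (m i).
Hypothesis m_assoc : forall V (x y z : nat -> M -> R[i]),
  (forall n, fn M V (x n)) -> (forall n, fn M V (y n)) -> (forall n, fn M V (z n)) ->
  forall n, eq_on V (mh m V (mh m V x y) z n) (mh m V x (mh m V y z) n).

Lemma m_bilocal i : bilocal (m i).
Proof.
case: i => [|i]; last exact/bidiff_bilocal/m_bidiff.
split.
- by move=> V a b Va Vb; apply: fn_eq (fn_mul Va Vb) _ => p Vp; rewrite m_0.
- move=> V a b a' b' Va Vb aa bb p Vp.
  by rewrite m_0 // m_0 ?aa ?bb //; [exact: fn_eq aa|exact: fn_eq bb].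
- move=> V W a b oW WV Va Vb p Wp; rewrite m_0 ?m_0 //; [exact: WV|..].
    exact: fn_res Va.
  exact: fn_res Vb.
- by move=> V e a b d Va Vb Vd p Vp; rewrite !m_0 //; [ring|exact: fn_lin].
- by move=> V e a b d Va Vb Vd p Vp; rewrite !m_0 //; [ring|exact: fn_lin].
Qed.

Definition const_series a (n : nat) : M -> R[i] := if n is 0 then a else fun=> 0.

Lemma const_series_fn V a n : fn M V a -> fn M V (const_series a n).
Proof. by case: n => //= _ Va; exact: fn_cst (fn_open Va). Qed.

Lemma mh_fn V x y n : open V -> (forall n, fn M V (x n)) ->
  (forall n, fn M V (y n)) -> fn M V (mh m V x y n).
Proof.
move=> oV Vx Vy; apply: fn_sum => // i; apply: fn_sum => // j.
exact: (bl_fn (m_bilocal i)).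
Qed.

Lemma mh_constr V x z n : (forall n, fn M V (x n)) -> fn M V z ->
  eq_on V (mh m V x (const_series z) n)
          (fun p => \sum_(i < n.+1) m i V (x (n - i)%N) z p).
Proof.
move=> Vx Vz p Vp; apply: eq_bigr => i _; rewrite big_ord_recr /= subnn /=.
rewrite big1 ?add0r // => j _.
have : (0 < n - i - j)%N by rewrite subn_gt0.
case: (n - i - j)%N => // l _ /=.
by rewrite (bl_0r (m_bilocal i) (fn_open Vz) (Vx _) Vp).
Qed.

Lemma mh_constl V a y n : (forall n, fn M V (y n)) -> fn M V a ->
  eq_on V (mh m V (const_series a) y n)
          (fun p => \sum_(i < n.+1) m i V a (y (n - i)%N) p).
Proof.
move=> Vy Va p Vp; apply: eq_bigr => i _; rewrite big_ord_recl /= subn0.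
rewrite big1 ?addr0 // => j _.
by rewrite /= (bl_0l (m_bilocal i) (fn_open Va) (Vy _) Vp).
Qed.

Lemma mh_const V a b n : fn M V a -> fn M V b ->
  eq_on V (mh m V (const_series a) (const_series b) n) (m n V a b).
Proof.
move=> Va Vb p Vp; rewrite mh_constr //; last by move=> l; exact: const_series_fn.
rewrite big_ord_recr /= subnn /= big1 ?add0r // => i _.
have : (0 < n - i)%N by rewrite subn_gt0.
case: (n - i)%N => // l _ /=.
by rewrite (bl_0l (m_bilocal i) (fn_open Va) Vb Vp).
Qed.

Lemma assoc_coef V a b c n : fn M V a -> fn M V b -> fn M V c ->
  eq_on V (fun p => \sum_(i < n.+1) m i V (m (n - i)%N V a b) c p)
          (fun p => \sum_(i < n.+1) m i V a (m (n - i)%N V b c) p).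
Proof.
move=> Va Vb Vc p Vp.
have Ca l := const_series_fn l Va; have Cb l := const_series_fn l Vb.
have Cc l := const_series_fn l Vc; have oV := fn_open Va.
have := m_assoc Ca Cb Cc n Vp.
rewrite mh_constr //; last by move=> l; exact: mh_fn.
rewrite mh_constl //; last by move=> l; exact: mh_fn.
have e1 i : m i V (mh m V (const_series a) (const_series b) (n - i)%N) c p =
    m i V (m (n - i)%N V a b) c p.
  by apply: (bl_eq (m_bilocal i)) Vp => //; [exact: mh_fn|exact: mh_const].
have e2 i : m i V a (mh m V (const_series b) (const_series c) (n - i)%N) p =
    m i V a (m (n - i)%N V b c) p.
  by apply: (bl_eq (m_bilocal i)) Vp => //; [exact: mh_fn|exact: mh_const].
by under eq_bigr do rewrite e1; under [RHS]eq_bigr do rewrite e2.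
Qed.

(** The coefficient of h in associativity: [m 1] is a Hochschild cocycle. *)
Lemma hochschild1 V a b c p : fn M V a -> fn M V b -> fn M V c -> V p ->
  m 1 V a b p * c p + m 1 V (fun p => a p * b p) c p =
  a p * m 1 V b c p + m 1 V a (fun p => b p * c p) p.
Proof.
move=> Va Vb Vc Vp; have := @assoc_coef V a b c 1 Va Vb Vc p Vp.
rewrite !big_ord_recl !big_ord0 /= !addr0 /bump /= !subn0 !subnn.
have m1fn x y : fn M V x -> fn M V y -> fn M V (m 1 V x y).
  exact: (bl_fn (m_bilocal 1)).
have m0fn x y : fn M V x -> fn M V y -> fn M V (m 0 V x y).
  exact: (bl_fn (m_bilocal 0)).
rewrite (m_0 (m1fn _ _ Va Vb) Vc Vp) (m_0 Va (m1fn _ _ Vb Vc) Vp).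
rewrite (bl_eq (m_bilocal 1) (m0fn _ _ Va Vb) Vc (m_0 Va Vb) (fun _ _ => erefl) Vp).
by rewrite (bl_eq (m_bilocal 1) Va (m0fn _ _ Vb Vc) (fun _ _ => erefl) (m_0 Vb Vc) Vp).
Qed.

(** The coefficient of h^2: the associator of [m 1] is the coboundary of
    [m 2]. *)
Lemma hochschild2 V a b c p : fn M V a -> fn M V b -> fn M V c -> V p ->
  m 2 V a b p * c p + m 1 V (m 1 V a b) c p + m 2 V (fun p => a p * b p) c p =
  a p * m 2 V b c p + m 1 V a (m 1 V b c) p + m 2 V a (fun p => b p * c p) p.
Proof.
move=> Va Vb Vc Vp; have := @assoc_coef V a b c 2 Va Vb Vc p Vp.
rewrite !big_ord_recl !big_ord0 /= !addr0 /bump /= !subn0 !subnn.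
have mfn i x y : fn M V x -> fn M V y -> fn M V (m i V x y).
  exact: (bl_fn (m_bilocal i)).
rewrite (m_0 (mfn 2%N _ _ Va Vb) Vc Vp) (m_0 Va (mfn 2%N _ _ Vb Vc) Vp).
rewrite (bl_eq (m_bilocal 2) (mfn 0%N _ _ Va Vb) Vc (m_0 Va Vb) (fun _ _ => erefl) Vp).
rewrite (bl_eq (m_bilocal 2) Va (mfn 0%N _ _ Vb Vc) (fun _ _ => erefl) (m_0 Vb Vc) Vp).
by rewrite !addrA.
Qed.

(** The Leibniz rule is the alternating sum of the cocycle identity at
    (a, b, c), (a, c, b) and (c, a, b). *)
Lemma poisson_of_bracket : bracket (poisson_of m).
Proof.
have B1 := m_bilocal 1.
split; [| | | |split].
- by move=> V a b Va Vb; apply: fn_sub; exact: (bl_fn B1).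
- by move=> V a b a' b' Va Vb aa bb p Vp; rewrite /poisson_of
    (bl_eq B1 Va Vb aa bb Vp) (bl_eq B1 Vb Va bb aa Vp).
- by move=> V W a b oW WV Va Vb p Wp; rewrite /poisson_of
    (bl_res B1 oW WV Va Vb Wp) (bl_res B1 oW WV Vb Va Wp).
- move=> V c a b d Va Vb Vd p Vp; rewrite /poisson_of.
  by rewrite (bl_linl B1 c Va Vb Vd Vp) (bl_linr B1 c Va Vb Vd Vp); ring.
- by move=> V a b Va Vb p Vp; rewrite /poisson_of opprB.
- move=> V a b c Va Vb Vc p Vp; rewrite /poisson_of.
  have h1 := hochschild1 Va Vb Vc Vp; have h2 := hochschild1 Vc Va Vb Vp.
  have h3 := hochschild1 Va Vc Vb Vp.
  have e1 : (fun p => c p * a p) = (fun p => a p * c p) :> (M -> R[i]).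
    by apply: boolp.funext => q; rewrite mulrC.
  have e2 : (fun p => c p * b p) = (fun p => b p * c p) :> (M -> R[i]).
    by apply: boolp.funext => q; rewrite mulrC.
  rewrite e1 in h2; rewrite e2 in h3.
  have aux (ab_ c_ abc b_ a_ bc abc' ca cab acb ac cb : R[i]) :
    ab_ * c_ + abc = a_ * bc + abc' -> ca * b_ + acb = c_ * ab_ + cab ->
    ac * b_ + acb = a_ * cb + abc' ->
    abc - cab = a_ * (bc - cb) + (ac - ca) * b_.
    move=> H1 H2 H3.
    have -> : abc = a_ * bc + abc' - ab_ * c_ by rewrite -H1; ring.
    have -> : cab = ca * b_ + acb - c_ * ab_ by rewrite H2; ring.
    have -> : abc' = ac * b_ + acb - a_ * cb by rewrite H3; ring.
    by ring.
  exact: (aux _ _ _ _ _ _ _ _ _ _ _ _ h1 h2 h3).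
Qed.

(** In the alternating sum of [hochschild2] over the six orders of the
    arguments the terms in [m 2] cancel, the product being commutative. *)
Lemma poisson_of_jacobi V a b c p : fn M V a -> fn M V b -> fn M V c -> V p ->
  poisson_of m V (poisson_of m V a b) c p + poisson_of m V (poisson_of m V b c) a p
  + poisson_of m V (poisson_of m V c a) b p = 0.
Proof.
move=> Va Vb Vc Vp; have B1 := m_bilocal 1.
have m1 x y : fn M V x -> fn M V y -> fn M V (m 1 V x y) by exact: (bl_fn B1).
have pE x y z : fn M V x -> fn M V y -> fn M V z ->
    poisson_of m V (poisson_of m V x y) z p =
    m 1 V (m 1 V x y) z p - m 1 V (m 1 V y x) z p
    - (m 1 V z (m 1 V x y) p - m 1 V z (m 1 V y x) p).
  move=> Vx Vy Vz; rewrite {1}/poisson_of.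
  by rewrite (bl_subl B1 (m1 _ _ Vx Vy) (m1 _ _ Vy Vx) Vz Vp)
    (bl_subr B1 (m1 _ _ Vx Vy) (m1 _ _ Vy Vx) Vz Vp).
rewrite !pE //.
have comm (x y : M -> R[i]) : (fun p => x p * y p) = (fun p => y p * x p).
  by apply: boolp.funext => q; rewrite mulrC.
have h1 := hochschild2 Va Vb Vc Vp; have h2 := hochschild2 Vb Vc Va Vp.
have h3 := hochschild2 Vc Va Vb Vp; have h4 := hochschild2 Vb Va Vc Vp.
have h5 := hochschild2 Va Vc Vb Vp; have h6 := hochschild2 Vc Vb Va Vp.
rewrite (comm b a) in h4 h6; rewrite (comm c b) in h6 h5; rewrite (comm a c) in h4 h5.
(* [li] and [ri] are the iterated [m 1] bracketed to the left and to the right. *)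
have aux (l1 l2 l3 l4 l5 l6 r1 r2 r3 r4 r5 r6 : R[i]) :
  l1 + l2 + l3 - l4 - l5 - l6 = r1 + r2 + r3 - r4 - r5 - r6 ->
  l1 - l4 - (r3 - r6) + (l2 - l6 - (r1 - r5)) + (l3 - l5 - (r2 - r4)) = 0.
  move=> H.
  have -> : l1 - l4 - (r3 - r6) + (l2 - l6 - (r1 - r5)) + (l3 - l5 - (r2 - r4)) =
   (l1 + l2 + l3 - l4 - l5 - l6) - (r1 + r2 + r3 - r4 - r5 - r6) by ring.
  by rewrite H subrr.
apply: aux.
have mid (x1 l1 y1 z1 r1 w1 : R[i]) : x1 + l1 + y1 = z1 + r1 + w1 ->
   l1 = z1 + r1 + w1 - x1 - y1 by move=> <-; ring.
rewrite (mid _ _ _ _ _ _ h1) (mid _ _ _ _ _ _ h2) (mid _ _ _ _ _ _ h3).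
rewrite (mid _ _ _ _ _ _ h4) (mid _ _ _ _ _ _ h5) (mid _ _ _ _ _ _ h6).
ring.
Qed.

End Associative.
End Bidifferential.

(** * Bivector fields of skew-symmetric tensors *)

Section SkewSums.
Context {C : comPzRingType} {n : nat}.
Implicit Types (r X Y : 'I_n -> 'I_n -> C) (Z : 'I_n -> 'I_n -> 'I_n -> C)
  (A B U : 'I_n -> C).

Lemma sum_skew r (F : 'I_n -> 'I_n -> C) : (forall i j, r j i = - r i j) ->
  \sum_i \sum_j r i j * F j i = - \sum_i \sum_j r i j * F i j.
Proof.
move=> rs; rewrite exchange_big -sumrN; apply: eq_bigr => i _.
by rewrite -sumrN; apply: eq_bigr => j _; rewrite rs mulNr.
Qed.

Definition contract r A i : C := \sum_j r i j * A j.

(** The shape common to the three terms of the Yang-Baxter expression and to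
    the commutators arising in the Jacobi sum of a bivector field. *)
Definition triple Z r U A B : C :=
  \sum_p \sum_i \sum_j Z i j p * U p * contract r A i * contract r B j.

Lemma triple_swap Z r U A B : (forall i j p, Z j i p = - Z i j p) ->
  triple Z r U B A = - triple Z r U A B.
Proof.
move=> Zs; rewrite /triple -sumrN; apply: eq_bigr => p _.
rewrite exchange_big -sumrN; apply: eq_bigr => i _.
rewrite -sumrN; apply: eq_bigr => j _; rewrite Zs; ring.
Qed.

Lemma sum_product A B : (\sum_i A i) * (\sum_j B j) = \sum_i \sum_j A i * B j.
Proof. by rewrite mulr_suml; apply: eq_bigr => i _; rewrite mulr_sumr. Qed.

Lemma exchange22 (F : 'I_n -> 'I_n -> 'I_n -> 'I_n -> C) :
  \sum_q \sum_t \sum_i \sum_j F q t i j = \sum_i \sum_j \sum_q \sum_t F q t i j.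
Proof.
rewrite pair_bigA /=.
under eq_bigr do rewrite pair_bigA /=.
rewrite exchange_big /= [RHS]pair_bigA /=.
by apply: eq_bigr => -[i j] _ /=; rewrite pair_bigA.
Qed.

Lemma triple_expand1 Z r U A B :
  \sum_p \sum_q \sum_t (\sum_i \sum_j r i q * r j t * Z i j p) * U p * A q * B t =
  triple Z r U A B.
Proof.
apply: eq_bigr => p _.
under eq_bigr => q _ do under eq_bigr => t _ do
  (rewrite !mulr_suml; under eq_bigr do rewrite !mulr_suml).
rewrite exchange22; apply: eq_bigr => i _; apply: eq_bigr => j _.
rewrite /contract -mulrA sum_product mulr_sumr; apply: eq_bigr => q _.
rewrite mulr_sumr; apply: eq_bigr => t _; ring.
Qed.

Lemma triple_expand2 Z r U A B :
  \sum_k \sum_l \sum_i \sum_j r k l * r i j * (\sum_p Z k i p * U p) * A j * B l =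
  triple Z r U B A.
Proof.
rewrite /triple [RHS]exchange_big; apply: eq_bigr => k _.
rewrite exchange_big [RHS]exchange_big; apply: eq_bigr => i _ /=.
rewrite -!mulr_suml -mulrA /contract sum_product mulr_sumr.
apply: eq_bigr => l _; rewrite mulr_sumr; apply: eq_bigr => j _; ring.
Qed.

End SkewSums.

Section TensorFields.
Context {R : realType} {k : category} {G : lie_group (model_of R k)}.
Context {g : lie_algebra_of G} {M : G_manifold G}.
Implicit Types (V W : set M) (a b c : M -> R[i]).

Hypothesis g_der : forall x : g, derivation setT (inf_act x : op M).

Lemma inf_fn (x : g) V a : fn M V a -> fn M V (inf_act x V a).
Proof. exact: (der_fn (g_der x)). Qed.

Context {r : tensor2 g}.

Local Notation D i := (@inf_act R k G g M (basg i)).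
Local Notation rM := (tensor2M (M := M) r).

Lemma der_tensor2M D0 (xi : op M) V a b p : derivation D0 xi -> V `<=` D0 ->
  fn M V a -> fn M V b -> V p -> xi V (rM V a b) p =
  \sum_i \sum_j r i j * (xi V (D i V a) p * D j V b p + D i V a p * xi V (D j V b) p).
Proof.
move=> dx VD Va Vb Vp; have oV := fn_open Va.
have fn1 i j : fn M V (fun p => D i V a p * D j V b p).
  by apply: fn_mul; exact: inf_fn.
have fn2 i j : fn M V (fun p => r i j * (D i V a p * D j V b p)) by exact: fn_cmul.
have -> : rM V a b = fun p => \sum_i \sum_j r i j * (D i V a p * D j V b p).
  apply: boolp.funext => q; apply: eq_bigr => i _; apply: eq_bigr => j _.
  by rewrite mulrA.
rewrite (der_sum dx _ VD oV _ Vp); last by move=> i; exact: fn_sum.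
apply: eq_bigr => i _; rewrite (der_sum dx _ VD oV (fn2 i) Vp).
apply: eq_bigr => j _; rewrite (der_cmul dx _ VD (fn1 i j) Vp).
by rewrite (der_mul dx VD (inf_fn _ Va) (inf_fn _ Vb) Vp).
Qed.

Hypothesis r_skew : skew2 r.

Lemma tensor2M_bracket : bracket rM.
Proof.
have fn2 V a b i j : fn M V a -> fn M V b ->
    fn M V (fun p => r i j * D i V a p * D j V b p).
  by move=> Va Vb; apply: fn_mul; [apply: fn_cmul|]; exact: inf_fn.
split; [| | | |split].
- move=> V a b Va Vb; have oV := fn_open Va.
  by apply: fn_sum => // i; apply: fn_sum => // j; exact: fn2.
- move=> V a b a' b' Va Vb aa bb p Vp; apply: eq_bigr => i _; apply: eq_bigr => j _.
  by rewrite (der_eq (g_der _) (@subsetT _ _) Va aa Vp)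
    (der_eq (g_der _) (@subsetT _ _) Vb bb Vp).
- move=> V W a b oW WV Va Vb p Wp; apply: eq_bigr => i _; apply: eq_bigr => j _.
  by rewrite (der_res (g_der _) (@subsetT _ _) oW WV Va Wp)
    (der_res (g_der _) (@subsetT _ _) oW WV Vb Wp).
- move=> V e a b d Va Vb Vd p Vp.
  rewrite /tensor2M mulr_sumr -big_split; apply: eq_bigr => i _ /=.
  rewrite mulr_sumr -big_split; apply: eq_bigr => j _ /=.
  by rewrite (der_lin (g_der _) e (@subsetT _ _) Va Vb Vp); ring.
- move=> V a b Va Vb p Vp; rewrite /tensor2M.
  under eq_bigr do under eq_bigr do rewrite -mulrA.
  under [X in _ = - X]eq_bigr do under eq_bigr do rewrite -mulrA.
  rewrite -(sum_skew (fun i j => D i V b p * D j V a p) r_skew).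
  by apply: eq_bigr => i _; apply: eq_bigr => j _; rewrite [X in _ * X]mulrC.
- move=> V a b c Va Vb Vc p Vp.
  rewrite /tensor2M mulr_sumr mulr_suml -big_split; apply: eq_bigr => i _ /=.
  rewrite mulr_sumr mulr_suml -big_split; apply: eq_bigr => j _ /=.
  by rewrite (der_mul (g_der _) (@subsetT _ _) Va Vb Vp); ring.
Qed.

Section Mixed.
Context {f : biop M} (fB : bracket f).
Hypothesis f_inv : forall (x : g) V a b, fn M V a -> fn M V b ->
  eq_on V (inf_act x V (f V a b))
          (fun p => f V (inf_act x V a) b p + f V a (inf_act x V b) p).

Definition mixed_term V a b c (p : M) : R[i] :=
  \sum_i \sum_j r i j * (D i V a p * f V (D j V b) c p).

Lemma bracket_tensor V a b c p : fn M V a -> fn M V b -> fn M V c -> V p ->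
  f V (rM V a b) c p = mixed_term V a b c p - mixed_term V b a c p.
Proof.
move=> Va Vb Vc Vp.
rewrite (der_tensor2M (bracket_derivation fB Vc) (@subset_refl _ _) Va Vb Vp).
rewrite -(sum_skew (fun i j => D i V b p * f V (D j V a) c p) r_skew).
rewrite -big_split; apply: eq_bigr => i _ /=.
by rewrite -big_split; apply: eq_bigr => j _ /=; ring.
Qed.

Lemma tensor_bracket V a b c p : fn M V a -> fn M V b -> fn M V c -> V p ->
  rM V (f V a b) c p = mixed_term V c b a p - mixed_term V c a b p.
Proof.
move=> Va Vb Vc Vp.
rewrite -(sum_skew (fun i j => D i V c p * f V (D j V a) b p) r_skew).
apply/eqP; rewrite -subr_eq0; apply/eqP.
have -> : mixed_term V c b a p = - \sum_i \sum_j r i j * (D j V c p * f V (D i V b) a p).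
  by rewrite (sum_skew (fun i j => D i V c p * f V (D j V b) a p) r_skew) opprK.
rewrite /tensor2M -!sumrN -!big_split -sumrB big1 // => i _ /=.
rewrite -!sumrN -!big_split -sumrB big1 // => j _ /=.
rewrite (f_inv (basg i) Va Vb Vp).
rewrite (br_skew fB Va (inf_fn (basg i) Vb) Vp); ring.
Qed.

(** The Schouten bracket of an invariant bivector field with the field of a
    tensor vanishes.  By the Leibniz rule and by invariance every term becomes a
    [mixed_term], and these cancel in pairs. *)
Lemma mixed_vanish V a b c p : fn M V a -> fn M V b -> fn M V c -> V p ->
  f V (rM V a b) c p + f V (rM V b c) a p + f V (rM V c a) b p
  + (rM V (f V a b) c p + rM V (f V b c) a p + rM V (f V c a) b p) = 0.
Proof.
move=> Va Vb Vc Vp; rewrite !bracket_tensor // !tensor_bracket //; ring.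
Qed.

End Mixed.

Hypothesis g_lin : forall (e : R[i]) (x y : g) V a, fn M V a ->
  eq_on V (inf_act (e *: x + y) V a : M -> R[i])
          (fun p => e * inf_act x V a p + inf_act y V a p).
Hypothesis g_br : forall (x y : g) V a, fn M V a ->
  eq_on V (inf_act (br x y) V a : M -> R[i])
    (fun p => inf_act x V (inf_act y V a) p - inf_act y V (inf_act x V a) p).

Lemma inf_act_sum V a p (x : 'I_(dimg g) -> g) (e : 'I_(dimg g) -> R[i]) : fn M V a ->
  V p -> inf_act (\sum_i e i *: x i) V a p = \sum_i e i * inf_act (x i) V a p.
Proof.
move=> Va Vp.
have z : inf_act (0 : g) V a p = 0.
  have := g_lin 1 0 0 Va Vp; rewrite scale1r addr0 mul1r.
  by move/esym/eqP; rewrite -subr_eq0 addrK => /eqP.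
elim: (index_enum _) => [|i s IH]; first by rewrite !big_nil.
by rewrite !big_cons (g_lin _ _ _ Va Vp) IH.
Qed.

Lemma commutator_struct V a i j p : fn M V a -> V p ->
  D i V (D j V a) p - D j V (D i V a) p = \sum_q struct_cst i j q * D q V a p.
Proof.
move=> Va Vp; rewrite -(g_br _ _ Va Vp) -(inf_act_sum _ _ Va Vp).
congr (inf_act _ V a p).
by rewrite {1}(coord_vbasis (memvf (br (basg i) (basg j)))).
Qed.

(** The part of [rM (rM a b) c] in which [a] is differentiated twice. *)
Definition hessian_term V a b c (p : M) : R[i] :=
  \sum_k \sum_l r k l * \sum_i \sum_j r i j *
     (D k V (D i V a) p * D j V b p * D l V c p).

Lemma tensor_tensor V a b c p : fn M V a -> fn M V b -> fn M V c -> V p ->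
  rM V (rM V a b) c p = hessian_term V a b c p - hessian_term V b a c p.
Proof.
move=> Va Vb Vc Vp; rewrite /hessian_term -sumrB; apply: eq_bigr => k' _.
rewrite -sumrB; apply: eq_bigr => l _; rewrite -mulrBr -mulrA; congr (_ * _).
rewrite (der_tensor2M (g_der _) (@subsetT _ _) Va Vb Vp).
rewrite -(sum_skew (fun i j => D k' V (D i V b) p * D j V a p * D l V c p) r_skew).
rewrite mulr_suml -big_split; apply: eq_bigr => i _ /=.
by rewrite mulr_suml -big_split; apply: eq_bigr => j _ /=; ring.
Qed.

(** Antisymmetry holds for commutators of vector fields, and the elements of
    the Lie algebra are determined by their fields on the group. *)
Lemma br_antisym (x y : g) : br y x = - br x y.
Proof.
apply/eqP; rewrite -subr_eq0 opprK; apply/eqP; apply: la_field_inj => V u Vu p Vp.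
have := la_field_lin 1 (br y x) (br x y) Vu Vp; rewrite scale1r => ->.
by rewrite (la_field_br _ _ Vu Vp) (la_field_br _ _ Vu Vp); ring.
Qed.

Lemma struct_cst_skew (i j q : 'I_(dimg g)) : struct_cst j i q = - struct_cst i j q.
Proof. by rewrite /struct_cst br_antisym linearN. Qed.

Local Notation T a b c V p := (triple (@struct_cst _ g) r
  (fun i => D i V a p) (fun i => D i V b p) (fun i => D i V c p)).

(** The two sums differ by the order in which two fields are applied to
    [a], hence by a commutator. *)
Lemma hessian_swap V a b c p : fn M V a -> V p ->
  hessian_term V a b c p - hessian_term V a c b p = - T a b c V p.
Proof.
move=> Va Vp; rewrite -(triple_swap _ _ _ _ struct_cst_skew) -triple_expand2.
have -> : hessian_term V a c b p = \sum_k \sum_l r k l * \sum_i \sum_j r i j *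
     (D i V (D k V a) p * D j V b p * D l V c p).
  rewrite /hessian_term.
  under eq_bigr do under eq_bigr do (rewrite mulr_sumr; under eq_bigr do rewrite mulr_sumr).
  rewrite exchange22; apply: eq_bigr => k' _; apply: eq_bigr => l _.
  rewrite mulr_sumr; apply: eq_bigr => i _; rewrite mulr_sumr.
  by apply: eq_bigr => j _; ring.
rewrite /hessian_term -sumrB; apply: eq_bigr => k' _; rewrite -sumrB.
apply: eq_bigr => l _; rewrite -mulrBr -sumrB mulr_sumr.
apply: eq_bigr => i _; rewrite -sumrB mulr_sumr.
apply: eq_bigr => j _.
by rewrite -(commutator_struct k' i Va Vp); ring.
Qed.

Lemma yang_baxter_triple V a b c p :
  tensor3M (M := M) (yang_baxter r r) V a b c p = T a b c V p + T b c a V p + T c a b V p.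
Proof.
rewrite /tensor3M /yang_baxter.
under eq_bigr do under eq_bigr do under eq_bigr do rewrite !mulrDl.
under eq_bigr do under eq_bigr do rewrite !big_split /=.
under eq_bigr do rewrite !big_split /=.
rewrite !big_split /= triple_expand1; congr (_ + _ + _).
  rewrite (triple_swap _ _ _ _ struct_cst_skew) -triple_expand1 exchange_big -sumrN.
  apply: eq_bigr => q _; rewrite -sumrN; apply: eq_bigr => i _.
  rewrite -sumrN; apply: eq_bigr => t _; rewrite !mulr_suml -sumrN.
  apply: eq_bigr => j _; rewrite !mulr_suml -sumrN.
  by apply: eq_bigr => l _; rewrite (r_skew j i); ring.
rewrite -triple_expand1; under eq_bigr do rewrite exchange_big /=.
rewrite exchange_big; apply: eq_bigr => t _; apply: eq_bigr => i _.
apply: eq_bigr => q _; rewrite !mulr_suml.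
apply: eq_bigr => j _; rewrite !mulr_suml.
by apply: eq_bigr => l _; rewrite (r_skew j i) (r_skew l q); ring.
Qed.

(** In the cyclic sum the terms with a second derivative of a given argument
    form one difference as in [hessian_swap]; the commutators which remain are
    the terms of the Yang-Baxter expression. *)
Lemma tensor_jacobi V a b c p : fn M V a -> fn M V b -> fn M V c -> V p ->
  rM V (rM V a b) c p + rM V (rM V b c) a p + rM V (rM V c a) b p =
  - tensor3M (M := M) (yang_baxter r r) V a b c p.
Proof.
move=> Va Vb Vc Vp; rewrite yang_baxter_triple !tensor_tensor // !opprD.
rewrite -(hessian_swap b c Va Vp) -(hessian_swap c a Vb Vp) -(hessian_swap a b Vc Vp).
ring.
Qed.

End TensorFields.

(** * Invariant quantizations *)

Section LinearMaps.
Context {F : fieldType} {U W : lmodType F} {h : U -> W} (hl : linear h).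

Lemma linear_add u v : h (u + v) = h u + h v.
Proof. by have := hl 1 u v; rewrite !scale1r. Qed.

Lemma linear_zero : h 0 = 0.
Proof. by apply: (addrI (h 0)); rewrite -linear_add !addr0. Qed.

Lemma linear_scale e u : h (e *: u) = e *: h u.
Proof. by have := hl e u 0; rewrite !addr0 linear_zero addr0. Qed.

Lemma linear_sub u v : h (u - v) = h u - h v.
Proof. by rewrite -scaleN1r linear_add linear_scale scaleN1r. Qed.

Lemma linear_sumE (I : finType) (u : I -> U) : h (\sum_i u i) = \sum_i h (u i).
Proof.
elim: (index_enum _) => [|i s IH]; first by rewrite !big_nil linear_zero.
by rewrite !big_cons linear_add IH.
Qed.

End LinearMaps.

Section Coproduct.
Context {F : fieldType} {g : lie_algebra F} {Ug : enveloping g}.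
Context {T2 : tensor_product Ug Ug} {T3 : tensor_product T2 Ug}.
Local Notation e x := (ug_in Ug x).
Local Notation "u \ox v" := (tens T2 u v) (at level 38).

Lemma primitive_lie_hom : lie_hom (fun x => e x \ox 1 + 1 \ox e x).
Proof.
have [el eb] := ug_in_hom Ug; have [tr tl] := tens_bilinear T2.
split=> [c x y|x y]; first by rewrite el tl tr scalerDr addrACA.
rewrite eb (linear_sub (tl 1)) (linear_sub (tr 1)).
rewrite !mulrDl !mulrDr !tensM !mulr1 !mul1r.
have E (A : zmodType) (p q s t p' t' : A) :
    (p - p') + (t - t') = p + q + (s + t) - (p' + s + (q + t')).
  rewrite [s + t]addrC [p + q + _]addrACA [q + t']addrC [p' + s + _]addrACA.
  by rewrite [s + q]addrC [in RHS]opprD [RHS]addrACA subrr addr0 opprD addrACA.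
exact: E.
Qed.

Lemma comul_primitive x : comul T2 (e x) = e x \ox 1 + 1 \ox e x.
Proof. exact: (@ug_liftE _ _ Ug T2 _ primitive_lie_hom). Qed.

Lemma psmul0 (A : pzRingType) (x y : nat -> A) : psmul x y 0 = x 0 * y 0.
Proof. by rewrite /psmul big_ord1. Qed.

Lemma psmul1 (A : pzRingType) (x y : nat -> A) : psmul x y 1 = x 0 * y 1%N + x 1%N * y 0.
Proof. by rewrite /psmul big_ord_recl big_ord1. Qed.

Context {r : tensor2 g} (Q : quantum_group T3 r).

Lemma qg_Finv0 : qg_Finv Q 0 = 1.
Proof. by have := qg_FFinv Q 0; rewrite psmul0 qg_F0 mul1r. Qed.

Lemma qg_Finv1 : qg_Finv Q 1 = - qg_F Q 1.
Proof.
have := qg_FFinv Q 1; rewrite psmul1 qg_F0 qg_Finv0 mul1r mulr1 => /eqP.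
by rewrite addr_eq0 => /eqP.
Qed.

Lemma comulh0 u : comulh Q u 0 = comul T2 u.
Proof. by rewrite /comulh psmul0 qg_F0 qg_Finv0 mul1r mulr1. Qed.

(** Conjugation by [1 + h F_1] has the first-order effect of the commutator with
    [F_1 = r / 2]. *)
Lemma comulh1 u : comulh Q u 1 =
  2%:R^-1 *: (to_T2 T2 r * comul T2 u - comul T2 u * to_T2 T2 r).
Proof.
rewrite /comulh psmul1 qg_F0 qg_Finv0 qg_Finv1 mul1r mulr1 qg_F1 mulrN addrC.
by rewrite scalerBr -scalerAl -scalerAr.
Qed.

End Coproduct.

Section Quantization.
Context {R : realType} {k : category} {G : lie_group (model_of R k)}.
Context {g : lie_algebra_of G} {M : G_manifold G}.
Context {Ug : enveloping g} {T2 : tensor_product Ug Ug} {T3 : tensor_product T2 Ug}.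
Context {ac : env_action M Ug} {r : tensor2 g} {Q : quantum_group T3 r}.
Context {m : nat -> biop M} (mq : invariant_quantization ac Q m).
Implicit Types (V W : set M) (a b c : M -> R[i]).

Let m_bl i : bilocal (m i) := m_bilocal (iq_m0 mq) (iq_bidiff mq) i.

Lemma quantum_action_linear (e : R[i]) (x y : g) V a : fn M V a ->
  eq_on V (inf_act (e *: x + y) V a : M -> R[i])
          (fun p => e * inf_act x V a p + inf_act y V a p).
Proof.
move=> Va p Vp; rewrite -!(ea_in ac _ Va Vp).
by have [-> _] := ug_in_hom Ug; rewrite (ea_lin_l ac _ _ _ Va Vp).
Qed.

Lemma ea_in2 x y V a : fn M V a ->
  eq_on V (ac (ug_in Ug x * ug_in Ug y) V a) (inf_act x V (inf_act y V a)).
Proof.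
move=> Va p Vp; have V1 := ea_fn ac (ug_in Ug y) Va.
rewrite (ea_M ac _ _ Va Vp) (ea_eq ac _ V1 (ea_in ac y Va) Vp).
by rewrite (ea_in ac x (fn_eq V1 (ea_in ac y Va)) Vp).
Qed.

Lemma quantum_action_bracket (x y : g) V a : fn M V a ->
  eq_on V (inf_act (br x y) V a : M -> R[i])
    (fun p => inf_act x V (inf_act y V a) p - inf_act y V (inf_act x V a) p).
Proof.
move=> Va p Vp; rewrite -(ea_in ac _ Va Vp) -!(ea_in2 _ _ Va Vp).
have [_ ->] := ug_in_hom Ug; rewrite -scaleN1r addrC (ea_lin_l ac _ _ _ Va Vp).
by rewrite mulN1r addrC.
Qed.

Definition act2 i V a b p (u v : Ug) : (R[i])^o := m i V (ac u V a) (ac v V b) p.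

Lemma act2_bilinear i V a b p : fn M V a -> fn M V b -> V p ->
  bilinear_map (act2 i V a b p).
Proof.
move=> Va Vb Vp; split=> [u e v v'|v e u u']; rewrite /act2 /=.
  have Vu := ea_fn ac u Va; have Vv := ea_fn ac v Vb; have Vv' := ea_fn ac v' Vb.
  rewrite (bl_eq (m_bl i) Vu (ea_fn ac _ Vb) (fun _ _ => erefl)
    (ea_lin_l ac e v v' Vb) Vp).
  exact: (bl_linr (m_bl i) e Vv Vv' Vu Vp).
have Vv := ea_fn ac v Vb; have Vu := ea_fn ac u Va; have Vu' := ea_fn ac u' Va.
rewrite (bl_eq (m_bl i) (ea_fn ac _ Va) Vv (ea_lin_l ac e u u' Va)
  (fun _ _ => erefl) Vp).
exact: (bl_linl (m_bl i) e Vu Vu' Vv Vp).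
Qed.

Lemma act2_primitive i x V a b p : fn M V a -> fn M V b -> V p ->
  tp_lift T2 (act2 i V a b p) (comul T2 (ug_in Ug x)) =
  m i V (inf_act x V a) b p + m i V a (inf_act x V b) p.
Proof.
move=> Va Vb Vp; have bil := act2_bilinear i Va Vb Vp.
rewrite comul_primitive (linear_add (tp_lift_linear (t := T2) bil)) !(tp_liftE T2 bil).
congr (_ + _); apply: (bl_eq (m_bl i)) Vp; try exact: ea_fn.
- exact: ea_in.
- exact: ea_1.
- exact: ea_1.
- exact: ea_in.
Qed.

(** The coefficient of h^0 in the invariance of the quantization. *)
Lemma quantum_action_leibniz (x : g) V a b : fn M V a -> fn M V b ->
  eq_on V (inf_act x V (fun p => a p * b p) : M -> R[i])
          (fun p => inf_act x V a p * b p + a p * inf_act x V b p).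
Proof.
move=> Va Vb p Vp.
have Vm := bl_fn (m_bl 0) Va Vb.
have xfn c : fn M V c -> fn M V (inf_act x V c).
  by move=> Vc; exact: fn_eq (ea_fn ac _ Vc) (ea_in ac x Vc).
rewrite -(ea_in ac x (fn_mul Va Vb) Vp) -(ea_eq ac _ Vm (iq_m0 mq Va Vb) Vp).
rewrite (iq_invariant mq _ Va Vb 0 Vp) /mh_act big_ord1 subnn comulh0.
rewrite (act2_primitive 0 x Va Vb Vp).
by rewrite (iq_m0 mq (xfn _ Va) Vb Vp) (iq_m0 mq Va (xfn _ Vb) Vp).
Qed.

Lemma quantum_action_derivation (x : g) : derivation setT (inf_act x : op M).
Proof.
split.
- by move=> V a _ Va; exact: fn_eq (ea_fn ac _ Va) (ea_in ac x Va).
- move=> V a b _ Va ab p Vp; rewrite -(ea_in ac x Va Vp) -(ea_in ac x (fn_eq Va ab) Vp).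
  exact: ea_eq Vp.
- move=> V W a _ oW WV Va p Wp.
  rewrite -(ea_in ac x Va (WV _ Wp)) -(ea_in ac x (fn_res oW WV Va) Wp).
  exact: ea_res Wp.
- move=> V e a b _ Va Vb p Vp; rewrite -(ea_in ac x (fn_lin e Va Vb) Vp).
  by rewrite (ea_lin ac _ e Va Vb Vp) (ea_in ac x Va Vp) (ea_in ac x Vb Vp).
- by move=> V a b _; exact: quantum_action_leibniz.
Qed.

Let g_der := quantum_action_derivation.
Local Notation D i := (@inf_act R k G g M (basg i)).
Local Notation rM := (tensor2M (M := M) r).

Lemma act2_tensor_primitive x V a b p : fn M V a -> fn M V b -> V p ->
  tp_lift T2 (act2 0 V a b p) (to_T2 T2 r * comul T2 (ug_in Ug x)) =
  rM V (inf_act x V a) b p + rM V a (inf_act x V b) p.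
Proof.
move=> Va Vb Vp; have bil := act2_bilinear 0 Va Vb Vp.
have lin := tp_lift_linear (t := T2) bil.
rewrite comul_primitive mulr_suml (linear_sumE lin) -big_split.
apply: eq_bigr => i _ /=; rewrite mulr_suml (linear_sumE lin) -big_split.
apply: eq_bigr => j _ /=.
rewrite -scalerAl (linear_scale lin) mulrDr !tensM !mulr1 (linear_add lin).
rewrite !(tp_liftE T2 bil) /act2 !(iq_m0 mq) ?(ea_in ac) ?ea_in2 //; try exact: ea_fn.
have E (e u v w z : R[i]) : e * (u * v + w * z) = e * u * v + e * w * z by ring.
exact: E.
Qed.

Lemma act2_primitive_tensor x V a b p : fn M V a -> fn M V b -> V p ->
  tp_lift T2 (act2 0 V a b p) (comul T2 (ug_in Ug x) * to_T2 T2 r) =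
  inf_act x V (rM V a b) p.
Proof.
move=> Va Vb Vp; have bil := act2_bilinear 0 Va Vb Vp.
have lin := tp_lift_linear (t := T2) bil.
rewrite (der_tensor2M g_der (g_der x) (@subsetT _ _) Va Vb Vp).
rewrite comul_primitive mulr_sumr (linear_sumE lin).
apply: eq_bigr => i _; rewrite mulr_sumr (linear_sumE lin).
apply: eq_bigr => j _.
rewrite -scalerAr (linear_scale lin) mulrDl !tensM !mul1r (linear_add lin).
by rewrite !(tp_liftE T2 bil) /act2 !(iq_m0 mq) ?(ea_in ac) ?ea_in2 //; exact: ea_fn.
Qed.

(** The coefficient of h in the invariance of the quantization: the defect of
    invariance of [m 1] is half that of the field of [r], with the opposite
    sign. *)
Lemma first_order_invariance (x : g) V a b p : fn M V a -> fn M V b -> V p ->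
  inf_act x V (m 1 V a b) p = m 1 V (inf_act x V a) b p + m 1 V a (inf_act x V b) p
  + 2%:R^-1 * (rM V (inf_act x V a) b p + rM V a (inf_act x V b) p
               - inf_act x V (rM V a b) p).
Proof.
move=> Va Vb Vp; have bil := act2_bilinear 0 Va Vb Vp.
have lin := tp_lift_linear (t := T2) bil.
rewrite -(ea_in ac x (bl_fn (m_bl 1) Va Vb) Vp) (iq_invariant mq _ Va Vb 1 Vp).
rewrite /mh_act big_ord_recl big_ord1 /= subn0 subnn comulh0 comulh1 addrC.
rewrite (act2_primitive 1 x Va Vb Vp) (linear_scale lin) (linear_sub lin).
by rewrite (act2_tensor_primitive x Va Vb Vp) (act2_primitive_tensor x Va Vb Vp).
Qed.

Definition invariant_part : biop M := fun V a b p => poisson_of m V a b p + rM V a b p.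

Lemma bracket_add (f f' : biop M) : bracket f -> bracket f' ->
  bracket (fun V a b p => f V a b p + f' V a b p).
Proof.
move=> fB fB'; split; [| | | |split].
- by move=> V a b Va Vb; apply: fn_add; exact: br_fn.
- move=> V a b a' b' Va Vb aa bb p Vp.
  by rewrite (br_eq fB Va Vb aa bb Vp) (br_eq fB' Va Vb aa bb Vp).
- move=> V W a b oW WV Va Vb p Wp.
  by rewrite (br_res fB oW WV Va Vb Wp) (br_res fB' oW WV Va Vb Wp).
- move=> V e a b d Va Vb Vd p Vp.
  by rewrite (br_lin fB e Va Vb Vd Vp) (br_lin fB' e Va Vb Vd Vp); ring.
- move=> V a b Va Vb p Vp.
  by rewrite (br_skew fB Va Vb Vp) (br_skew fB' Va Vb Vp) opprD.
- move=> V a b c Va Vb Vc p Vp.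
  by rewrite (br_leibniz fB Va Vb Vc Vp) (br_leibniz fB' Va Vb Vc Vp); ring.
Qed.

Let p_B : bracket (poisson_of m) :=
  poisson_of_bracket (iq_m0 mq) (iq_bidiff mq) (iq_assoc mq).

Hypothesis r_skew : skew2 r.
Let r_B : bracket rM := tensor2M_bracket g_der r_skew.

Lemma invariant_part_bracket : bracket invariant_part.
Proof. exact: bracket_add p_B r_B. Qed.

(** Antisymmetrization doubles the defect in [first_order_invariance], [r]
    being skew-symmetric; adding the field of [r] compensates it. *)
Lemma invariant_part_inv (x : g) V a b : fn M V a -> fn M V b ->
  eq_on V (inf_act x V (invariant_part V a b))
     (fun p => invariant_part V (inf_act x V a) b p + invariant_part V a (inf_act x V b) p).
Proof.
move=> Va Vb p Vp; have dx := g_der x.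
have Vm := bl_fn (m_bl 1).
have xfn c : fn M V c -> fn M V (inf_act x V c) by exact: (inf_fn g_der).
rewrite (der_add dx (@subsetT _ _) (br_fn p_B Va Vb) (br_fn r_B Va Vb) Vp).
rewrite (der_add dx (@subsetT _ _) (Vm _ _ _ Va Vb) (fn_opp (Vm _ _ _ Vb Va)) Vp).
rewrite (der_opp dx (@subsetT _ _) (Vm _ _ _ Vb Va) Vp).
rewrite !first_order_invariance // /invariant_part /poisson_of.
have E : inf_act x V (rM V b a) p = - inf_act x V (rM V a b) p.
  rewrite -(der_opp dx (@subsetT _ _) (br_fn r_B Va Vb) Vp).
  exact: (der_eq dx (@subsetT _ _) (br_fn r_B Vb Va) (br_skew r_B Vb Va) Vp).
rewrite E (br_skew r_B (xfn _ Vb) Va Vp) (br_skew r_B Vb (xfn _ Va) Vp).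
by field.
Qed.

Lemma poisson_decomposition V a b c p : fn M V a -> fn M V b -> fn M V c -> V p ->
  poisson_of m V (poisson_of m V a b) c p =
  invariant_part V (invariant_part V a b) c p
  - (invariant_part V (rM V a b) c p + rM V (invariant_part V a b) c p)
  + rM V (rM V a b) c p.
Proof.
move=> Va Vb Vc Vp; have fB := invariant_part_bracket.
have Vf := br_fn fB Va Vb; have Vr := br_fn r_B Va Vb.
have E : eq_on V (poisson_of m V a b) (fun q => invariant_part V a b q + - rM V a b q).
  by move=> q _; rewrite /invariant_part addrK.
have lin (h : biop M) : bracket h ->
    h V (poisson_of m V a b) c p = h V (invariant_part V a b) c p - h V (rM V a b) c p.
  move=> hB; have dh := bracket_derivation hB Vc.
  rewrite (br_eq hB (br_fn p_B Va Vb) Vc E (fun _ _ => erefl) Vp).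
  by rewrite (der_add dh (@subset_refl _ _) Vf (fn_opp Vr) Vp)
    (der_opp dh (@subset_refl _ _) Vr Vp).
have -> : poisson_of m V (poisson_of m V a b) c p =
    invariant_part V (poisson_of m V a b) c p - rM V (poisson_of m V a b) c p.
  by rewrite /invariant_part addrK.
by rewrite (lin _ fB) (lin _ r_B); ring.
Qed.

Lemma tensor3M_schouten V a b c p :
  tensor3M (M := M) (schouten r r) V a b c p =
  tensor3M (M := M) (yang_baxter r r) V a b c p + tensor3M (yang_baxter r r) V a b c p.
Proof.
rewrite /tensor3M -big_split; apply: eq_bigr => i _ /=.
rewrite -big_split; apply: eq_bigr => j _ /=.
by rewrite -big_split; apply: eq_bigr => l _ /=; rewrite /schouten; ring.
Qed.

(** Write J for the cyclic sum.  By [poisson_decomposition], J of the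
    Poisson bracket, which is 0, is J of the invariant part plus J of the field
    of [r], the mixed terms vanishing; the latter is known by
    [tensor_jacobi]. *)
Lemma invariant_part_schouten V a b c : fn M V a -> fn M V b -> fn M V c ->
  eq_on V (schoutenM invariant_part invariant_part V a b c)
          (fun p => - tensor3M (schouten r r) V a b c p).
Proof.
move=> Va Vb Vc p Vp; have fB := invariant_part_bracket.
have Jr := tensor_jacobi g_der r_skew quantum_action_linear quantum_action_bracket
  Va Vb Vc Vp.
have S := mixed_vanish g_der r_skew fB invariant_part_inv Va Vb Vc Vp.
have := poisson_of_jacobi (iq_m0 mq) (iq_bidiff mq) (iq_assoc mq) Va Vb Vc Vp.
rewrite !poisson_decomposition // tensor3M_schouten /schoutenM.
move: Jr S.
have aux (F1 F2 F3 G1 G2 G3 H1 H2 H3 K1 K2 K3 y : R[i]) :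
  K1 + K2 + K3 = - y -> G1 + G2 + G3 + (H1 + H2 + H3) = 0 ->
  F1 - (G1 + H1) + K1 + (F2 - (G2 + H2) + K2) + (F3 - (G3 + H3) + K3) = 0 ->
  - (F1 + F2 + F3 + F1 + F2 + F3) = - (y + y).
  move=> hK hG hF; have E : F1 + F2 + F3 = y.
    by apply/eqP; rewrite -subr_eq0 -(opprK y) -hK -[X in _ == X]hF
      -[X in X == _]subr0 -[X in _ - X == _]hG; apply/eqP; ring.
  by rewrite -E; ring.
exact: aux.
Qed.

Lemma quantization_bracket (G_connected : connected [set: G]) :
  poisson (poisson_of m) /\ phi_bracket (schouten r r) invariant_part.
Proof.
split; split.
- exact: p_B.
- move=> V a b c Va Vb Vc p Vp; rewrite /schoutenM.
  have J := poisson_of_jacobi (iq_m0 mq) (iq_bidiff mq) (iq_assoc mq) Va Vb Vc Vp.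
  have aux (x y z : R[i]) : x + y + z = 0 -> - (x + y + z + x + y + z) = 0.
    by move=> E; rewrite -addrA -addrA [x + (y + z)]addrA E addr0 oppr0.
  exact: aux J.
- exact: invariant_part_bracket.
- exact: bracket_G_invariant invariant_part_bracket g_der invariant_part_inv G_connected.
- exact: invariant_part_schouten.
Qed.

End Quantization.

Theorem corollary4p1 (R : realType) (k : category)
    (G : lie_group (model_of R k)) (g : lie_algebra_of G)
    (G_connected : connected [set: G]%classic) (G_semisimple : semisimple g)
    (M : G_manifold G)
    (Ug : enveloping g) (T2 : tensor_product Ug Ug)
    (T3 : tensor_product T2 Ug) (ac : env_action M Ug)
    (r : tensor2 g) (r_classical : classical_rmatrix r)
    (Q : quantum_group T3 r) (m : nat -> biop M)
    (m_quantization : invariant_quantization ac Q m) :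
  poisson (poisson_of m) /\
  exists f : biop M,
    phi_bracket (schouten r r) f /\
    forall (V : set M) (a b : M -> R[i]%C), fn M V a -> fn M V b ->
      forall p, V p -> poisson_of m V a b p = (f V a b p - tensor2M r V a b p)%R.
Proof.
case: r_classical => r_skew _.
have [pP fP] := quantization_bracket m_quantization r_skew G_connected.
split=> //; exists (invariant_part (r := r) (m := m)); split=> // V a b _ _ p _.
by rewrite /invariant_part addrK.
Qed.
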